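(* Let $A=Q_{5,1}(E,\tau)$ be a $5$-dimensional Sklyanin algebra with $\tau\in E$ a point of order $2$, and let $S=\mathrm{Max}(Z(A))$ be the set of maximal ideals of its center. Above any point of $S$ lies a $4$-dimensional simple representation of $A$, with the exception of the points of the cone above the elliptic curve $E'=E/\langle\tau\rangle$. For points on the cone above $E'$ there exists a unique $2$-dimensional simple representation, except for the trivial representation lying above the maximal ideal $(x_0^2,x_1^2,x_2^2,x_3^2,x_4^2,c_5)$.
   Context: Sklyanin algebras. Let $E=\mathbb C/\Gamma$ with $\Gamma=\mathbb Z+\mathbb Z\eta$, $\mathrm{Im}\,\eta>0$, and $n\ge3$. Put $\theta(z)=\sum_{k\in\mathbb Z}(-1)^k e^{2\pi i(kz+\frac{k(k-1)}2\eta)}$ and $$\theta_\alpha(z)=e^{2\pi i\left(\alpha z+\frac{\alpha(\alpha-n)}{2n}\eta+\frac{\alpha}{2n}\right)}\prod_{m=0}^{n-1}\theta\!\left(z+\tfrac mn+\tfrac{\alpha}{n}\eta\right),\quad\alpha\in\mathbb Z_n$$ (well defined since $\theta_{\alpha+n}=\theta_\alpha$). For $\tau\in E$ not $n$-torsion, $Q_{n,1}(E,\tau)$ is the graded $\mathbb C$-algebra generated by $x_i$, $i\in\mathbb Z_n$, with relations $\sum_{r\in\mathbb Z_n}\frac{\theta_{j-i}(0)}{\theta_{j-i-r}(-\tau)\theta_r(\tau)}x_{j-r}x_{i+r}=0$ for $i\ne j$. For $n=5$ and $\tau$ of order 2, there are $a,b\in\mathbb C$ such that the relations of $A$ are, with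 indices mod 5 and $\{x,y\}=xy+yx$, $$\{x_{1+k},x_{4+k}\}=a\,x_k^2,\qquad\{x_{2+k},x_{3+k}\}=b\,x_k^2,\qquad0\le k\le4.$$ $A$ is a graded Clifford algebra over the polynomial ring $R=\mathbb C[x_0^2,\dots,x_4^2]$ with associated symmetric matrix $$Q=\begin{bmatrix} 2x_0^2 & b x_3^2 & a x_1^2 & a x_4^2 & b x_2^2 \\ b x_3^2 & 2x_1^2 & b x_4^2 & a x_2^2 & a x_0^2 \\ a x_1^2 & b x_4^2 & 2x_2^2 & b x_0^2 & a x_3^2 \\ a x_4^2 & a x_2^2 & b x_0^2 & 2x_3^2 & b x_1^2 \\ b x_2^2 & a x_0^2 & a x_3^2 & b x_1^2 & 2x_4^2 \end{bmatrix}.$$ The center $Z(A)$ is generated by $x_0^2,\dots,x_4^2$ and an element $c_5$ of degree 5 with $c_5^2=\det Q$. The inclusion $R\subset Z(A)$ gives a double cover $\psi:S\to\mathbb A^5=\mathrm{Max}(R)$. The elliptic curve $E'=E/\langle\tau\rangle$ is viewed inside $\mathbb P^4=\mathrm{Proj}(R)$ (coordinates $x_0^2,\dots,x_4^2$) as the locus of points where $Q$ has rank $\le2$. The cone above $E'$ is the set of points of $S$ whose image under $\psi$ lies on the affine cone over $E'$ in $\mathbb A^5$. A simple (finite-dimensional complex) representation of $A$ lies above $\mathfrak m\in S$ if its kernel $\mathfrak M$ satisfies $\mathfrak M\cap Z(A)=\mathfrak m$. The trivial representation is the 1-dimensional one sending all $x_i$ to 0. *)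

(* Defs.v *)
From HB Require Import structures.
From mathcomp Require Import all_boot all_order all_algebra.
From mathcomp Require Import complex.
From mathcomp Require Import all_classical all_reals all_analysis.

Set Implicit Arguments.
Unset Strict Implicit.
Unset Printing Implicit Defensive.

Import Order.TTheory GRing.Theory Num.Theory numFieldNormedType.Exports.

Local Open Scope classical_set_scope.
Local Open Scope ring_scope.
Local Open Scope complex_scope.

Section Theta.
Variable R : realType.
Notation C := R[i].

Definition cexp (z : C) : C :=
  (expR (complex.Re z))%:C * (cos (complex.Im z) +i* sin (complex.Im z)).

(* e^(2 pi i z) *)
Definition ce (z : C) : C := cexp ((0 +i* (2 * pi)) * z).

(* (-1)^k e^(2 pi i (k z + k (k-1)/2 eta)); the sign (-1)^k, k an integer, only
   depends on the absolute value of k. *)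
Definition theta_term (eta z : C) (k : int) : C :=
  (-1) ^+ `|k|%N * ce (k%:~R * z + (k * (k - 1))%:~R / 2 * eta).

(* The sum over Z converges absolutely for Im eta > 0; its terms are grouped in
   pairs (k, -(k+1)), k >= 0. R[i]^o is R[i] as a normed module over itself. *)
Definition theta (eta z : C) : C :=
  limn (series (fun k : nat =>
    theta_term eta z k%:Z + theta_term eta z (- k.+1%:Z)) : nat -> R[i]^o).

(* theta_(alpha + n) = theta_alpha, so alpha mod n is given here by a natural
   number representing it. *)
Definition theta_ (n : nat) (eta : C) (alpha : nat) (z : C) : C :=
  ce (alpha%:R * z
      + alpha%:R * (alpha%:R - n%:R) / (2 * n%:R) * eta
      + alpha%:R / (2 * n%:R))
  * \prod_(m < n) theta eta (z + m%:R / n%:R + alpha%:R / n%:R * eta).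

Definition in_lattice (eta z : C) : Prop :=
  exists p q : int, z = p%:~R + q%:~R * eta.

Definition order_two_point (eta tau : C) : Prop :=
  ~ in_lattice eta tau /\ in_lattice eta (2 * tau).

End Theta.

Section Presentations.
Variable K : fieldType.

(* A is the K-algebra generated by the x i subject to the relations rel, where
   rel B y means that the family y of elements of B satisfies the relations. *)
Definition presented_by (I : Type) (rel : forall B : algType K, (I -> B) -> Prop)
    (A : algType K) (x : I -> A) : Prop :=
  rel A x /\
  forall (B : algType K) (y : I -> B), rel B y ->
    (exists f : {lrmorphism A -> B}, forall i, f (x i) = y i) /\
    (forall f g : {lrmorphism A -> B}, (forall i, f (x i) = g (x i)) -> f =1 g).

(* For a presentation by homogeneous relations with all x i of degree 1, the
   component of degree d is spanned by the words of length d. *)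
Definition homogeneous_of_degree (I : finType) (A : algType K) (x : I -> A)
    (d : nat) (u : A) : Prop :=
  exists f : d.-tuple I -> K, u = \sum_(w : d.-tuple I) f w *: \prod_(i <- w) x i.

Variable A : algType K.

Definition center : set A := [set z | forall u : A, z * u = u * z].

Definition subalgebra (B : set A) : Prop :=
  [/\ B 1,
      forall (c : K) u v, B u -> B v -> B (c *: u + v)
    & forall u v, B u -> B v -> B (u * v)].

Definition generated_subalgebra (G : set A) : set A :=
  [set u | forall B : set A, subalgebra B -> G `<=` B -> B u].

Definition center_ideal (I : set A) : Prop :=
  [/\ I `<=` center, I 0,
      forall u v, I u -> I v -> I (u + v)
    & forall z u, center z -> I u -> I (z * u)].

Definition generated_center_ideal (G : set A) : set A :=
  [set u | forall I : set A, center_ideal I -> G `<=` I -> I u].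

(* m is a point of Max(Z(A)). *)
Definition maximal_center_ideal (m : set A) : Prop :=
  [/\ center_ideal m, ~ m 1
    & forall I : set A, center_ideal I -> ~ I 1 -> m `<=` I -> I = m].

(* Representations of dimension d.+1, acting on column vectors. *)
Definition simple_rep (d : nat) (rho : {lrmorphism A -> 'M[K]_d.+1}) : Prop :=
  forall V : {vspace 'cV[K]_d.+1},
    (forall (u : A) v, v \in V -> rho u *m v \in V) ->
    V = 0%VS \/ V = fullv.

Definition isomorphic_reps (d : nat) (rho rho' : {lrmorphism A -> 'M[K]_d.+1}) :
    Prop :=
  exists2 P : 'M[K]_d.+1, P \in unitmx & forall u, P *m rho u = rho' u *m P.

Definition lies_above (d : nat) (rho : {lrmorphism A -> 'M[K]_d.+1})
    (m : set A) : Prop :=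
  [set u | rho u = 0] `&` center = m.

End Presentations.

Section Sklyanin.
Variable R : realType.
Notation C := R[i].

(* For n > 1, 'Z_n is the ring of integers mod n. *)
Definition sklyanin_relations (n : nat) (eta tau : C)
    (B : algType C) (y : 'Z_n -> B) : Prop :=
  forall i j : 'Z_n, i != j ->
    \sum_(r : 'Z_n)
      (theta_ n eta (val (j - i)) 0
       / (theta_ n eta (val (j - i - r)) (- tau) * theta_ n eta (val r) tau))
      *: (y (j - r) * y (i + r)) = 0.

Definition is_sklyanin_algebra (n : nat) (eta tau : C)
    (A : algType C) (x : 'Z_n -> A) : Prop :=
  presented_by (@sklyanin_relations n eta tau) x.

Definition clifford_relations (a b : C) (B : algType C) (y : 'Z_5 -> B) : Prop :=
  forall k : 'Z_5,
    y (1 + k) * y (4 + k) + y (4 + k) * y (1 + k) = a *: y k ^+ 2 /\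
    y (2 + k) * y (3 + k) + y (3 + k) * y (2 + k) = b *: y k ^+ 2.

(* The matrix Q with y k in place of x_k^2, over any ring B. *)
Definition Qmx (B : pzRingType) (a b : B) (y : 'Z_5 -> B) : 'M[B]_5 :=
  let row0 := [:: 2 * y 0; b * y 3; a * y 1; a * y 4; b * y 2] in
  let row1 := [:: b * y 3; 2 * y 1; b * y 4; a * y 2; a * y 0] in
  let row2 := [:: a * y 1; b * y 4; 2 * y 2; b * y 0; a * y 3] in
  let row3 := [:: a * y 4; a * y 2; b * y 0; 2 * y 3; b * y 1] in
  let row4 := [:: b * y 2; a * y 0; a * y 3; b * y 1; 2 * y 4] in
  \matrix_(i, j) nth 0 (nth [::] [:: row0; row1; row2; row3; row4] i) j.

(* The affine cone in A^5 over the locus E' of P^4 where Q has rank at most 2;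
   the entries of Q are linear forms, so this locus in A^5 is a cone and
   contains the vertex 0. *)
Definition affine_cone (a b : C) : set ('Z_5 -> C) :=
  [set p | (\rank (Qmx a b p) <= 2)%N].

Section Center.
Variables (A : algType C) (x : 'Z_5 -> A).

(* p is the image in A^5 = Max(C[x_0^2, ..., x_4^2]) of the point m. *)
Definition has_image (m : set A) (p : 'Z_5 -> C) : Prop :=
  forall i, m (x i ^+ 2 - (p i)%:A).

Definition on_cone (a b : C) (m : set A) : Prop :=
  exists2 p, affine_cone a b p & has_image m p.

Definition center_generators (c5 : A) : set A :=
  [set x i ^+ 2 | i in [set: 'Z_5]] `|` [set c5].

(* The entries of Q lie in the commutative ring C[x_0^2, ..., x_4^2], so the
   Leibniz formula defining \det over A gives its determinant. *)
Definition is_central_c5 (a b : C) (c5 : A) : Prop :=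
  [/\ homogeneous_of_degree x 5 c5,
      c5 ^+ 2 = \det (Qmx a%:A b%:A (fun i => x i ^+ 2))
    & @center _ A = generated_subalgebra (center_generators c5)].

Definition vertex_ideal (c5 : A) : set A :=
  generated_center_ideal (center_generators c5).

End Center.

End Sklyanin.

(* Main.v *)
(* Let u, v be the ratios theta_1/theta_0 and theta_2/theta_0 at tau, up to fifth
   roots of unity; theta_3 and theta_4 repeat them because tau has order 2.  The
   Sklyanin relations then amount to v + a u^2 + b u = 0 = u + b v^2 + a v with
   u v <> 1.  Writing theta_alpha as sums over residue classes mod 5, products of
   two such sums rearrange into bilinear expressions, giving a 3 x 3 determinant
   that vanishes, that is 2 u^3 v^3 - u^2 v^2 + u v = u^5 + v^5, and
   theta_0^2 + 4 theta_1 theta_2 = product of two theta values <> 0.  Hence U = a/2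
   and V = b/2 satisfy the same quintic equation and U V <> 0, 1; this forces Q
   never to have rank 3, 4 x 4 minors of Q being quadratic in the quadrics defining
   E', and to have rank 1 nowhere.

   A representation on which x_i^2 acts by p_i is a module over the Clifford algebra
   of Q(p).  A factorization Q = 2 L^T L turns it into an irreducible system of
   anticommuting square roots of 1, rank Q many: of dimension 4 for rank 4 or 5, and
   unique of dimension 2 for rank 2.  As C is uncountable and Z(A) has countable
   dimension, maximal ideals of Z(A) have residue field C. *)
Require Import Defs.
From HB Require Import structures.
From mathcomp Require Import all_boot all_order all_algebra.
From mathcomp Require Import complex.
From mathcomp Require Import all_classical all_reals all_analysis.
From mathcomp Require Import ring lra zify.

Set Implicit Arguments.
Unset Strict Implicit.
Unset Printing Implicit Defensive.

Import Order.TTheory GRing.Theory Num.Theory.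

Local Open Scope ring_scope.

(** * The matrix Q *)

(** The obstacle is ranks 3 and 1. Where Q has rank 3 the simple modules have dimension 2 although
    the point lies off the cone; where Q has rank 1 they have dimension 1. Both occur already for a
    = b = 0, where Q is diagonal, so the theta constants have to enter. The scalars a and b are
    known only through the fact that the same generators satisfy both presentations. As x_0^2 is
    nonzero, comparing the relations gives two linear equations for a and b, of determinant u v (u v
    - 1). If u v = 1, the Sklyanin relations would have a representation violating the Clifford
    ones. Otherwise Cramer's rule gives U = (u^2 - v^3) / D and V = (v^2 - u^3) / D with D = 2 u v
    (u v - 1), and the quintic equation for u, v turns the product into 4 u v U V = -1. So U V is
    automatically nonzero, and U V <> 1 says exactly that 1 + 4 u v <> 0: this is why the value
    theta_0^2 + 4 theta_1 theta_2 is needed. *)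

Lemma det_mx22 (R : comPzRingType) (f : nat -> nat -> R) :
  \det (\matrix_(i < 2, j < 2) f i j) = f 0 0 * f 1 1 - f 0 1 * f 1 0.
Proof.
rewrite (expand_det_row _ ord0) !big_ord_recl big_ord0 /cofactor !det_mx11 !mxE.
by rewrite /= /bump /=; ring.
Qed.

Lemma det_mx33 (R : comPzRingType) (f : nat -> nat -> R) :
  \det (\matrix_(i < 3, j < 3) f i j) =
    f 0 0 * (f 1 1 * f 2 2 - f 1 2 * f 2 1)
  - f 0 1 * (f 1 0 * f 2 2 - f 1 2 * f 2 0)
  + f 0 2 * (f 1 0 * f 2 1 - f 1 1 * f 2 0).
Proof.
rewrite (expand_det_row _ ord0) !big_ord_recl big_ord0 /cofactor.
rewrite !(expand_det_row _ ord0) !big_ord_recl !big_ord0 /cofactor !det_mx11.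
by rewrite !mxE /= /bump /=; ring.
Qed.

(** Indexing the entries by natural numbers lets the columns [bump k 0], [bump k 1], [bump k 2] left
    after deleting column [k] be computed. *)
Lemma det_mx44 (R : comPzRingType) (f : nat -> nat -> R) :
  \det (\matrix_(i < 4, j < 4) f i j) =
    \sum_(k < 4) (-1) ^+ k * f 0 k *
      (f 1 (bump k 0) * (f 2 (bump k 1) * f 3 (bump k 2)
                         - f 2 (bump k 2) * f 3 (bump k 1))
     - f 1 (bump k 1) * (f 2 (bump k 0) * f 3 (bump k 2)
                         - f 2 (bump k 2) * f 3 (bump k 0))
     + f 1 (bump k 2) * (f 2 (bump k 0) * f 3 (bump k 1)
                         - f 2 (bump k 1) * f 3 (bump k 0))).
Proof.
rewrite (expand_det_row _ ord0); apply: eq_bigr => k _.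
rewrite !mxE /cofactor add0n mulrCA mulrA.
rewrite -(det_mx33 (fun i j => f i.+1 (bump k j))); congr (_ * \det _).
by apply/matrixP => i j; rewrite !mxE.
Qed.

Section Minors.
Variables (F : fieldType) (n : nat).

Lemma mxrank_mxsub (m p : nat) (f : 'I_m -> 'I_n) (g : 'I_p -> 'I_n) (M : 'M[F]_n) :
  (\rank (mxsub f g M) <= \rank M)%N.
Proof.
rewrite -{1}(mulmx1 M) mxsub_mul rowsubE.
exact: leq_trans (mxrankM_maxl _ _) (mxrankM_maxr _ _).
Qed.

Lemma det_mxsub_eq0 (m : nat) (f g : 'I_m -> 'I_n) (M : 'M[F]_n) :
  (\rank M < m)%N -> \det (mxsub f g M) = 0.
Proof.
move=> rkM; apply/eqP; apply: contraTT rkM; rewrite -unitfE -unitmxE -leqNgt.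
by move=> /mxrank_unit {1}<-; exact: mxrank_mxsub.
Qed.

(** The rows chosen by [f] span all rows; by symmetry the columns chosen by [f] span all columns. So
    restricting the chosen rows to these columns loses no rank. *)
Lemma principal_minor_neq0 (r : nat) (M : 'M[F]_n) :
    M^T = M -> \rank M = r ->
  exists f : 'I_r -> 'I_n, \det (mxsub f f M) != 0.
Proof.
move=> symM <-; set f := maxrankfun M; exists f.
rewrite -unitfE -unitmxE -row_free_unit.
have /submxP[D defM] : (M <= rowsub f M)%MS by rewrite eq_maxrowsub.
have eqf : rowsub f M = mxsub f f M *m D^T.
  have eM : M = (rowsub f M)^T *m D^T by rewrite -trmx_mul -defM symM.
  apply: etrans (congr1 (rowsub f) eM) _; rewrite -mul_rowsub_mx; congr (_ *m _).
  by rewrite trmx_mxsub symM -mxsubrc.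
rewrite /row_free eqn_leq rank_leq_row /=.
by rewrite -{1}(eqP (maxrowsub_free M)) -/f eqf mxrankM_maxl.
Qed.

End Minors.

Section Q.
Variables (R : comPzRingType) (a b : R) (y : 'Z_5 -> R).

Lemma trmx_Qmx : (Qmx a b y)^T = Qmx a b y.
Proof.
by apply/matrixP; case=> [[|[|[|[|[|]]]]] ?] //;
   case=> [[|[|[|[|[|]]]]] ?] //; rewrite !mxE.
Qed.

(** The cyclic symmetry of Q: a statement about one index, or about one minor, carries over to its
    five shifts. *)
Lemma Qmx_shift (k : 'Z_5) :
  Qmx a b (fun i => y (i + k)) = mxsub (fun i => i + k) (fun i => i + k) (Qmx a b y).
Proof.
(* Passing to natural indices makes equal residues syntactically equal, whatever their proofs of
   being less than 5. *)
pose Y m := y (inZp m); have yE z : y z = Y (val z) by rewrite /Y valZpK.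
by apply/matrixP; case=> [[|[|[|[|[|]]]]] ?] //;
   case=> [[|[|[|[|[|]]]]] ?] //; case: k => [[|[|[|[|[|]]]]] ?] //;
   rewrite !mxE /= !yE.
Qed.

Lemma Qmx0 : Qmx a b (fun=> 0) = 0.
Proof.
by apply/matrixP; case=> [[|[|[|[|[|]]]]] ?] //;
   case=> [[|[|[|[|[|]]]]] ?] //; rewrite !mxE /= mulr0.
Qed.

End Q.

Lemma Z5_cases (i : 'Z_5) : [|| i == 0, i == 1, i == 2, i == 3 | i == 4].
Proof. by case: i => [[|[|[|[|[|]]]]] ?]. Qed.

(** * The ranks that Q avoids *)

Section RankDichotomy.
Variables (F : fieldType) (U V : F).
Hypothesis two_neq0 : (2 : F) != 0.
Hypothesis U_neq0 : U != 0.
Hypothesis V_neq0 : V != 0.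
Hypothesis UV_neq1 : U * V != 1.

Let Q := Qmx (2 * U) (2 * V).

(** If all 2 x 2 minors vanish while [y 0] is nonzero, they give V = U^4 and U = V^4, hence (U V)^3
    = 1; two further minors give (U V)^2 = 1, so U V = 1. *)
Lemma Qmx_rank_neq1 y : y 0 != 0 -> (1 < \rank (Q y))%N.
Proof.
move=> y0_neq0; rewrite ltnNge; apply: contraNN UV_neq1 => rk1.
have minor (i j k l : 'Z_5) : Q y i j * Q y k l = Q y i l * Q y k j.
  pose f m := if m is 0%N then i else k.
  pose g m := if m is 0%N then j else l.
  have := @det_mxsub_eq0 F _ 2 (fun m => f m) (fun m => g m) (Q y) rk1.
  have -> : mxsub (fun m : 'I_2 => f m) (fun m => g m) (Q y)
    = \matrix_(i < 2, j < 2) Q y (f i) (g j) by apply/matrixP => ? ?; rewrite !mxE.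
  by rewrite (det_mx22 (fun i j => Q y (f i) (g j))) /= => /eqP; rewrite subr_eq0 => /eqP.
have -> : U * V = 1; last by rewrite eqxx.
move: (minor 0 0 1 1) (minor 0 0 2 2) (minor 0 0 3 3) (minor 0 0 4 4).
move: (minor 0 0 1 4) (minor 0 0 2 3).
rewrite !mxE /=.
move: (minor 0 0 3 4) (minor 0 0 1 2); rewrite !mxE /=.
move: y0_neq0; move: (y 0) (y 1) (y 2) (y 3) (y 4) => y0 y1 y2 y3 y4 y0_neq0.
have y02_neq0 : y0 ^+ 2 != 0 by rewrite expf_neq0.
have four_neq0 : (2 * 2 : F) != 0 by rewrite mulf_neq0.
have cancel4' (u v w t c d e : F) : c != 0 ->
    2 * u * (2 * c * v) = 2 * d * w * (2 * e * t) -> c * (u * v) = d * e * (w * t).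
  by move=> _ h; apply: (mulfI four_neq0); ring: h.
move=> /[dup] h34 /(cancel4' _ _ _ _ _ _ _ V_neq0) e34 /(cancel4' _ _ _ _ _ _ _ V_neq0) e12.
move=> /(cancel4' _ _ _ _ _ _ _ U_neq0) e23 /(cancel4' _ _ _ _ _ _ _ V_neq0) e14.
move=> h1 h2 h3 h4.
have e1 : y0 * y1 = V ^+ 2 * y3 ^+ 2 by apply: (mulfI four_neq0); ring: h1.
have e2 : y0 * y2 = U ^+ 2 * y1 ^+ 2 by apply: (mulfI four_neq0); ring: h2.
have e3 : y0 * y3 = U ^+ 2 * y4 ^+ 2 by apply: (mulfI four_neq0); ring: h3.
have e4 : y0 * y4 = V ^+ 2 * y2 ^+ 2 by apply: (mulfI four_neq0); ring: h4.
have p14 : y1 * y4 = U ^+ 2 * y0 ^+ 2.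
  apply: (mulfI y02_neq0); transitivity ((y0 * y1) * (y0 * y4)); first ring.
  rewrite e1 e4; transitivity ((V * V * (y2 * y3)) ^+ 2); first ring.
  by rewrite -e23; ring.
have p23 : y2 * y3 = V ^+ 2 * y0 ^+ 2.
  apply: (mulfI y02_neq0); transitivity ((y0 * y2) * (y0 * y3)); first ring.
  rewrite e2 e3; transitivity ((U * U * (y4 * y1)) ^+ 2); first ring.
  by rewrite -e14; ring.
have VU4 : V = U ^+ 4.
  by apply: (mulIf y02_neq0); rewrite expr2 e14 mulrC (mulrC y4) p14; ring.
have UV4 : U = V ^+ 4.
  by apply: (mulIf y02_neq0); rewrite expr2 e23 mulrC p23; ring.
have UV3 : (U * V) ^+ 3 = 1.
  apply: (mulfI (mulf_neq0 U_neq0 V_neq0)).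
  transitivity (U ^+ 4 * V ^+ 4); first ring.
  by rewrite -VU4 -UV4 mulr1 mulrC.
have UV2 : (U * V) ^+ 2 = 1.
  have n14 : y1 * y4 != 0 by rewrite p14 mulf_neq0 // expf_neq0.
  apply: (mulIf y02_neq0); apply: (mulfI n14); rewrite mul1r.
  transitivity (U ^+ 2 * (V ^+ 2 * y0 ^+ 2) * (y1 * y4)); first ring.
  rewrite -p23; apply: (mulfI (expf_neq0 2 V_neq0)).
  transitivity ((U * V * (y4 * y2)) * (V * U * (y3 * y1))); first ring.
  have -> : U * V * (y4 * y2) = V * (y0 * y1) by rewrite e34; ring.
  have -> : V * U * (y3 * y1) = V * (y0 * y4) by rewrite e12; ring.
  ring.
by move: UV3; rewrite exprS UV2 mulr1.
Qed.

Section Quadrics.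
Hypothesis gUV : U ^+ 5 = 2 * U ^+ 3 * V ^+ 3 - U ^+ 2 * V ^+ 2 + U * V - V ^+ 5.
(* Up to a common factor, q0 and its cyclic shifts are the quadrics cutting out E'. *)
Let A0 := U * V * (1 - U * V).
Let A1 := U * (V ^+ 3 - U ^+ 2).
Let A2 := V * (U ^+ 3 - V ^+ 2).
Let q0 (y : 'Z_5 -> F) := A0 * y 0 ^+ 2 + A1 * y 1 * y 4 + A2 * y 2 * y 3.

(* With q_k the shifts of q0, the 4 x 4 minors of Q at (0,0), (1,4) and (2,3) are linear
   combinations of q_0^2, q_1 q_4 and q_2 q_3, with invertible coefficient matrix. *)
Lemma q_eq0 y : (\rank (Q y) <= 3)%N -> q0 y = 0.
Proof.
move=> rk3.
have minor (f g : nat -> 'Z_5) : \det (\matrix_(i < 4, j < 4) Q y (f i) (g j)) = 0.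
  rewrite -(@det_mxsub_eq0 F _ 4 (fun m => f m) (fun m => g m) (Q y) rk3).
  by congr (\det _); apply/matrixP => ? ?; rewrite !mxE.
pose idx (s : seq 'Z_5) m := nth 0 s m.
pose f1 := A0 * y 1 ^+ 2 + A1 * y 2 * y 0 + A2 * y 3 * y 4.
pose f2 := A0 * y 2 ^+ 2 + A1 * y 3 * y 1 + A2 * y 4 * y 0.
pose f3 := A0 * y 3 ^+ 2 + A1 * y 4 * y 2 + A2 * y 0 * y 1.
pose f4 := A0 * y 4 ^+ 2 + A1 * y 0 * y 3 + A2 * y 1 * y 2.
have e0 : U^+2 * V^+2 * A0^+2 * (q0 y)^+2 + (V^+4 * A0^+2 - A1^+2 * U^+2 * V^+2) * (f1 * f4)
  + (U^+4 * A0^+2 - A2^+2 * U^+2 * V^+2) * (f2 * f3) = 0.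
  apply: (mulfI (_ : 2 ^+ 4 != 0)); first by rewrite expf_neq0.
  rewrite mulr0.
  have := minor (idx [:: 1; 2; 3; 4]) (idx [:: 1; 2; 3; 4]).
  rewrite (det_mx44 (fun i j => Q y (idx _ i) (idx _ j))) /= !big_ord_recl big_ord0 /= /bump /= !mxE /=.
  (* The factor [A0 ^+ 4] clears the denominators of the minor written through the quadrics. The
     quintic relation is needed for this rewriting. *)
  move/(congr1 ( *%R (A0 ^+ 4))); rewrite mulr0 => <-.
  rewrite /f1 /f2 /f3 /f4 /q0 /A0 /A1 /A2; ring: gUV.
have e1 : U * V^+2 * A0^+2 * (q0 y)^+2 + (U^+2 * V^+2 * A0^+2 - A1^+2 * U * V^+2) * (f1 * f4)
  + (V^+2 * A0^+2 - A2^+2 * U * V^+2) * (f2 * f3) = 0.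
  apply: (mulfI (_ : 2 ^+ 4 != 0)); first by rewrite expf_neq0.
  rewrite mulr0.
  have := minor (idx [:: 0; 2; 3; 4]) (idx [:: 0; 1; 2; 3]).
  rewrite (det_mx44 (fun i j => Q y (idx _ i) (idx _ j))) /= !big_ord_recl big_ord0 /= /bump /= !mxE /=.
  move/(congr1 ( *%R (- A0 ^+ 4))); rewrite mulr0 => <-.
  rewrite /f1 /f2 /f3 /f4 /q0 /A0 /A1 /A2; ring: gUV.
have e2 : U^+2 * V * A0^+2 * (q0 y)^+2 + (U^+2 * A0^+2 - A1^+2 * U^+2 * V) * (f1 * f4)
  + (U^+2 * V^+2 * A0^+2 - A2^+2 * U^+2 * V) * (f2 * f3) = 0.
  apply: (mulfI (_ : 2 ^+ 4 != 0)); first by rewrite expf_neq0.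
  rewrite mulr0.
  have := minor (idx [:: 0; 1; 3; 4]) (idx [:: 0; 1; 2; 4]).
  rewrite (det_mx44 (fun i j => Q y (idx _ i) (idx _ j))) /= !big_ord_recl big_ord0 /= /bump /= !mxE /=.
  move/(congr1 ( *%R (- A0 ^+ 4))); rewrite mulr0 => <-.
  rewrite /f1 /f2 /f3 /f4 /q0 /A0 /A1 /A2; ring: gUV.
have A0_neq0 : A0 != 0 by rewrite !mulf_neq0 // subr_eq0 eq_sym.
apply/eqP; rewrite -[_ == 0]andTb -[true]/(0 < 2)%N -expf_eq0; apply/eqP.
(* Cramer's rule for the three equations: modulo the quintic relation the determinant of their
   coefficient matrix is [A0 ^+ 9]. *)
apply: (mulfI (expf_neq0 9 A0_neq0)); rewrite mulr0.
move: e0 e1 e2; move: (q0 y ^+ 2) (f1 * f4) (f2 * f3) => a b c e0 e1 e2.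
pose T01 := V^+4 * A0^+2 - A1^+2 * U^+2 * V^+2.
pose T02 := U^+4 * A0^+2 - A2^+2 * U^+2 * V^+2.
pose T11 := U^+2 * V^+2 * A0^+2 - A1^+2 * U * V^+2.
pose T12 := V^+2 * A0^+2 - A2^+2 * U * V^+2.
pose T21 := U^+2 * A0^+2 - A1^+2 * U^+2 * V.
pose T22 := U^+2 * V^+2 * A0^+2 - A2^+2 * U^+2 * V.
have <- : (T11 * T22 - T12 * T21) * 0 - (T01 * T22 - T02 * T21) * 0
  + (T01 * T12 - T02 * T11) * 0 = 0 :> F by ring.
rewrite -{1}e0 -{1}e1 -e2 /T01 /T02 /T11 /T12 /T21 /T22 /A0 /A1 /A2.
ring: gUV.
Qed.

Let M3 (y : 'Z_5 -> F) (i j k : 'Z_5) :=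
  \det (\matrix_(i' < 3, j' < 3) Q y (nth 0 [:: i; j; k] i') (nth 0 [:: i; j; k] j')).

(* The minors at {0,1,4} and {0,2,3} are the linear combinations S and S' of the products
   y_i q_k; the others are shifts of these. *)
Lemma principal_minor3_eq0 y : (forall k, q0 (fun i => y (i + k)) = 0) ->
  forall j k, M3 y 0 j k = 0.
Proof.
move=> q j k; have A0_neq0 : A0 != 0 by rewrite !mulf_neq0 // subr_eq0 eq_sym.
pose Y m := y (inZp m); have yE z : y z = Y (val z) by rewrite /Y valZpK.
have e0 : A0 * y 0 ^+ 2 + A1 * y 1 * y 4 + A2 * y 2 * y 3 = 0.
  by rewrite -(q 0) /q0 !yE.
have e1 : A0 * y 1 ^+ 2 + A1 * y 2 * y 0 + A2 * y 3 * y 4 = 0.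
  by rewrite -(q 1) /q0 !yE.
have e2 : A0 * y 2 ^+ 2 + A1 * y 3 * y 1 + A2 * y 4 * y 0 = 0.
  by rewrite -(q 2) /q0 !yE.
have e3 : A0 * y 3 ^+ 2 + A1 * y 4 * y 2 + A2 * y 0 * y 1 = 0.
  by rewrite -(q 3) /q0 !yE.
have e4 : A0 * y 4 ^+ 2 + A1 * y 0 * y 3 + A2 * y 1 * y 2 = 0.
  by rewrite -(q 4) /q0 !yE.
have M3E i' j' k' := det_mx33 (fun m p => Q y (nth 0 [:: i'; j'; k'] m) (nth 0 [:: i'; j'; k'] p)).
have [ei|i_neq0] := eqVneq j 0; first by rewrite ei /M3 M3E /=; ring.
have [ek|k_neq0] := eqVneq k 0; first by rewrite ek /M3 M3E /=; ring.
have [ej|j_neq0] := eqVneq k j; first by rewrite ej /M3 M3E /=; ring.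
apply: (mulfI (expf_neq0 2 A0_neq0)); apply: (mulfI two_neq0); rewrite !mulr0.
pose S (y0 y1 y2 y3 y4 : F) f0 f1 f2 f3 f4 := 2 ^+ 3 * (- U ^+ 2 * A0 * 2 * (y0 * f0) + V ^+ 2 * A1 * (y3 * f1 + y2 * f4)
   - V ^+ 2 * A0 * (y1 * f2 + y4 * f3)).
pose S' (y0 y1 y2 y3 y4 : F) f0 f1 f2 f3 f4 := 2 ^+ 3 * (- V ^+ 2 * A0 * 2 * (y0 * f0) + U ^+ 2 * A2 * (y1 * f2 + y4 * f3)
   - U ^+ 2 * A0 * (y2 * f4 + y3 * f1)).
have SE y0 y1 y2 y3 y4 f0 f1 f2 f3 f4 : f0 = 0 -> f1 = 0 -> f2 = 0 -> f3 = 0 -> f4 = 0 ->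
   S y0 y1 y2 y3 y4 f0 f1 f2 f3 f4 = 0 /\ S' y0 y1 y2 y3 y4 f0 f1 f2 f3 f4 = 0.
  by move=> -> -> -> -> ->; rewrite /S /S'; split; ring.
have [s014 s023] := SE (y 0) (y 1) (y 2) (y 3) (y 4) _ _ _ _ _ e0 e1 e2 e3 e4.
have [s102 _] := SE (y 1) (y 2) (y 3) (y 4) (y 0) _ _ _ _ _ e1 e2 e3 e4 e0.
have [s403 _] := SE (y 4) (y 0) (y 1) (y 2) (y 3) _ _ _ _ _ e4 e0 e1 e2 e3.
have [_ s301] := SE (y 3) (y 4) (y 0) (y 1) (y 2) _ _ _ _ _ e3 e4 e0 e1 e2.
have [_ s204] := SE (y 2) (y 3) (y 4) (y 0) (y 1) _ _ _ _ _ e2 e3 e4 e0 e1.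
have m014 : 2 * (A0 ^+ 2 * M3 y 0 1 4) = 0.
  by rewrite -s014 /M3 M3E /= !mxE /= /S /A0 /A1 /A2; ring: gUV.
have m023 : 2 * (A0 ^+ 2 * M3 y 0 2 3) = 0.
  by rewrite -s023 /M3 M3E /= !mxE /= /S' /A0 /A1 /A2; ring: gUV.
have m012 : 2 * (A0 ^+ 2 * M3 y 0 1 2) = 0.
  by rewrite -s102 /M3 M3E /= !mxE /= /S /A0 /A1 /A2; ring: gUV.
have m034 : 2 * (A0 ^+ 2 * M3 y 0 3 4) = 0.
  by rewrite -s403 /M3 M3E /= !mxE /= /S /A0 /A1 /A2; ring: gUV.
have m013 : 2 * (A0 ^+ 2 * M3 y 0 1 3) = 0.
  by rewrite -s301 /M3 M3E /= !mxE /= /S' /A0 /A1 /A2; ring: gUV.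
have m024 : 2 * (A0 ^+ 2 * M3 y 0 2 4) = 0.
  by rewrite -s204 /M3 M3E /= !mxE /= /S' /A0 /A1 /A2; ring: gUV.
have sym i' j' : Q y i' j' = Q y j' i' by rewrite /Q -[in LHS]trmx_Qmx mxE.
have M3C i' j' : M3 y 0 i' j' = M3 y 0 j' i'.
  by rewrite /M3 !M3E /= (sym i' 0) (sym j' 0) (sym j' i'); ring.
have := Z5_cases j; have := Z5_cases k.
rewrite (negPf i_neq0) (negPf k_neq0) !orFb.
case/or4P => /eqP ek; case/or4P => /eqP ej; move: j_neq0;
   rewrite ek ej ?eqxx // => _; first [done | rewrite M3C; done].
Qed.

(** A symmetric matrix of rank 3 has a nonzero principal 3 x 3 minor. Shifting its first index to 0
    puts it among the minors that vanish with the quadrics. *)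
Lemma Qmx_rank_neq3 y : (\rank (Q y) <= 3)%N -> (\rank (Q y) <= 2)%N.
Proof.
move=> rk3; rewrite leqNgt; apply/negP => rk2.
have {rk2} rkE : \rank (Q y) = 3%N by apply/eqP; rewrite eqn_leq rk3.
have q k : q0 (fun i => y (i + k)) = 0.
  by apply: q_eq0; rewrite /Q Qmx_shift (leq_trans (mxrank_mxsub _ _ _)).
have [f] := principal_minor_neq0 (trmx_Qmx _ _ _) rkE.
pose i := f 0; pose j := f 1; pose k := f 2%R.
suff -> : mxsub f f (Q y) = \matrix_(i' < 3, j' < 3) Q (fun z : 'Z_5 => y (z + (i : 'Z_5)))
    (nth 0 [:: 0; (j : 'Z_5) - i; (k : 'Z_5) - i] i') (nth 0 [:: 0; (j : 'Z_5) - i; (k : 'Z_5) - i] j').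
  by rewrite [\det _]principal_minor3_eq0 ?eqxx // => z; rewrite -(q (z + i)) /q0 !addrA.
apply/matrixP => i' j'; rewrite [LHS]mxE [RHS]mxE /Q Qmx_shift [RHS]mxE.
have eqf (m : 'I_3) : f m = nth 0 [:: 0; (j : 'Z_5) - i; (k : 'Z_5) - i] m + (i : 'Z_5).
  by case: m => [[|[|[|]]] lt] //=; rewrite ?subrK ?add0r; congr f; apply/val_inj.
by rewrite {1}[f i']eqf {1}[f j']eqf.
Qed.
End Quadrics.
End RankDichotomy.

(** * Modules over Clifford systems *)

(** For v with c = v Q v^T nonzero and w = v Q / sqrt c, the form Q - w^T w has v in its kernel, and
    its rank has dropped; w becomes one more row of L. *)
Lemma sym_mx_factor (K : numClosedFieldType) (n r : nat) (Q : 'M[K]_n) :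
  Q^T = Q -> (\rank Q <= r)%N -> exists L : 'M[K]_(r, n), Q = L^T *m L.
Proof.
elim: r Q => [|r IHr] Q symQ rkQ.
  exists 0; rewrite mulmx0; apply/eqP; rewrite -mxrank_eq0; by case: (\rank Q) rkQ.
have [Q0|Q_neq0] := eqVneq Q 0; first by exists 0; rewrite mulmx0.
(* Polarization: if the entry (i, j) is nonzero, the form does not vanish at all three of e_i, e_j
   and e_i + e_j, as 2 is invertible. *)
have [v cN0] : exists v : 'rV[K]_n, (v *m Q *m v^T) 0 0 != 0.
  pose B (u w : 'rV[K]_n) := (u *m Q *m w^T) 0 0.
  have BC u w : B u w = B w u.
    by rewrite /B -[in LHS](trmxK (u *m Q *m w^T)) mxE !trmx_mul trmxK symQ mulmxA.
  have [/existsP[i /existsP[j Qij]]|/existsPn noQ] := boolP [exists i, exists j, Q i j != 0]; last first.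
    case/eqP: Q_neq0; apply/matrixP => i j; rewrite mxE; apply/eqP.
    by have /existsPn/(_ j)/negbNE := noQ i.
  pose u := delta_mx 0 i : 'rV[K]_n; pose w := delta_mx 0 j : 'rV[K]_n.
  have Buw : B u w != 0.
    by rewrite /B /u /w -rowE trmx_delta -colE !mxE.
  have [Buu|] := eqVneq (B u u) 0; last by exists u.
  have [Bww|] := eqVneq (B w w) 0; last by exists w.
  exists (u + w); rewrite -/(B _ _).
  have -> : B (u + w) (u + w) = B u u + B w w + (B u w + B w u).
    by rewrite /B linearD /= !mulmxDl !mulmxDr !mxE; ring.
  by rewrite Buu Bww (BC w u) !add0r -mulr2n mulrn_eq0.
set c := (v *m Q *m v^T) 0 0 in cN0; pose s := sqrtC c.
have s2 : s ^+ 2 = c by rewrite sqrtCK.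
have s_neq0 : s != 0 by rewrite sqrtC_eq0.
pose w := s^-1 *: (v *m Q).
have wT : w^T = s^-1 *: (Q *m v^T) by rewrite /w linearZ /= trmx_mul symQ.
have vQv : v *m Q *m v^T = c%:M by rewrite [LHS]mx11_scalar.
have wv : w *m v^T = s%:M.
  by rewrite /w -scalemxAl vQv scale_scalar_mx -s2 expr2 mulKf.
pose Q' := Q - w^T *m w.
have symQ' : Q'^T = Q' by rewrite /Q' linearB /= symQ trmx_mul trmxK.
have Q'v : Q' *m v^T = 0.
  rewrite /Q' mulmxBl -mulmxA wv wT mul_mx_scalar scalerA mulfV // scale1r subrr //.
have vQ' : v *m Q' = 0 by rewrite -[LHS]trmxK trmx_mul symQ' Q'v trmx0.
have sQ'Q : (Q' <= Q)%MS.
  rewrite /Q' addmx_sub ?submx_refl // eqmx_opp.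
  by rewrite (submx_trans (submxMl _ _)) // /w scalemx_sub // submxMl.
have rkQ' : (\rank Q' < \rank Q)%N.
  rewrite ltn_neqAle mxrankS // andbT; apply/negP => /eqP rkE.
  have /submxP[D QE] : (Q <= Q')%MS by rewrite -(mxrank_leqif_sup sQ'Q).2 rkE.
  by move: cN0; rewrite /c -mulmxA QE -mulmxA Q'v !mulmx0 mxE eqxx.
have [L QL] := IHr Q' symQ' (leq_trans rkQ' rkQ).
have QE : (col_mx w L)^T *m col_mx w L = Q.
  by rewrite tr_col_mx mul_row_col -QL /Q' addrC subrK.
by exists (col_mx w L); rewrite -[LHS]QE.
Qed.

Section CliffordSystems.
Variable K : numClosedFieldType.

Definition clifford_system r d (Y : 'I_r -> 'M[K]_d) : Prop :=
  forall k l, Y k *m Y l + Y l *m Y k = ((k == l)%:R * 2)%:M.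

Definition irreducible r d (Y : 'I_r -> 'M[K]_d) : Prop :=
  forall V : {vspace 'cV[K]_d},
    (forall k v, v \in V -> Y k *m v \in V) -> V = 0%VS \/ V = fullv.

Lemma irreducible1 r (Y : 'I_r -> 'M[K]_1) : irreducible Y.
Proof.
move=> V _; have [->|V_neq0] := eqVneq V 0%VS; [by left | right].
have d1 : \dim {: 'cV[K]_1} = 1%N by rewrite dimvf /dim /= muln1.
apply/eqP; rewrite -(dimv_leqif_eq (subvf V)) d1 eqn_leq lt0n dimv_eq0 V_neq0.
by rewrite andbT (leq_trans (dimvS (subvf V))) ?d1.
Qed.

Section Double.
Variables (r d : nat) (Y : 'I_r -> 'M[K]_d).

Let A0 : 'M[K]_(d + d) := block_mx 0 1%:M 1%:M 0.
Let A1 : 'M[K]_(d + d) := block_mx 0 (- 'i)%:M 'i%:M 0.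

(* Two more generators in twice the dimension, by tensoring with the Pauli matrices. *)
Definition doubled (k : 'I_(2 + r)) : 'M[K]_(d + d) :=
  match fintype.split k with
  | inl k0 => if k0 == 0 then A0 else A1
  | inr l => block_mx (Y l) 0 0 (- Y l)
  end.

Lemma clifford_doubled : clifford_system Y -> clifford_system doubled.
Proof.
move=> cliffY k l; rewrite /doubled -(splitK k) -(splitK l) !unsplitK.
have i2 : 'i * 'i = -1 :> K by rewrite -expr2 sqrCi.
have A00 : A0 *m A0 = 1%:M.
  by rewrite mulmx_block !mul0mx !mulmx0 !mul1mx !(add0r, addr0) -scalar_mx_block.
have A11 : A1 *m A1 = 1%:M.
  by rewrite mulmx_block !mul0mx !mulmx0 -!scalar_mxM mulNr mulrN i2 opprK
     !(add0r, addr0) -scalar_mx_block.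
have A01 : A0 *m A1 + A1 *m A0 = 0.
  rewrite !mulmx_block !mul0mx !mulmx0 !mul1mx !mulmx1 !(add0r, addr0) add_block_mx.
  by rewrite !addr0 -!raddfD /= subrr addNr !raddf0 block_mx0.
have A0Y l' : A0 *m block_mx (Y l') 0 0 (- Y l') + block_mx (Y l') 0 0 (- Y l') *m A0 = 0.
  rewrite !mulmx_block !mul0mx !mulmx0 !mul1mx !mulmx1 !(add0r, addr0) add_block_mx.
  by rewrite (addrC (- Y l')) subrr addr0 block_mx0.
have A1Y l' : A1 *m block_mx (Y l') 0 0 (- Y l') + block_mx (Y l') 0 0 (- Y l') *m A1 = 0.
  rewrite !mulmx_block !mul0mx !mulmx0 !mul_scalar_mx !mul_mx_scalar !(add0r, addr0) add_block_mx.
  by rewrite !scaleNr !scalerN (addrC (- _)) !subrr addr0 block_mx0.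
have two_ord (k0 : 'I_2) : k0 = 0 \/ k0 = 1 by case: k0 => [[|[|]] ?] //; [left|right]; apply: val_inj.
case: (fintype.split k) => [k0|k1]; case: (fintype.split l) => [l0|l1] /=.
- rewrite (inj_eq (@lshift_inj _ _)).
  case: (two_ord k0) => ->; case: (two_ord l0) => -> //=; rewrite ?mul0r ?mul1r ?raddf0 //=.
  + by rewrite A00 -raddfD.
  + by rewrite addrC.
  + by rewrite A11 -raddfD.
- by rewrite eq_lrshift mul0r raddf0; case: ifP.
- by rewrite eq_rlshift mul0r raddf0 addrC; case: ifP.
rewrite (inj_eq (@rshift_inj _ _)) !mulmx_block !mul0mx !mulmx0 !(add0r, addr0).
by rewrite !mulNmx !mulmxN !opprK add_block_mx addr0 !cliffY -scalar_mx_block.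
Qed.

(** A stable subspace is W + W for the subspace W of its vectors with second half 0, and W is stable
    under the original system. *)
Lemma irreducible_doubled : irreducible Y -> irreducible doubled.
Proof.
move=> irrY V stabV.
have stab0 v : v \in V -> A0 *m v \in V.
  by move/(stabV (lshift r ord0)); rewrite /doubled (unsplitK (inl _)).
have stab1 v : v \in V -> A1 *m v \in V.
  by move/(stabV (lshift r ord_max)); rewrite /doubled (unsplitK (inl _)).
have stabY l v : v \in V -> block_mx (Y l) 0 0 (- Y l) *m v \in V.
  by move/(stabV (rshift 2 l)); rewrite /doubled (unsplitK (inr _)).
(* The product - i A0 A1 is diag(1, -1), so averaging a vector with its image keeps the first half
   only. *)
have proj v1 v2 : col_mx v1 v2 \in V -> col_mx v1 0 \in V.
  move=> Vv; have /stab1/stab0/(memvZ (- 'i)) := Vv.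
  rewrite mul_block_col !mul0mx add0r addr0 !mul_scalar_mx.
  rewrite mul_block_col !mul0mx add0r addr0 !mul1mx scale_col_mx !scalerA.
  rewrite !mulNr !mulrN -!expr2 !sqrCi !opprK scale1r scaleN1r => Vw.
  have := memvZ 2^-1 (memvD Vv Vw).
  by rewrite add_col_mx subrr scale_col_mx scaler0 -mulr2n -scaler_nat scalerA mulVf
       ?scale1r // pnatr_eq0.
have swap v1 v2 : col_mx v1 v2 \in V -> col_mx v2 v1 \in V.
  by move/stab0; rewrite mul_block_col !mul0mx add0r addr0 !mul1mx.
pose W := (linfun (mulmx (col_mx 1%:M 0 : 'M[K]_(d + d, d))) @^-1: V)%VS.
have memW w : (w \in W) = (col_mx w 0 \in V).
  by rewrite -memv_preim lfunE /= mul_col_mx mul1mx mul0mx.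
have stabW k w : w \in W -> Y k *m w \in W.
  rewrite !memW => /(stabY k).
  by rewrite mul_block_col !mul0mx mulmx0 !addr0.
have memV v : v \in V -> usubmx v \in W /\ dsubmx v \in W.
  rewrite -{1}(vsubmxK v) !memW => Vv; split; first exact: proj Vv.
  exact: proj (swap _ _ Vv).
have [W0|Wfull] := irrY W stabW; [left | right].
  apply/eqP; rewrite -subv0; apply/subvP => v /memV[].
  rewrite W0 !memv0 => /eqP u0 /eqP d0.
  by rewrite -(vsubmxK v) u0 d0 col_mx0.
apply/eqP; rewrite eqEsubv subvf /=; apply/subvP => v _.
have inV w : col_mx w 0 \in V by rewrite -memW Wfull memvf.
rewrite -(vsubmxK v) -[usubmx v]addr0 -[dsubmx v]add0r -add_col_mx.
by rewrite memvD // swap.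
Qed.
End Double.

Lemma clifford_system2 :
  exists2 Y : 'I_2 -> 'M[K]_2, clifford_system Y & irreducible Y.
Proof.
pose Y0 (k : 'I_0) : 'M[K]_1 := 0.
exists (doubled Y0); first by apply: (@clifford_doubled 0 1) => - [].
exact/(@irreducible_doubled 0 1)/irreducible1.
Qed.

(** Doubling twice in dimension 1, from the empty system for 4 = 2 + 2 + 0 and from the single
    matrix 1 for 5 = 2 + 2 + 1. *)
Lemma clifford_system4 (r : nat) : (3 < r <= 5)%N ->
  exists2 Y : 'I_r -> 'M[K]_4, clifford_system Y & irreducible Y.
Proof.
move=> r_bd; have /orP[/eqP->|/eqP->] : (r == 4%N) || (r == 5%N).
- by case: r r_bd => [|[|[|[|[|[|]]]]]].
- have [Y cliffY irrY] := clifford_system2; exists (doubled Y).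
    exact: (@clifford_doubled 2 2).
  exact: (@irreducible_doubled 2 2).
pose Y0 (k : 'I_1) : 'M[K]_1 := 1%:M.
exists (doubled (doubled Y0)).
  apply: (@clifford_doubled 3 2); apply: (@clifford_doubled 1 1) => k l.
  by rewrite /Y0 !ord1 eqxx mul1mx mul1r -raddfD.
exact/(@irreducible_doubled 3 2)/(@irreducible_doubled 1 1)/irreducible1.
Qed.

End CliffordSystems.

(** * Modules over a quadratic form and systems of anticommuting square roots of 1 *)

Section CliffordModules.
Variables (K : numClosedFieldType) (n : nat) (Q : 'M[K]_n).
Hypothesis symQ : Q^T = Q.

Definition clifford_module d (X : 'I_n -> 'M[K]_d) : Prop :=
  forall i j, X i *m X j + X j *m X i = (Q i j)%:M.

(** With exactly [\rank Q] rows, L has independent rows; the right inverse B is what recovers the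
    square roots of 1 from the operators of a module. *)
Lemma sym_mx_split_factor :
  exists (L : 'M[K]_(\rank Q, n)) (B : 'M[K]_(n, \rank Q)),
    Q = 2 *: (L^T *m L) /\ L *m B = 1%:M.
Proof.
have two_neq0 : (2 : K) != 0 by rewrite pnatr_eq0.
have sym2 : (2^-1 *: Q)^T = 2^-1 *: Q by rewrite linearZ /= symQ.
have rk2 : (\rank (2^-1 *: Q) <= \rank Q)%N by rewrite mxrank_scale_nz ?invr_eq0.
have [L QL] := sym_mx_factor sym2 rk2.
exists L, (pinvmx L); split; first by rewrite -QL scalerA mulfV // scale1r.
rewrite mulmxVp // /row_free eqn_leq rank_leq_row /=.
rewrite -[X in (X <= _)%N](@mxrank_scale_nz _ _ _ 2^-1) ?invr_eq0 //.
by rewrite {1}QL mxrankM_maxr.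
Qed.

Variable (r : nat) (L : 'M[K]_(r, n)).
Hypothesis QL : Q = 2 *: (L^T *m L).
Variable (B : 'M[K]_(n, r)).
Hypothesis LB : L *m B = 1%:M.

Lemma Q_entry i j : Q i j = 2 * \sum_k L k i * L k j.
Proof. by rewrite QL !mxE; congr (_ * _); apply: eq_bigr => k _; rewrite mxE. Qed.

Section OfSystem.
Variables (d : nat) (Y : 'I_(r) -> 'M[K]_d).

Definition module_of_system i : 'M[K]_d := \sum_k L k i *: Y k.

Lemma module_of_systemP : clifford_system Y -> clifford_module module_of_system.
Proof.
move=> cliffY i j; rewrite /module_of_system !mulmx_suml.
under eq_bigr do rewrite mulmx_sumr.
under [X in _ + X]eq_bigr do rewrite mulmx_sumr.
rewrite [X in _ + X]exchange_big -big_split /=.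
transitivity (\sum_k \sum_l (L k i * L l j) *: ((k == l)%:R * 2 : K)%:M : 'M[K]_d).
  apply: eq_bigr => k _; rewrite -big_split; apply: eq_bigr => l _ /=.
  by rewrite -!scalemxAl -!scalemxAr !scalerA (mulrC (L l j)) -scalerDr cliffY.
rewrite Q_entry mulr_sumr raddf_sum; apply: eq_bigr => k _.
rewrite (bigD1 k) //= eqxx mul1r big1 ?addr0; first by rewrite scale_scalar_mx mulrC.
by move=> l /negPf lk; rewrite eq_sym lk mul0r raddf0 scaler0.
Qed.

Lemma module_of_system_inv k : Y k = \sum_i B i k *: module_of_system i.
Proof.
under eq_bigr do rewrite scaler_sumr.
rewrite exchange_big /= (bigD1 k) //= [X in _ + X]big1 ?addr0 => [|l /negPf lk].
  under eq_bigr do rewrite scalerA mulrC.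
  by rewrite -scaler_suml; have /matrixP/(_ k k) := LB; rewrite !mxE eqxx => ->; rewrite scale1r.
under eq_bigr do rewrite scalerA mulrC.
by rewrite -scaler_suml; have /matrixP/(_ l k) := LB; rewrite !mxE lk => ->; rewrite scale0r.
Qed.

Lemma irreducible_module_of_system : irreducible Y -> irreducible module_of_system.
Proof.
move=> irrY V stabV; apply: irrY => k v Vv; rewrite module_of_system_inv mulmx_suml.
by apply: memv_suml => i _; rewrite -scalemxAl memvZ // stabV.
Qed.

Lemma irreducible_system_of_module : irreducible module_of_system -> irreducible Y.
Proof.
move=> irrX V stabV; apply: irrX => k v Vv; rewrite mulmx_suml.
by apply: memv_suml => i _; rewrite -scalemxAl memvZ // stabV.
Qed.

End OfSystem.

Section OfModule.
Variables (d : nat) (X : 'I_n -> 'M[K]_d.+1).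
Hypotheses (modX : clifford_module X) (irrX : irreducible X).

(** A vector of the radical acts by an operator that anticommutes with every [X j] and squares to 0.
    Its kernel is therefore stable and contains its image, so by irreducibility it is the whole
    space. *)
Lemma radical_acts_trivially (v : 'cV[K]_n) : L *m v = 0 -> \sum_i v i 0 *: X i = 0.
Proof.
move=> Lv; set Xv := \sum_i _.
have Qv : Q *m v = 0 by rewrite QL -scalemxAl -mulmxA Lv mulmx0 scaler0.
have anti j : Xv *m X j + X j *m Xv = 0.
  rewrite mulmx_suml mulmx_sumr -big_split /=.
  transitivity (((Q *m v) j 0)%:M : 'M[K]_d.+1); last by rewrite Qv mxE raddf0.
  rewrite mxE raddf_sum; apply: eq_bigr => i _.
  rewrite -scalemxAl -scalemxAr -scalerDr modX scale_scalar_mx mulrC.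
  by rewrite -[in LHS]symQ mxE.
have Xv2 : Xv *m Xv = 0.
  apply: (@scalerI _ _ (2 : K)); first by rewrite pnatr_eq0.
  transitivity (\sum_j (Xv *m (v j 0 *: X j) + (v j 0 *: X j) *m Xv)).
    by rewrite big_split -mulmx_sumr -mulmx_suml scaler_nat mulr2n.
  rewrite scaler0; apply: big1 => j _.
  by rewrite -scalemxAl -scalemxAr -scalerDr anti scaler0.
pose V := lker (linfun (mulmx Xv) : 'Hom('cV[K]_d.+1, 'cV[K]_d.+1)).
have memV w : (w \in V) = (Xv *m w == 0) by rewrite memv_ker lfunE.
have stabV k w : w \in V -> X k *m w \in V.
  rewrite !memV => /eqP Xw; have /(congr1 (mulmx^~ w)) := anti k.
  rewrite mulmxDl -!mulmxA Xw mulmx0 addr0 mul0mx => /eqP //.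
have [V0|Vfull] := irrX stabV.
  apply/eqP; apply: contraT => /matrix0Pn[i [j Xij]].
  have : col j Xv \in V by rewrite memV colE mulmxA Xv2 mul0mx.
  rewrite V0 memv0 => /eqP/matrixP/(_ i 0); rewrite !mxE => e.
  by rewrite e eqxx in Xij.
apply/matrixP => i j.
have : delta_mx j 0 \in V by rewrite Vfull memvf.
by rewrite memV -colE => /eqP/matrixP/(_ i 0); rewrite !mxE.
Qed.

Definition system_of_module k : 'M[K]_d.+1 := \sum_i B i k *: X i.

(** The vector e_i - B L e_i is killed by L, so it acts by 0; this is where irreducibility of the
    module enters. *)
Lemma system_of_moduleK : X =1 module_of_system system_of_module.
Proof.
move=> i; apply/eqP; rewrite -subr_eq0; apply/eqP.
pose v := delta_mx i 0 - B *m (L *m delta_mx i 0) : 'cV[K]_n.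
rewrite -[RHS](@radical_acts_trivially v); last first.
  by rewrite /v mulmxBr (mulmxA L (B)) LB mul1mx subrr.
under [RHS]eq_bigr do rewrite mxE scalerDl.
rewrite big_split /=; congr (_ + _).
  rewrite (bigD1 i) //= mxE !eqxx scale1r big1 ?addr0 // => j /negPf ji.
  by rewrite mxE ji scale0r.
rewrite /module_of_system /system_of_module.
under [in LHS]eq_bigr do rewrite scaler_sumr.
rewrite exchange_big -sumrN; apply: eq_bigr => j _ /=.
rewrite -colE !mxE scaleNr; congr (- _); rewrite scaler_suml.
by apply: eq_bigr => k _; rewrite scalerA mulrC !mxE.
Qed.

Lemma system_of_moduleP : clifford_system system_of_module.
Proof.
move=> k l; rewrite /system_of_module !mulmx_suml.
under eq_bigr do rewrite mulmx_sumr.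
under [X in _ + X]eq_bigr do rewrite mulmx_sumr.
rewrite [X in _ + X]exchange_big -big_split /=.
transitivity (\sum_i \sum_j (B i k * B j l) *: (Q i j)%:M : 'M[K]_d.+1).
  apply: eq_bigr => i _; rewrite -big_split; apply: eq_bigr => j _ /=.
  by rewrite -!scalemxAl -!scalemxAr !scalerA (mulrC (B j l)) -scalerDr modX.
have BQB : (B)^T *m Q *m B = 2%:M.
  rewrite QL -scalemxAr -scalemxAl (mulmxA _ L^T) -(mulmxA _ L) LB mulmx1 -trmx_mul LB trmx1.
  by rewrite scale_scalar_mx mulr1.
have -> : ((k == l)%:R * 2 : K) = ((B)^T *m Q *m B) k l.
  by rewrite BQB mxE mulr_natl.
rewrite mxE exchange_big raddf_sum; apply: eq_bigr => j _ /=.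
rewrite mxE mulr_suml raddf_sum; apply: eq_bigr => i _ /=.
by rewrite mxE scale_scalar_mx mulrAC.
Qed.

End OfModule.
End CliffordModules.

(** * Irreducible systems of at most two square roots of 1 *)

Section SmallSystems.
Variable K : numClosedFieldType.

Lemma dimv_cV d : \dim {: 'cV[K]_d} = d.
Proof. by rewrite dimvf /dim /= muln1. Qed.

Lemma irreducible_eq0_dim r d (Y : 'I_r -> 'M[K]_d.+1) :
  (forall k, Y k = 0) -> irreducible Y -> d = 0%N.
Proof.
move=> Y0 irrY; pose v := delta_mx 0 0 : 'cV[K]_d.+1.
have v_neq0 : v != 0.
  by apply/matrix0Pn; exists 0, 0; rewrite mxE !eqxx oner_eq0.
have stab k w : w \in <[v]>%VS -> Y k *m w \in <[v]>%VS.
  by move=> _; rewrite Y0 mul0mx mem0v.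
have [|Vv] := irrY _ stab.
  by move/eqP; rewrite -subv0 -memvE memv0 (negPf v_neq0).
by have := dim_vline v; rewrite Vv dimv_cV v_neq0 => -[].
Qed.

(** If v is an eigenvector of the first operator, v and its image under the second one span a stable
    subspace. *)
Lemma irreducible_system_dim r d (Y : 'I_r -> 'M[K]_d.+1) :
  (r <= 2)%N -> clifford_system Y -> irreducible Y -> (d < 2)%N.
Proof.
move=> r2 cliffY irrY.
(* Extending the system by 0 treats r = 0, 1, 2 at once; the operators then square to scalars c^2
   with c = 1 or c = 0. *)
pose Z k : 'M[K]_d.+1 := if insub k is Some k' then Y k' else 0.
have ZY (k : 'I_r) : Z k = Y k by rewrite /Z valK.
have sq k : exists c : K, Z k *m Z k = (c ^+ 2)%:M.
  rewrite /Z; case: insubP => [k' _ _|_].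
    exists 1; apply: (@scalerI _ _ (2 : K)); first by rewrite pnatr_eq0.
    rewrite scaler_nat mulr2n cliffY eqxx mul1r expr1n scale_scalar_mx mulr1 //.
  by exists 0; rewrite mul0mx expr0n raddf0.
have anti : Z 0 *m Z 1 = - (Z 1 *m Z 0).
  apply/eqP; rewrite -addr_eq0; rewrite /Z; case: insubP => [k0 _ k0E|_]; last first.
    by rewrite mul0mx mulmx0 addr0.
  case: insubP => [k1 _ k1E|_]; last by rewrite mul0mx mulmx0 addr0.
  have /negPf k01 : k0 != k1 by apply/eqP => k01; rewrite k01 k1E in k0E.
  by rewrite cliffY k01 mul0r raddf0.
have [[c Z0c] [c1 Z1c]] := (sq 0%N, sq 1%N).
(* From Z^2 = c^2 the vector Z w + c w is an eigenvector for c, unless it is 0 and w itself is one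
   for - c. *)
have [v v_neq0 [s Z0v]] : exists2 v : 'cV[K]_d.+1, v != 0 & exists s, Z 0 *m v = s *: v.
  pose w := delta_mx 0 0 : 'cV[K]_d.+1.
  have w_neq0 : w != 0.
    by apply/matrix0Pn; exists 0, 0; rewrite mxE !eqxx oner_eq0.
  have [u0|u_neq0] := eqVneq (Z 0 *m w + c *: w) 0.
    by exists w => //; exists (- c); rewrite scaleNr; apply/eqP; rewrite -addr_eq0 u0.
  exists (Z 0 *m w + c *: w) => //; exists c.
  by rewrite mulmxDr mulmxA Z0c -scalemxAr mul_scalar_mx scalerDr scalerA addrC expr2.
pose V := (<[v]> + <[Z 1 *m v]>)%VS.
have stabV k u : u \in V -> Y k *m u \in V.
  move=> /memv_addP[_ /vlineP[x ->] [_ /vlineP[y ->] ->]].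
  have : (k < 2)%N by rewrite (leq_trans _ r2).
  rewrite -ZY mulmxDr -!scalemxAr; case: (nat_of_ord k) => [|[|]] // _.
    rewrite mulmxA anti mulNmx -mulmxA Z0v -scalemxAr scalerN -scaleNr !scalerA.
    by rewrite memv_add // memvZ // memv_line.
  by rewrite addrC mulmxA Z1c mul_scalar_mx scalerA memv_add // memvZ // memv_line.
have [V0|Vfull] := irrY V stabV.
  have : v \in V by rewrite memvE addvSl.
  by rewrite V0 memv0 (negPf v_neq0).
have := (dimv_add_leqif <[v]> <[Z 1 *m v]>).1.
rewrite -/V Vfull dimv_cV !dim_vline => h; apply: leq_trans h _.
by case: (v != 0); case: (_ != 0).
Qed.

Let s1 : 'M[K]_2 := \matrix_(i, j) (i != j)%:R.
Let s2 : 'M[K]_2 := \matrix_(i, j) (if i == j then 0 else if i == 0 then - 'i else 'i).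

(** The operator Y_0 + i Y_1 squares to 0. For v in its kernel, the basis v, Y_0 v brings the system
    to the Pauli matrices [s1] and [s2]. *)
Lemma system2_normal_form (Y : 'I_2 -> 'M[K]_2) : clifford_system Y ->
  exists2 P : 'M[K]_2, P \in unitmx & Y 0 *m P = P *m s1 /\ Y 1 *m P = P *m s2.
Proof.
move=> cliffY.
have i2 : 'i * 'i = -1 :> K by rewrite -expr2 sqrCi.
have Y00 : Y 0 *m Y 0 = 1%:M.
  apply: (@scalerI _ _ (2 : K)); first by rewrite pnatr_eq0.
  by rewrite scaler_nat mulr2n cliffY eqxx mul1r scale_scalar_mx mulr1.
have Y11 : Y 1 *m Y 1 = 1%:M.
  apply: (@scalerI _ _ (2 : K)); first by rewrite pnatr_eq0.
  by rewrite scaler_nat mulr2n cliffY eqxx mul1r scale_scalar_mx mulr1.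
have Y10 : Y 1 *m Y 0 = - (Y 0 *m Y 1).
  by apply/eqP; rewrite -addr_eq0 cliffY mul0r raddf0.
pose N := Y 0 + 'i *: Y 1.
have N2 : N *m N = 0.
  rewrite /N mulmxDr !mulmxDl -!scalemxAl -!scalemxAr scalerA i2 Y00 Y11 Y10.
  by rewrite scalerN scaleN1r addrA subrK subrr.
have [v v_neq0 Nv] : exists2 v : 'cV[K]_2, v != 0 & N *m v = 0.
  have : \det N^T == 0.
    by rewrite det_tr -[_ == 0](expf_eq0 _ 2) expr2 -det_mulmx N2 det0.
  move/det0P=> [u u_neq0 uN]; exists u^T; first by rewrite trmx_eq0.
  by rewrite -[LHS]trmxK trmx_mul trmxK uN trmx0.
have Y1v : Y 1 *m v = 'i *: (Y 0 *m v).
  apply/eqP; rewrite -subr_eq0; apply/eqP.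
  transitivity (- 'i *: (N *m v)); last by rewrite Nv scaler0.
  by rewrite /N mulmxDl scalerDr -scalemxAl scalerA mulNr i2 opprK scale1r scaleNr addrC.
have Y1w : Y 1 *m (Y 0 *m v) = - 'i *: v.
  by rewrite mulmxA Y10 mulNmx -mulmxA Y1v -scalemxAr mulmxA Y00 mul1mx scaleNr.
have [w Ew] : exists w, Y 0 *m v = w by exists (Y 0 *m v).
have Y0w : Y 0 *m w = v by rewrite -Ew mulmxA Y00 mul1mx.
rewrite Ew in Y1v Y1w.
pose P : 'M[K]_2 := \matrix_(i, j) if j == 0 then v i 0 else w i 0.
have ZP (Z M : 'M[K]_2) : Z *m v = M 0 0 *: v + M 1 0 *: w ->
    Z *m w = M 0 1 *: v + M 1 1 *: w -> Z *m P = P *m M.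
  move=> /matrixP e0 /matrixP e1; apply/matrixP => i j.
  rewrite !mxE !big_ord_recl !big_ord0 !mxE /=.
  have := e0 i 0; have := e1 i 0; rewrite !mxE !big_ord_recl !big_ord0 /=.
  have -> : lift ord0 ord0 = 1 :> 'I_2 by apply: val_inj.
  have [->|->] : j = 0 \/ j = 1.
    by case: (j) => [[|[|]] ?] //; [left|right]; apply: val_inj.
  - by rewrite /= => _ e; rewrite [LHS]e; ring.
  - by rewrite /= => e _; rewrite [LHS]e; ring.
exists P; last first.
  split; apply: ZP; rewrite !mxE /= ?scale0r ?scale1r ?add0r ?addr0 //.
have PE (u : 'cV[K]_2) : P *m u = u 0 0 *: v + u 1 0 *: w.
  apply/matrixP => i j; rewrite !mxE (ord1 j) !big_ord_recl !big_ord0 !mxE /=.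
  have -> : lift ord0 ord0 = 1 :> 'I_2 by apply: val_inj.
  ring.
rewrite unitmxE unitfE -det_tr; apply/negP => /det0P[u u_neq0 uP].
have Pu : P *m u^T = 0 by rewrite -[LHS]trmxK trmx_mul trmxK uP trmx0.
move: Pu; rewrite PE !mxE => e.
(* Applying Y_0 and - i Y_1 to a linear relation between v and w gives two relations whose
   difference involves v only. *)
have eY0 : u 0 0 *: w + u 0 1 *: v = 0.
  have := congr1 (mulmx (Y 0)) e.
  by rewrite mulmx0 mulmxDr -!scalemxAr Y0w Ew.
have eY1 : u 0 0 *: w - u 0 1 *: v = 0.
  have := congr1 (mulmx (- 'i *: Y 1)) e; rewrite mulmx0 mulmxDr -!scalemxAr -!scalemxAl Y1v Y1w.
  by rewrite !scalerA -!mulrA mulrNN mulNr i2 opprK mulr1 mulrN1 scaleNr.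
have two_neq0 : (2 : K) != 0 by rewrite pnatr_eq0.
have u1 : u 0 1 = 0.
  apply/eqP; have /eqP : (2 * u 0 1) *: v = 0.
    transitivity ((u 0 0 *: w + u 0 1 *: v) - (u 0 0 *: w - u 0 1 *: v)).
      by rewrite opprB addrC addrA subrK -scalerDl mulrDl mul1r.
    by rewrite eY0 eY1 subr0.
  by rewrite scaler_eq0 (negPf v_neq0) orbF mulf_eq0 (negPf two_neq0).
have u0 : u 0 0 = 0.
  by move/eqP: e; rewrite u1 scale0r addr0 scaler_eq0 (negPf v_neq0) orbF => /eqP.
case/eqP: u_neq0; apply/rowP => j; rewrite mxE.
have [->|->] // : j = 0 \/ j = 1.
by case: (j) => [[|[|]] ?] //; [left|right]; apply: val_inj.
Qed.

Lemma system2_unique (Y Y' : 'I_2 -> 'M[K]_2) :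
    clifford_system Y -> clifford_system Y' ->
  exists2 P : 'M[K]_2, P \in unitmx & forall k, P *m Y k = Y' k *m P.
Proof.
move=> /system2_normal_form[P uP [P0 P1]] /system2_normal_form[P' uP' [P0' P1']].
exists (P' *m invmx P); first by rewrite unitmx_mul uP' unitmx_inv.
move=> k; have [->|->] : k = 0 \/ k = 1.
  by case: (k) => [[|[|]] ?] //; [left|right]; apply: val_inj.
- rewrite mulmxA P0' -!mulmxA; congr (_ *m _).
  by rewrite -[LHS](mulmxK uP) -(mulmxA (invmx P)) P0 mulKmx.
- rewrite mulmxA P1' -!mulmxA; congr (_ *m _).
  by rewrite -[LHS](mulmxK uP) -(mulmxA (invmx P)) P1 mulKmx.
Qed.
End SmallSystems.

Section IrreducibleModules.
Variables (K : numClosedFieldType) (n : nat) (Q : 'M[K]_n).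
Hypothesis symQ : Q^T = Q.

Lemma exists_irreducible_module4 : (3 < \rank Q <= 5)%N ->
  exists2 X : 'I_n -> 'M[K]_4, clifford_module Q X & irreducible X.
Proof.
move=> /(clifford_system4 K)[Y cliffY irrY].
have [L [B [QL LB]]] := sym_mx_split_factor symQ.
exists (module_of_system L Y); first exact: module_of_systemP.
exact: (irreducible_module_of_system LB irrY).
Qed.

Lemma exists_irreducible_module2 : \rank Q = 2%N ->
  exists2 X : 'I_n -> 'M[K]_2, clifford_module Q X & irreducible X.
Proof.
move=> rkQ; have [Y cliffY irrY] := clifford_system2 K.
have [L [B [QL LB]]] := sym_mx_split_factor symQ.
rewrite rkQ in L B QL LB.
exists (module_of_system L Y); first exact: module_of_systemP.
exact: (irreducible_module_of_system LB irrY).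
Qed.

Lemma irreducible_module_dim d (X : 'I_n -> 'M[K]_d.+1) :
  (\rank Q <= 2)%N -> clifford_module Q X -> irreducible X -> (d < 2)%N.
Proof.
move=> rkQ modX irrX; have [L [B [QL LB]]] := sym_mx_split_factor symQ.
have XE := system_of_moduleK symQ QL LB modX irrX.
apply: (irreducible_system_dim rkQ (system_of_moduleP QL LB modX)).
apply: (@irreducible_system_of_module _ _ _ L).
move=> V stabV; apply: irrX => k v Vv; rewrite XE; exact: stabV.
Qed.

Lemma irreducible_module2_unique (X X' : 'I_n -> 'M[K]_2) : \rank Q = 2%N ->
    clifford_module Q X -> irreducible X -> clifford_module Q X' -> irreducible X' ->
  exists2 P : 'M[K]_2, P \in unitmx & forall i, P *m X i = X' i *m P.
Proof.
move=> rkQ modX irrX modX' irrX'; have [L [B [QL LB]]] := sym_mx_split_factor symQ.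
rewrite rkQ in L B QL LB.
have [P uP PY] := system2_unique (system_of_moduleP QL LB modX) (system_of_moduleP QL LB modX').
exists P => // i; rewrite (system_of_moduleK symQ QL LB modX irrX i).
rewrite (system_of_moduleK symQ QL LB modX' irrX' i) mulmx_sumr mulmx_suml.
by apply: eq_bigr => k _; rewrite -scalemxAr -scalemxAl PY.
Qed.

End IrreducibleModules.

(** * Summable families *)

Section HasSum.
Variable K : numFieldType.

(** Unconditional summation over the finite subsets of the index type, encoded as lists without
    repetition. No order is involved, so sums over integers and pairs can be reindexed along any
    bijection. *)
Definition has_sum (I : eqType) (f : I -> K) (s : K) : Prop :=
  forall e, 0 < e -> exists F0 : seq I, forall F : seq I,
    uniq F -> {subset F0 <= F} -> `|\sum_(i <- F) f i - s| < e.

Definition norm_bounded (I : eqType) (f : I -> K) (B : K) : Prop :=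
  forall F : seq I, uniq F -> \sum_(i <- F) `|f i| <= B.

Lemma has_sum_eq (I : eqType) (f g : I -> K) s : f =1 g -> has_sum f s -> has_sum g s.
Proof.
move=> fg hf e e0; have [F0 hF] := hf e e0; exists F0 => F uF sF.
by rewrite -(eq_bigr _ (fun i _ => fg i)); exact: hF.
Qed.

Lemma has_sum_uniq (I : eqType) (f : I -> K) s t : has_sum f s -> has_sum f t -> s = t.
Proof.
move=> hs ht; apply/eqP; rewrite -subr_eq0 -normr_eq0; apply/contraT => st.
have e0 : 0 < `|s - t| / 2 by rewrite divr_gt0 ?ltr0n // lt_def st normr_ge0.
have [F0 h0] := hs _ e0; have [F1 h1] := ht _ e0.
pose F := undup (F0 ++ F1).
have s0 : {subset F0 <= F} by move=> i; rewrite mem_undup mem_cat => ->.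
have s1 : {subset F1 <= F} by move=> i; rewrite mem_undup mem_cat orbC => ->.
have := ltrD (h0 F (undup_uniq _) s0) (h1 F (undup_uniq _) s1).
rewrite -splitr distrC => lt; have := le_lt_trans (ler_normD _ _) lt.
by rewrite addrA subrK ltxx.
Qed.

Lemma has_sumD (I : eqType) (f g : I -> K) s t :
  has_sum f s -> has_sum g t -> has_sum (fun i => f i + g i) (s + t).
Proof.
move=> hs ht e e0; have e2 : 0 < e / 2 by rewrite divr_gt0 ?ltr0n.
have [F0 h0] := hs _ e2; have [F1 h1] := ht _ e2.
exists (F0 ++ F1) => F uF sF; rewrite big_split /= opprD addrACA.
apply: le_lt_trans (ler_normD _ _) _; rewrite [ltRHS]splitr.
by apply: ltrD; [apply: h0 | apply: h1] => // i iF; apply: sF; rewrite mem_cat iF ?orbT.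
Qed.

Lemma has_sum0 (I : eqType) : has_sum (fun _ : I => 0) 0.
Proof. by move=> e e0; exists [::] => F _ _; rewrite big1 // subr0 normr0. Qed.

Lemma has_sumZ (I : eqType) (f : I -> K) c s :
  has_sum f s -> has_sum (fun i => c * f i) (c * s).
Proof.
move=> hs e e0; have c1 : 0 < `|c| + 1 by rewrite ltr_wpDl.
have [F0 h0] := hs _ (divr_gt0 e0 c1); exists F0 => F uF sF.
rewrite -mulr_sumr -mulrBr normrM.
have := h0 F uF sF; rewrite ltr_pdivlMr // => lt; apply: le_lt_trans lt.
by rewrite mulrC ler_wpM2l // lerDl ler01.
Qed.

Lemma has_sum_sum (I : eqType) (T : finType) (f : T -> I -> K) (s : T -> K) :
  (forall b, has_sum (f b) (s b)) -> has_sum (fun i => \sum_b f b i) (\sum_b s b).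
Proof.
move=> hs; elim: (index_enum T) => [|b r IHr].
  by rewrite big_nil; apply: has_sum_eq (@has_sum0 I) => i; rewrite big_nil.
rewrite big_cons; apply: has_sum_eq (has_sumD (hs b) IHr) => i.
by rewrite big_cons.
Qed.

Lemma big_pmap (I J : Type) (h : J -> option I) (F : seq J) (f : I -> K) :
  \sum_(i <- pmap h F) f i = \sum_(j <- F) oapp f 0 (h j).
Proof.
elim: F => [|j F IHF]; rewrite ?big_nil //= big_cons -IHF.
by case: (h j) => [i|] /=; rewrite ?big_cons ?add0r.
Qed.

Lemma has_sum_ext (I J : eqType) (h : I -> J) (k : J -> option I) (f : I -> K) s :
    pcancel h k -> ocancel k h -> has_sum f s ->
  has_sum (fun j => oapp f 0 (k j)) s.
Proof.
move=> hK kK hs e e0; have [F0 h0] := hs e e0; exists (map h F0) => F uF sF.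
rewrite -big_pmap; apply: h0; first exact: pmap_uniq kK _ uF.
by move=> i iF0; rewrite mem_pmap; apply/mapP; exists (h i); rewrite ?hK // sF ?map_f.
Qed.

Lemma has_sum_bij (I J : eqType) (h : J -> I) (k : I -> J) (f : I -> K) s :
  cancel h k -> cancel k h -> has_sum f s -> has_sum (f \o h) s.
Proof.
move=> hK kK /(@has_sum_ext _ _ k (Some \o h) _ _ _ _); apply=> [i|j] /=.
- by rewrite kK.
- by rewrite hK.
Qed.

(** There are finitely many slices: each is extended by 0 to the whole product, and the extensions
    are added. *)
Lemma has_sum_slices (I : eqType) (T : finType) (f : I * T -> K) (s : T -> K) :
  (forall b, has_sum (fun i => f (i, b)) (s b)) -> has_sum f (\sum_b s b).
Proof.
move=> hs; pose k b (p : I * T) := if p.2 == b then Some p.1 else None.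
have hk b : has_sum (fun p => oapp (fun i => f (i, b)) 0 (k b p)) (s b).
  apply: (@has_sum_ext _ _ (fun i => (i, b))) (hs b) => [i|[i b']].
    by rewrite /k eqxx.
  by rewrite /k /=; case: eqP => //= ->.
apply: has_sum_eq (has_sum_sum hk) => -[i b].
rewrite (bigD1 b) //= /k eqxx /= big1 ?addr0 // => b' /negPf.
by rewrite eq_sym => ->.
Qed.

Lemma norm_boundedW (I : eqType) (f g : I -> K) C B : 0 <= C ->
  (forall i, `|f i| <= C * `|g i|) -> norm_bounded g B -> norm_bounded f (C * B).
Proof.
move=> C0 fg hg F uF; apply: le_trans (ler_wpM2l C0 (hg F uF)).
by rewrite mulr_sumr; apply: ler_sum => i _.
Qed.

Lemma has_sum_le (I : eqType) (f : I -> K) s B : has_sum f s ->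
  norm_bounded f B -> `|s| <= B.
Proof.
move=> hs hB; have B0 : 0 <= B by have := hB [::] isT; rewrite big_nil.
rewrite real_leNgt ?ger0_real //; apply/negP => lt.
have [F0 h0] := hs _ (etrans (subr_gt0 _ _) lt).
have uF := undup_uniq F0; have := h0 _ uF (fun i iF => etrans (mem_undup _ _) iF).
rewrite distrC => lt'; have := ler_distD (\sum_(i <- undup F0) f i) s 0.
rewrite !subr0 => /le_lt_trans/(_ (ltr_leD lt' (le_trans (ler_norm_sum _ _ _) (hB _ uF)))).
by rewrite subrK ltxx.
Qed.

Lemma uniq_cat_notin (I : eqType) (F0 F : seq I) : uniq F0 -> uniq F ->
  {in F, forall i, i \notin F0} -> uniq (F0 ++ F).
Proof.
move=> u0 u dis; rewrite cat_uniq u0 u andbT /=; apply/hasPn => i /dis //.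
Qed.

Lemma has_sum_tail (I : eqType) (f : I -> K) s : has_sum (fun i => `|f i|) s ->
  forall e, 0 < e -> exists2 F0, uniq F0 & forall F, uniq F ->
    {in F, forall i, i \notin F0} -> \sum_(i <- F) `|f i| < e.
Proof.
move=> hs e e0; have e2 : 0 < e / 2 by rewrite divr_gt0 ?ltr0n.
have [F0 h0] := hs _ e2; exists (undup F0); first exact: undup_uniq.
move=> F uF dis.
have sub0 : {subset F0 <= undup F0} by move=> i; rewrite mem_undup.
have subF : {subset F0 <= undup F0 ++ F} by move=> i iF; rewrite mem_cat sub0.
have := ltrD (h0 _ (uniq_cat_notin (undup_uniq _) uF dis) subF) (h0 _ (undup_uniq _) sub0).
rewrite -splitr (distrC (\sum_(i <- undup F0) _) s) big_cat /= => lt.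
have := le_lt_trans (ler_normD _ _) lt.
by rewrite addrA subrK addrC addKr ger0_norm // sumr_ge0.
Qed.

(** The family of products is assumed summable; its sum is identified by evaluating on a rectangle F
    x G large enough for all three families at once. *)
Lemma has_sumM (I J : eqType) (f : I -> K) (g : J -> K) s t B C S :
    norm_bounded f B -> norm_bounded g C -> has_sum f s -> has_sum g t ->
    has_sum (fun p => f p.1 * g p.2) S -> S = s * t.
Proof.
move=> fB gC hf hg hS.
have B0 : 0 <= B by have := fB [::] isT; rewrite big_nil.
have C0 : 0 <= C by have := gC [::] isT; rewrite big_nil.
have tC : `|t| <= C by apply: has_sum_le hg gC.
apply/eqP; rewrite -subr_eq0 -normr_eq0; apply/contraT => Sst.
have d0 : 0 < B + C + 2 by rewrite ltr_wpDl ?addr_ge0 ?ltr0n.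
(* The estimates below bound |S - s t| by (B + C + 1) e, while it equals (B + C + 2) e by this
   choice. *)
pose e := `|S - s * t| / (B + C + 2).
have e0 : 0 < e by rewrite divr_gt0 // lt_def Sst normr_ge0.
have [F0 h0] := hf _ e0; have [G0 g0] := hg _ e0; have [P0 p0] := hS _ e0.
pose F := undup (F0 ++ map fst P0); pose G := undup (G0 ++ map snd P0).
have uF : uniq F := undup_uniq _; have uG : uniq G := undup_uniq _.
have sF : {subset F0 <= F} by move=> i iF; rewrite mem_undup mem_cat iF.
have sG : {subset G0 <= G} by move=> i iF; rewrite mem_undup mem_cat iF.
have uP : uniq [seq (i, j) | i <- F, j <- G].
  by apply: allpairs_uniq => // -[i j] [i' j'] _ _ [-> ->].
have sP : {subset P0 <= [seq (i, j) | i <- F, j <- G]}.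
  move=> [i j] P0ij; apply/allpairsP; exists (i, j); split=> //=.
    by rewrite mem_undup mem_cat; apply/orP; right; apply/mapP; exists (i, j).
  by rewrite mem_undup mem_cat; apply/orP; right; apply/mapP; exists (i, j).
have := p0 _ uP sP; rewrite big_allpairs /=.
have -> : \sum_(i <- F) \sum_(j <- G) f i * g j = (\sum_(i <- F) f i) * (\sum_(j <- G) g j).
  by rewrite mulr_suml; apply: eq_bigr => i _; rewrite mulr_sumr.
have := h0 F uF sF; have := g0 G uG sG.
have : `|\sum_(i <- F) f i| <= B by apply: le_trans (ler_norm_sum _ _ _) (fB _ uF).
move: (\sum_(i <- F) f i) (\sum_(j <- G) g j) => X Y XB Yt Xs XYS.
have : `|S - s * t| < e + (B * e + e * C).
  have -> : S - s * t = - (X * Y - S) + (X * (Y - t) + (X - s) * t) by ring.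
  apply: le_lt_trans (ler_normD _ _) _; rewrite normrN; apply: ltr_leD => //.
  apply: le_trans (ler_normD _ _) _; rewrite !normrM.
  by apply: lerD; apply: ler_pM => //; exact: ltW.
have -> : e + (B * e + e * C) = (B + C + 1) * e by ring.
rewrite -[X in X < _](divfK (lt0r_neq0 d0)) -/e mulrC ltr_pM2r // ltrD2l.
by rewrite lt_gtF ?ltr1n.
Qed.

Lemma norm_boundedM (I J : eqType) (f : I -> K) (g : J -> K) B C :
    norm_bounded f B -> norm_bounded g C ->
  norm_bounded (fun p => f p.1 * g p.2) (B * C).
Proof.
move=> fB gC P uP.
pose F := undup (map fst P); pose G := undup (map snd P).
apply: le_trans (_ : (\sum_(i <- F) `|f i|) * (\sum_(j <- G) `|g j|) <= _); last first.
  by apply: ler_pM; rewrite ?sumr_ge0 ?fB ?gC ?undup_uniq.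
have -> : (\sum_(i <- F) `|f i|) * (\sum_(j <- G) `|g j|) =
    \sum_(p <- [seq (i, j) | i <- F, j <- G]) `|f p.1 * g p.2|.
  rewrite big_allpairs mulr_suml; apply: eq_bigr => i _; rewrite mulr_sumr.
  by apply: eq_bigr => j _; rewrite normrM.
have uFG : uniq [seq (i, j) | i <- F, j <- G].
  by apply: allpairs_uniq; rewrite ?undup_uniq // => -[i j] [i' j'] _ _ [-> ->].
apply: le_trans (_ : \sum_(p <- [seq (i, j) | i <- F, j <- G] | p \in P) `|f p.1 * g p.2| <= _);
    last first.
  by rewrite [leRHS](bigID (fun p => p \in P)) /= lerDl sumr_ge0.
rewrite -(big_filter [seq (i, j) | i <- F, j <- G]) le_eqVlt; apply/orP; left; apply/eqP/perm_big.
apply: uniq_perm; rewrite ?filter_uniq // => -[i j].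
rewrite mem_filter; case: (boolP (_ \in P)) => //= ijP; apply/esym/allpairsP.
by exists (i, j); rewrite !mem_undup; split=> //=; apply/mapP; exists (i, j).
Qed.

Definition tends (u : nat -> K) (l : K) : Prop :=
  forall e, 0 < e -> exists N, forall n, (N <= n)%N -> `|u n - l| < e.

Lemma has_sum_tends (f : nat -> K) s : has_sum f s ->
  tends (fun N => \sum_(i < N) f i) s.
Proof.
move=> hs e e0; have [F0 h0] := hs e e0; exists (\max_(i <- F0) i.+1) => N FN.
rewrite -(big_mkord xpredT f); apply: h0; first exact: iota_uniq.
move=> i iF; rewrite mem_index_iota /=; apply: leq_trans FN.
by rewrite (big_rem i) //= leq_maxl.
Qed.

(** Dominated convergence with a multiple of the limit family as majorant. Outside a finite set the
    differences sum to at most C + 1 times a tail of the norms of [t]; on the finite set the terms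
    converge. *)
Lemma tannery (I : eqType) (F : nat -> I -> K) (t : I -> K) (P : nat -> K) C B s :
    0 <= C -> (forall N i, `|F N i| <= C * `|t i|) -> (forall i, tends (F ^~ i) (t i)) ->
    has_sum (fun i => `|t i|) B -> has_sum t s -> (forall N, has_sum (F N) (P N)) ->
  tends P s.
Proof.
move=> C0 FC Ft tB ts FP e e0.
have c0 : 0 < C + 1 by rewrite ltr_wpDl.
have d0 : 0 < e / 4 by rewrite divr_gt0 ?ltr0n.
have [F0 uF0 F0P] := has_sum_tail tB (divr_gt0 d0 c0).
have [T0 T0P] := ts _ d0.
have [M MP] : exists M, forall N, (M <= N)%N ->
    \sum_(i <- F0) `|F N i - t i| < e / 4.
  elim: (F0) (e / 4) d0 => [|i r IHr] d d0.
    by exists 0%N => N _; rewrite big_nil.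
  have d2 : 0 < d / 2 by rewrite divr_gt0 ?ltr0n.
  have [M1 M1P] := IHr _ d2; have [M2 M2P] := Ft i _ d2.
  exists (maxn M1 M2) => N; rewrite geq_max => /andP[N1 N2].
  by rewrite big_cons [ltRHS]splitr; apply: ltrD; [exact: M2P | exact: M1P].
exists M => N MN; have [P0 P0P] := FP N _ d0.
pose G' := [seq i <- undup (T0 ++ P0) | i \notin F0]; pose G := F0 ++ G'.
have uG' : uniq G' by rewrite filter_uniq ?undup_uniq.
have disG : {in G', forall i, i \notin F0} by move=> i; rewrite mem_filter => /andP[].
have uG : uniq G by exact: uniq_cat_notin.
have sG i : i \in T0 ++ P0 -> i \in G.
  by move=> iTP; rewrite mem_cat mem_filter mem_undup iTP andbT orbN.
have hT : `|\sum_(i <- G) t i - s| < e / 4.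
  by apply: T0P => // i iT; apply: sG; rewrite mem_cat iT.
have hP : `|\sum_(i <- G) F N i - P N| < e / 4.
  by apply: P0P => // i iT; apply: sG; rewrite mem_cat iT orbT.
have hG : `|\sum_(i <- G) (F N i - t i)| < e / 4 + e / 4.
  apply: le_lt_trans (ler_norm_sum _ _ _) _; rewrite big_cat /=.
  apply: ltrD; first exact: MP.
  apply: le_lt_trans (_ : (C + 1) * \sum_(i <- G') `|t i| < _); last first.
    by rewrite mulrC -ltr_pdivlMr //; exact: F0P.
  rewrite mulr_sumr; apply: ler_sum => i _; apply: le_trans (ler_normB _ _) _.
  by rewrite mulrDl mul1r lerD2r.
have -> : P N - s = - (\sum_(i <- G) F N i - P N) +
    (\sum_(i <- G) (F N i - t i) + (\sum_(i <- G) t i - s)).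
  by rewrite sumrB; ring.
apply: le_lt_trans (ler_normD _ _) _; rewrite normrN.
have -> : e = e / 4 + (e / 4 + e / 4 + e / 4) by field.
apply: ltrD => //; apply: le_lt_trans (ler_normD _ _) _.
exact: ltrD.
Qed.

Lemma tends_uniq u l l' : tends u l -> tends u l' -> l = l'.
Proof.
move=> ul ul'; apply/eqP; rewrite -subr_eq0 -normr_eq0; apply/contraT => ll.
have e0 : 0 < `|l - l'| / 2 by rewrite divr_gt0 ?ltr0n // lt_def ll normr_ge0.
have [N NP] := ul _ e0; have [M MP] := ul' _ e0.
have := ltrD (NP _ (leq_maxl N M)) (MP _ (leq_maxr N M)).
rewrite -splitr (distrC _ l) => lt; have := le_lt_trans (ler_normD _ _) lt.
by rewrite addrA subrK ltxx.
Qed.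

Lemma eq_tends u v l : u =1 v -> tends u l -> tends v l.
Proof. by move=> uv ul e /ul[N NP]; exists N => n /NP; rewrite uv. Qed.

Lemma tends_cst l : tends (fun=> l) l.
Proof. by move=> e e0; exists 0%N => n _; rewrite subrr normr0. Qed.

Lemma tendsD u v l l' : tends u l -> tends v l' -> tends (fun n => u n + v n) (l + l').
Proof.
move=> ul vl e e0; have e2 : 0 < e / 2 by rewrite divr_gt0 ?ltr0n.
have [N NP] := ul _ e2; have [M MP] := vl _ e2; exists (maxn N M) => n.
rewrite geq_max => /andP[Nn Mn]; rewrite opprD addrACA [ltRHS]splitr.
by apply: le_lt_trans (ler_normD _ _) _; apply: ltrD; [exact: NP | exact: MP].
Qed.

Lemma tendsZ c u l : tends u l -> tends (fun n => c * u n) (c * l).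
Proof.
move=> ul e e0; have c0 : 0 < `|c| + 1 by rewrite ltr_wpDl.
have [N NP] := ul _ (divr_gt0 e0 c0); exists N => n Nn.
rewrite -mulrBr normrM; have := NP n Nn; rewrite ltr_pdivlMr // mulrDr mulr1 mulrC.
by apply: le_lt_trans; rewrite lerDl.
Qed.

Lemma tendsM u v l l' : tends u l -> tends v l' -> tends (fun n => u n * v n) (l * l').
Proof.
move=> ul vl; suff h : tends (fun n => (u n - l) * (v n - l')) 0.
  have := tendsD (tendsD h (tendsZ l vl)) (tendsD (tendsZ l' ul) (tends_cst (- (l * l')))).
  rewrite add0r (mulrC l' l) subrr addr0; apply: eq_tends => n; ring.
move=> e e0; have [N NP] := ul 1 ltr01; have [M MP] := vl e e0; exists (maxn N M) => n.
rewrite geq_max => /andP[Nn Mn]; rewrite subr0 normrM -[e]mul1r.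
by apply: ltr_pM => //; [exact: NP | exact: MP].
Qed.

(** That the limit is nonzero is as important as the inverse: non-vanishing of infinite products is
    read off from lower bounds on their partial products. *)
Lemma tendsV u l c : 0 < c -> (forall n, c <= `|u n|) -> tends u l ->
  l != 0 /\ tends (fun n => (u n)^-1) l^-1.
Proof.
move=> c0 cu ul.
have l0 : l != 0.
  apply/eqP => l0; have [N NP] := ul c c0.
  by have := NP N (leqnn N); rewrite l0 subr0 => /(le_lt_trans (cu N)); rewrite ltxx.
split=> // e e0; have nl : 0 < `|l| by rewrite normr_gt0.
have [N NP] := ul _ (mulr_gt0 e0 (mulr_gt0 c0 nl)); exists N => n Nn.
have un0 : u n != 0 by rewrite -normr_gt0 (lt_le_trans c0).
have -> : (u n)^-1 - l^-1 = (l - u n) / (u n * l) by field; rewrite ?un0 ?l0.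
rewrite normrM normfV normrM ltr_pdivrMr ?mulr_gt0 ?normr_gt0 // distrC.
apply: lt_le_trans (NP n Nn) _.
by rewrite ler_pM2l // ler_pM2r.
Qed.

Lemma tends_sub (h : nat -> nat) u l : (forall M, exists N, forall n, (N <= n)%N -> (M <= h n)%N) ->
  tends u l -> tends (fun n => u (h n)) l.
Proof.
move=> hM ul e /ul[M MP]; have [N NP] := hM M.
by exists N => n Nn; apply: MP; exact: NP.
Qed.

Lemma tends_near u v l : (exists M, forall n, (M <= n)%N -> u n = v n) ->
  tends u l -> tends v l.
Proof.
move=> [M uv] ul e /ul[N NP]; exists (maxn M N) => n.
by rewrite geq_max => /andP[Mn Nn]; rewrite -uv //; exact: NP.
Qed.

Lemma has_sum_finite (I : eqType) (f : I -> K) (s : seq I) : uniq s ->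
  (forall i, i \notin s -> f i = 0) -> has_sum f (\sum_(i <- s) f i).
Proof.
move=> us fs e e0; exists s => F uF sF.
suff -> : \sum_(i <- F) f i = \sum_(i <- s) f i by rewrite subrr normr0.
rewrite (bigID (mem s)) /= [X in _ + X]big1 => [|i]; last exact: fs.
rewrite addr0 -big_filter; apply/perm_big/uniq_perm; rewrite ?filter_uniq // => i.
by rewrite mem_filter; case: (boolP (i \in s)) => //= /sF ->.
Qed.

End HasSum.

(** * Bounds on infinite products, and the q-binomial theorem *)

Section InfiniteProducts.
Variable K : numFieldType.

(** The Weierstrass product inequality. *)
Lemma prod_one_sub_ge (n : nat) (x : nat -> K) : (forall k, 0 <= x k) ->
  \sum_(k < n) x k <= 1 -> 1 - \sum_(k < n) x k <= \prod_(k < n) (1 - x k).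
Proof.
move=> x0; elim: n => [|n IHn]; first by rewrite !big_ord0 subr0.
rewrite !big_ord_recr /=; set s := \sum_(k < n) x k; set p := \prod_(k < n) _ => le1.
have s0 : 0 <= s by apply: sumr_ge0.
have xn1 : x n <= 1 by apply: le_trans le1; rewrite lerDr.
have sp : 1 - s <= p by apply: IHn; apply: le_trans le1; rewrite lerDl.
apply: le_trans (ler_wpM2r _ sp); last by rewrite subr_ge0.
rewrite -subr_ge0 (_ : _ - _ = s * x n) ?mulr_ge0 //; ring.
Qed.

(** Beyond some index the norms sum to less than 1/2, and the product of that tail stays above 1/2.
    The finitely many earlier factors are nonzero and are put back one at a time. *)
Lemma prod_lower_bound (a : nat -> K) s : has_sum (fun n => `|a n|) s ->
    (forall n, 1 - a n != 0) ->
  exists2 c, 0 < c & forall N, c <= `|\prod_(n < N) (1 - a n)|.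
Proof.
move=> hs a1; have half0 : 0 < 2^-1 :> K by rewrite invr_gt0 ltr0n.
have [F0 uF0 F0P] := has_sum_tail hs half0.
pose P M := exists2 c, 0 < c & forall N, c <= `|\prod_(n < N) (1 - a (n + M)%N)|.
have tail : exists M, P M.
  pose M := (\max_(k <- F0) k.+1)%N; exists M; exists 2^-1 => // N.
  have lt : \sum_(n < N) `|a (n + M)%N| < 2^-1.
    rewrite -(big_mkord xpredT (fun n => `|a (n + M)%N|)).
    have -> : \sum_(0 <= i < N) `|a (i + M)%N| = \sum_(k <- iota M N) `|a k|.
      rewrite -[M in iota M]addn0 iotaDl big_map /index_iota subn0.
      by apply: eq_bigr => i _; rewrite addnC.
    apply: F0P; rewrite ?iota_uniq // => k; rewrite mem_iota => /andP[Mk _].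
    apply/negP => kF; move: Mk; rewrite leqNgt => /negP; apply.
    by rewrite /M (big_rem k) //= leq_maxl.
  rewrite normr_prod; apply: le_trans (_ : \prod_(n < N) (1 - `|a (n + M)%N|) <= _).
    apply: le_trans (prod_one_sub_ge (x := fun n => `|a (n + M)%N|) _ _) => //; last first.
      by apply: ltW (lt_le_trans lt _); rewrite invf_le1 ?ler1n ?ltr0n.
    rewrite lerBrDr -lerBrDl (_ : 1 - 2^-1 = 2^-1) ?ltW //.
    by field.
  apply: ler_prod => n _; rewrite subr_ge0; apply/andP; split.
    have le : `|a (n + M)%N| <= \sum_(n < N) `|a (n + M)%N|.
      by rewrite (bigD1 n) //= lerDl sumr_ge0.
    by apply: le_trans le (ltW (lt_le_trans lt _)); rewrite invf_le1 ?ler1n ?ltr0n.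
  by rewrite -{1}(normr1 K) lerB_dist.
have step M : P M.+1 -> P M.
  move=> [c c0 cP]; have aM : 0 < `|1 - a M| by rewrite normr_gt0.
  have d0 : 0 < 1 + `|1 - a M| * c by rewrite addr_gt0 // mulr_gt0.
  (* With t = |1 - a M| c, the bound t / (1 + t) lies below t and also below 1, the value of the
     empty product. *)
  exists (`|1 - a M| * c / (1 + `|1 - a M| * c)); first by rewrite divr_gt0 // mulr_gt0.
  case=> [|N].
    by rewrite big_ord0 normr1 ler_pdivrMr // mul1r lerDr.
  rewrite big_ord_recl /= add0n normrM ler_pdivrMr //.
  have eN : \prod_(n < N) (1 - a (n + M.+1)%N) = \prod_(i < N) (1 - a (i.+1 + M)%N).
    by apply: eq_bigr => i _; rewrite addnS.
  have := cP N; rewrite eN => cN.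
  apply: le_trans (_ : `|1 - a M| * `|\prod_(i < N) (1 - a (i.+1 + M)%N)| <= _).
    by rewrite ler_wpM2l.
  by rewrite ler_peMr ?mulr_ge0 // lerDl mulr_ge0 // ltW.
have [M PM] := tail; have [c c0 cP] : P 0%N.
  by elim: M PM => // M IHM /step.
by exists c => // N; have := cP N; under eq_bigr do rewrite addn0.
Qed.

(** Since 1 - x / (1 + x) = 1 / (1 + x), an upper bound on the product of the 1 + |a n| is the
    inverse of a lower bound of the previous kind. *)
Lemma prod_upper_bound (a : nat -> K) s s' : has_sum (fun n => `|a n|) s ->
    has_sum (fun n => `| `|a n| / (1 + `|a n|) |) s' ->
  exists C, forall N, `|\prod_(n < N) (1 - a n)| <= C.
Proof.
move=> hs hs'; have d0 n : 0 < 1 + `|a n| by rewrite ltr_wpDr.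
have e n : 1 - `|a n| / (1 + `|a n|) = (1 + `|a n|)^-1 by field; rewrite gt_eqF.
have [|c c0 cP] := prod_lower_bound hs'.
  by move=> n; rewrite e invr_neq0 // gt_eqF.
exists c^-1 => N; apply: le_trans (_ : \prod_(n < N) (1 + `|a n|) <= _).
  rewrite normr_prod; apply: ler_prod => n _; rewrite normr_ge0 /=.
  by apply: le_trans (ler_normB _ _) _; rewrite normr1.
have := cP N; under eq_bigr do rewrite e.
have p0 : 0 < \prod_(n < N) (1 + `|a n|) by apply: prodr_gt0.
rewrite prodfV normfV gtr0_norm // => le.
by rewrite -[leLHS]invrK lef_pV2 // posrE invr_gt0.
Qed.

Section Poch.
Variable q : K.

Definition qpoch n := \prod_(k < n) (1 - q ^+ k.+1).

Lemma qpochS n : qpoch n.+1 = qpoch n * (1 - q ^+ n.+1).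
Proof. by rewrite /qpoch big_ord_recr. Qed.

(** Gaussian binomial coefficients through the q-Pascal rule, which needs no division; [gbin_poch]
    relates them to quotients of q-factorials. *)
Fixpoint gbin n k : K :=
  match n, k with
  | _, 0%N => 1
  | 0%N, _.+1 => 0
  | n'.+1, k'.+1 => gbin n' k'.+1 + q ^+ (n' - k') * gbin n' k'
  end.

Lemma gbin_small n k : (n < k)%N -> gbin n k = 0.
Proof.
elim: n k => [|n IHn] [|k] //= nk; rewrite !IHn ?mulr0 ?addr0 //; lia.
Qed.

Lemma gbinS n k : gbin n.+1 k.+1 = gbin n k.+1 + q ^+ (n - k) * gbin n k.
Proof. by []. Qed.

Lemma gbin0 n : gbin n 0 = 1. Proof. by case: n. Qed.

Lemma gbin_poch n k : (k <= n)%N -> gbin n k * (qpoch k * qpoch (n - k)) = qpoch n.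
Proof.
elim: n k => [|n IHn] [|k] // kn.
- by rewrite /qpoch big_ord0 !mulr1.
- by rewrite gbin0 subn0 /qpoch big_ord0 !mul1r.
rewrite gbinS subSS mulrDl.
have [->|nk] := eqVneq k n.
  rewrite gbin_small ?ltnSn // subnn expr0 mul1r mul0r add0r.
  rewrite qpochS -[in RHS](IHn n (leqnn n)) subnn; ring.
have {}kn : (k < n)%N by rewrite ltn_neqAle nk.
have e : (n - k)%N = (n - k.+1).+1 by rewrite subnSK.
have e1 : q ^+ n.+1 = q ^+ (n - k) * q ^+ k.+1 by rewrite -exprD; congr (_ ^+ _); lia.
have h1 := IHn k.+1 kn; have h2 := IHn k (ltnW kn).
rewrite (qpochS n) e1.
transitivity ((gbin n k.+1 * (qpoch k.+1 * qpoch (n - k.+1))) * (1 - q ^+ (n - k))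
   + q ^+ (n - k) * (1 - q ^+ k.+1) * (gbin n k * (qpoch k * qpoch (n - k)))).
  have hP : qpoch (n - k) = qpoch (n - k.+1) * (1 - q ^+ (n - k)) by rewrite e qpochS.
  by rewrite hP (qpochS k); ring.
by rewrite h1 h2; ring.
Qed.

Lemma gauss_binomial n (X Y : K) : \prod_(k < n) (Y + q ^+ k * X) =
  \sum_(i < n.+1) gbin n i * q ^+ 'C(i, 2) * X ^+ i * Y ^+ (n - i).
Proof.
elim: n => [|n IHn]; first by rewrite big_ord0 big_ord1 /= !mulr1.
rewrite big_ord_recr /= IHn [RHS]big_ord_recl /= !mulr1 !mul1r subn0.
(* The factor [(i < n)%:R] switches off the term i = n, in which the subtraction [n - i.+1] is
   truncated. *)
transitivity (Y ^+ n.+1 + \sum_(i < n.+1) (Y * (gbin n i.+1 * q ^+ 'C(i.+1, 2) * X ^+ i.+1 * Y ^+ (n - i.+1)) * (i < n)%:R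
  + q ^+ n * X * (gbin n i * q ^+ 'C(i, 2) * X ^+ i * Y ^+ (n - i)))).
  rewrite big_split /= -mulr_sumr addrA mulrDr [X in _ + X]mulrC; congr (_ + _).
  rewrite [in RHS]big_ord_recr /= ltnn mulr0 addr0 mulr_suml [LHS]big_ord_recl /= gbin0 subn0.
  congr (_ + _); first by rewrite bin_small // !expr0 !mul1r exprSr.
  by apply: eq_bigr => i _; rewrite /bump leq0n add1n ltn_ord mulr1 [LHS]mulrC.
congr (_ + _); apply: eq_bigr => i _; rewrite /bump /= add0n add1n subSS.
rewrite binS bin1 exprD.
have e : q ^+ n = q ^+ (n - i) * q ^+ i by rewrite -exprD subnK // -ltnS.
rewrite e; case: ltnP => [ilt|ige].
  have -> : (n - i)%N = (n - i.+1).+1 by rewrite subnSK.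
  by rewrite mulr1 !exprS; ring.
have -> : (n - i)%N = 0%N by apply/eqP; rewrite subn_eq0.
rewrite mulr0 (@gbin_small n i.+1) ?ltnS // exprS; ring.
Qed.

End Poch.
End InfiniteProducts.

Import numFieldNormedType.Exports.

Local Open Scope classical_set_scope.
Local Open Scope ring_scope.
Local Open Scope complex_scope.

(** * Maximal ideals of the center *)

Lemma uncountable_realType (R : realType) : ~ countable [set: R].
Proof.
move=> /countable_lebesgue_measure0 m0.
have := lebesgue_measure_itv (`[0, 1]%R : interval R); rewrite /= lte_fin ltr01 sube0.
move=> m1; have : (lebesgue_measure `[0%R, 1%R]%classic <= lebesgue_measure [set: R])%E.
  by apply: le_measure; rewrite ?inE //.
by rewrite m0 m1 lee_fin ler10.
Qed.

Lemma uncountable_complex (R : realType) : ~ countable [set: R[i]].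
Proof.
move=> /countable_injP[f injf]; apply: (@uncountable_realType R).
apply/countable_injP; exists (f \o (fun r : R => r%:C)) => r s _ _ /= e.
by have [] : r%:C = s%:C by apply: injf; rewrite ?inE.
Qed.

Section CenterIdeals.
Variables (K : fieldType) (A : algType K).

Lemma center_scalar c : Defs.center (c%:A : A).
Proof. by move=> u; rewrite mulr_algl mulr_algr. Qed.

Lemma centerM (u v : A) : Defs.center u -> Defs.center v -> Defs.center (u * v).
Proof. by move=> cu cv w; rewrite -mulrA cv mulrA cu mulrA. Qed.

Lemma centerD (u v : A) : Defs.center u -> Defs.center v -> Defs.center (u + v).
Proof. by move=> cu cv w; rewrite mulrDl mulrDr cu cv. Qed.

Lemma centerZ c (u : A) : Defs.center u -> Defs.center (c *: u).
Proof. by move=> cu; rewrite -mulr_algl; apply: centerM; first exact: center_scalar. Qed.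

Lemma centerB (u v : A) : Defs.center u -> Defs.center v -> Defs.center (u - v).
Proof. by move=> cu cv; rewrite -scaleN1r; apply/centerD/centerZ. Qed.

Lemma center_horner_alg (z : A) p : Defs.center z -> Defs.center (horner_alg z p).
Proof.
move=> cz; elim/poly_ind: p => [|p c IHp].
  by rewrite rmorph0 -(scale0r 1); exact: center_scalar.
rewrite rmorphD rmorphM /= horner_algX horner_algC.
by apply: centerD (center_scalar _); apply: centerM.
Qed.

Variable m : set A.
Hypothesis m_ideal : center_ideal m.

Lemma cideal_center u : m u -> Defs.center u.
Proof. by case: m_ideal => + _ _ _; apply. Qed.

Lemma cideal0 : m 0. Proof. by case: m_ideal. Qed.

Lemma cidealD u v : m u -> m v -> m (u + v).
Proof. by case: m_ideal => _ _ + _; apply. Qed.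

Lemma cidealM z u : Defs.center z -> m u -> m (z * u).
Proof. by case: m_ideal => _ _ _; apply. Qed.

Lemma cidealMr u z : Defs.center z -> m u -> m (u * z).
Proof. by move=> cz mu; rewrite -cz; exact: cidealM. Qed.

Lemma cidealZ c u : m u -> m (c *: u).
Proof. by move=> mu; rewrite -mulr_algl; apply: cidealM => //; exact: center_scalar. Qed.

Lemma cidealB u v : m u -> m v -> m (u - v).
Proof. by move=> mu mv; rewrite -scaleN1r; apply/cidealD/cidealZ. Qed.

Lemma cideal_sum (I : Type) (r : seq I) (F : I -> A) :
  (forall i, m (F i)) -> m (\sum_(i <- r) F i).
Proof. by move=> mF; apply: big_ind => //; [exact: cideal0 | exact: cidealD]. Qed.

End CenterIdeals.

Section MaximalIdeals.
Variables (K : fieldType) (A : algType K) (m : set A).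
Hypothesis m_max : maximal_center_ideal m.

Let m_ideal : center_ideal m. Proof. by case: m_max. Qed.

(** The ideal m + Z(A) z contains z and so is larger than m; hence it contains 1. *)
Lemma maximal_ideal_inverse z :
  Defs.center z -> ~ m z -> exists2 w, Defs.center w & m (1 - w * z).
Proof.
move=> cz mz.
pose I := [set u | Defs.center u /\ exists2 w, Defs.center w & m (u - w * z)].
have I_ideal : center_ideal I.
  split=> [u []//||u v [cu [w cw mw]] [cv [w' cw' mw']]|y u cy [cu [w cw mw]]].
  - split; first by rewrite -(scale0r 1); exact: center_scalar.
    exists 0; first by rewrite -(scale0r 1); exact: center_scalar.
    by rewrite mul0r subr0; exact: cideal0.
  - split; first exact: centerD.
    exists (w + w'); first exact: centerD.
    by rewrite mulrDl opprD addrACA; exact: cidealD.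
  - split; first exact: centerM.
    exists (y * w); first exact: centerM.
    by rewrite -mulrA -mulrBr; exact: cidealM.
have c0 : Defs.center (0 : A) by rewrite -(scale0r 1); exact: center_scalar.
have mI : m `<=` I.
  move=> u mu; split; first exact: cideal_center mu.
  by exists 0 => //; rewrite mul0r subr0.
have [_ _ /(_ I I_ideal)] := m_max.
have [[_ []]|nI1] := pselect (I 1); first by move=> w; exists w.
move=> /(_ nI1 mI) Im; case: mz; rewrite -Im; split=> //.
exists 1; first by rewrite -(scale1r 1); exact: center_scalar.
by rewrite mul1r subrr; exact: cideal0.
Qed.

Lemma maximal_ideal_prime u v : Defs.center u -> Defs.center v -> m (u * v) -> m u \/ m v.
Proof.
move=> cu cv muv; have [mu|nmu] := pselect (m u); [by left | right].
have [w cw m1w] := maximal_ideal_inverse cu nmu.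
have -> : v = (1 - w * u) * v + w * (u * v) by rewrite mulrBl mul1r mulrA subrK.
by apply: cidealD => //; [apply: cidealMr | apply: cidealM].
Qed.

End MaximalIdeals.

(** * Residue fields over an uncountable algebraically closed field *)

Section Nullstellensatz.
Variables (K : closedFieldType) (A : algType K) (m : set A).
Hypothesis K_uncountable : ~ countable [set: K].
Hypothesis m_max : maximal_center_ideal m.
Variable e : nat -> A.
Hypothesis e_span : forall z : A, Defs.center z ->
  exists N (l : nat -> K), z = \sum_(k < N) l k *: e k.

Let m_ideal : center_ideal m. Proof. by case: m_max. Qed.
Let m1 : ~ m 1. Proof. by case: m_max. Qed.

(* If no z - c lay in m, all of them would have inverses w c modulo m.  As K is uncountable
   and the center has countable dimension, some of these are linearly dependent, and
   clearing denominators yields a polynomial p with p(z) in m. *)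
Lemma maximal_ideal_residue z : Defs.center z -> exists c : K, m (z - c%:A).
Proof.
move=> cz; apply: contrapT => /forallNP nz.
have ct c : Defs.center (z - c%:A) by apply/centerB/center_scalar.
have [w wP] : {w : K -> A & forall c, Defs.center (w c) /\ m (1 - w c * (z - c%:A))}.
  apply: (@choice _ _ (fun c u => Defs.center u /\ m (1 - u * (z - c%:A)))) => c.
  by have [u] := maximal_ideal_inverse m_max (ct c) (nz c); exists u.
have NlP c : exists p : nat * (nat -> K), w c = \sum_(k < p.1) p.2 k *: e k.
  by have [N [l wE]] := e_span (wP c).1; exists (N, l).
have {NlP} [Nl NlP] := choice NlP.
(* Otherwise K would be a countable union of finite sets. N + 1 of the inverses then lie in the span
   of N elements. *)
have [N infN] : exists N, infinite_set [set c | (Nl c).1 = N].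
  apply: contrapT => /forallNP fin; apply: K_uncountable.
  have -> : [set: K] = \bigcup_(N in [set: nat]) [set c | (Nl c).1 = N].
    by apply/seteqP; split => // c _; exists (Nl c).1.
  apply: bigcup_countable => // N _.
  by apply: finite_set_countable; apply: contrapT; exact: fin.
have [B BN cardB] := infinite_set_fset N.+1 infN.
pose s (i : 'I_N.+1) : K := nth 0 (finmap.enum_fset B) i.
have sB i : s i \in finmap.enum_fset B by rewrite mem_nth // (leq_trans (ltn_ord i)).
have injs : injective s.
  by move=> i j /eqP; rewrite nth_uniq ?(leq_trans (ltn_ord _)) ?finmap.fset_uniq // => /eqP/val_inj.
have wE i : w (s i) = \sum_(k < N) (Nl (s i)).2 k *: e k by rewrite NlP (BN _ (sB i)).
pose M : 'M[K]_(N.+1, N) := \matrix_(i, k) (Nl (s i)).2 k.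
have /rowV0Pn[mu /sub_kermxP muM mu_neq0] : kermx M != 0.
  by rewrite kermx_eq0 /row_free neq_ltn (leq_ltn_trans (rank_leq_col _)).
have sum_w : \sum_i mu 0 i *: w (s i) = 0.
  under eq_bigr do rewrite wE scaler_sumr.
  rewrite exchange_big big1 // => k _ /=.
  have -> : \sum_i mu 0 i *: ((Nl (s i)).2 k *: e k) = (mu *m M) 0 k *: e k.
    by rewrite mxE scaler_suml; apply: eq_bigr => i _; rewrite scalerA mxE.
  by rewrite muM mxE scale0r.
(* The dependence between the inverses of the z - s_i after clearing denominators. At s_i only the
   i-th summand survives, so p is not 0. *)
pose p : {poly K} := \sum_i mu 0 i *: \prod_(j | j != i) ('X - (s j)%:P).
have p_neq0 : p != 0.
  have [i mui] : exists i, mu 0 i != 0 by have /matrix0Pn[j [i mui]] := mu_neq0; exists i; rewrite -(ord1 j).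
  apply/negP => /eqP/(congr1 (horner^~ (s i))); rewrite /p horner_sum horner0.
  rewrite (bigD1 i) //= [X in _ + X]big1 ?addr0 => [|j ji].
    rewrite hornerZ horner_prod => /eqP; rewrite mulf_eq0 (negPf mui) /= prodf_seq_eq0.
    move=> /hasP[j _ /andP[ji]]; rewrite hornerXsubC subr_eq0 (inj_eq injs).
    by rewrite eq_sym (negPf ji).
  by rewrite hornerZ horner_prod (bigD1 i) 1?eq_sym //= hornerXsubC subrr mul0r mulr0.
have linE c : horner_alg z ('X - c%:P) = z - c%:A.
  by rewrite rmorphB /= horner_algX horner_algC.
have haZ c q : horner_alg z (c *: q) = c *: horner_alg z q.
  by rewrite -mul_polyC rmorphM /= horner_algC mulr_algl.
have mp : m (horner_alg z p).
  (* The subtracted terms add up to a multiple of the vanishing combination of the [w (s i)], and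
     each factor 1 - w (z - s_i) lies in m. *)
  have -> : horner_alg z p = \sum_i mu 0 i *: ((1 - w (s i) * (z - (s i)%:A)) *
       horner_alg z (\prod_(j | j != i) ('X - (s j)%:P))).
    under eq_bigr do rewrite mulrBl mul1r scalerBr.
    rewrite sumrB [X in _ - X](_ : _ = 0) ?subr0.
      by rewrite /p rmorph_sum; apply: eq_bigr => i _; exact: haZ.
    under eq_bigr => i _ do rewrite -linE -mulrA -rmorphM.
    transitivity ((\sum_i mu 0 i *: w (s i)) * horner_alg z (\prod_j ('X - (s j)%:P))).
      rewrite mulr_suml; apply: eq_bigr => i _; rewrite -scalerAl; congr (_ *: (_ * horner_alg _ _)).
      by apply/esym; rewrite (bigD1 i).
    by rewrite sum_w mul0r.
  apply: (cideal_sum m_ideal) => i; apply/(cidealZ m_ideal)/(cidealMr m_ideal); last exact: (wP _).2.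
  exact: center_horner_alg.
have [rs pE] := closed_field_poly_normal p.
have {mp} : m (horner_alg z (\prod_(r <- rs) ('X - r%:P))).
  move: mp; rewrite pE haZ => /(cidealZ m_ideal (lead_coef p)^-1).
  rewrite scalerA mulVf ?scale1r //.
  by rewrite lead_coef_eq0.
elim: rs {pE} => [|r rs IHrs]; first by rewrite big_nil rmorph1.
rewrite big_cons rmorphM /= linE => /(maximal_ideal_prime m_max (ct r))[|mr|//].
  exact: center_horner_alg.
exact: nz mr.
Qed.
End Nullstellensatz.

Section GeneratedSpan.
Variables (K : fieldType) (A : algType K) (I : finType) (g : I -> A).

(** Words in finitely many generators can be enumerated by [pickle]; numbers that code no word are
    sent to 0. *)
Lemma generated_subalgebra_span (G : set A) : G `<=` range g ->
  exists e : nat -> A, forall z, generated_subalgebra G z ->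
    exists N (l : nat -> K), z = \sum_(k < N) l k *: e k.
Proof.
move=> Gg; pose mono w := \prod_(i <- w) g i.
pose e k : A := if unpickle k is Some w then mono w else 0.
exists e => z genz.
pose B : set A := [set u | exists s : seq (K * seq I), u = \sum_(p <- s) p.1 *: mono p.2].
have BD u v : B u -> B v -> B (u + v).
  by move=> [s ->] [t ->]; exists (s ++ t); rewrite big_cat.
have B0 : B 0 by exists [::]; rewrite big_nil.
have Bm c w : B (c *: mono w) by exists [:: (c, w)]; rewrite big_seq1.
have BZ c u : B u -> B (c *: u).
  move=> [s ->]; rewrite scaler_sumr; apply: (big_ind B) => // p _.
  by rewrite scalerA.
have subB : subalgebra B.
  split=> [|c u v Bu Bv|_ _ [s ->] [t ->]]; last 1 first.
  - rewrite mulr_suml; apply: (big_ind B) => // p _.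
    rewrite mulr_sumr; apply: (big_ind B) => // q _.
    by rewrite -scalerAl -scalerAr scalerA /mono -big_cat; exact: Bm.
  - by have := Bm 1 [::]; rewrite /mono big_nil scale1r.
  - by apply: BD => //; exact: BZ.
have [s ->] : B z.
  apply: genz => // u /Gg[i _ <-].
  by have := Bm 1 [:: i]; rewrite /mono big_seq1 scale1r.
elim: s {z genz} => [|[c w] s [N [l IHs]]].
  by exists 0%N, (fun=> 0); rewrite big_nil big_ord0.
pose l0 k := if (k < N)%N then l k else 0.
pose M := (maxn N (pickle w).+1).
exists M, (fun k => l0 k + (k == pickle w)%:R * c).
rewrite big_cons IHs /=; under [RHS]eq_bigr do rewrite scalerDl.
rewrite big_split /= [LHS]addrC; congr (_ + _).
  rewrite (big_ord_widen M (fun k => l k *: e k)) ?leq_maxl // big_mkcond.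
  by apply: eq_bigr => k _; rewrite /l0; case: ifP => //; rewrite scale0r.
have wM : (pickle w < M)%N by rewrite leq_maxr.
rewrite (bigD1 (Ordinal wM)) //= eqxx mul1r big1 ?addr0.
  by rewrite /e pickleK.
by move=> k /negPf; rewrite -val_eqE /= => ->; rewrite mul0r scale0r.
Qed.

End GeneratedSpan.

Section Residues.
Variables (K : fieldType) (A : algType K) (m : set A).
Hypothesis m_ideal : center_ideal m.

(** The value of z at the point m, kept as a relation so that it can be used for any ideal of the
    center. It is single-valued when m is proper, and defined on the whole center when m is
    maximal. *)
Definition residue (z : A) (c : K) : Prop := Defs.center z /\ m (z - c%:A).

Lemma residue_scalar c : residue c%:A c.
Proof. by split; [exact: center_scalar | rewrite subrr; exact: cideal0]. Qed.

Lemma residueD u v c d : residue u c -> residue v d -> residue (u + v) (c + d).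
Proof.
move=> [cu mu] [cv mv]; split; first exact: centerD.
by rewrite scalerDl opprD addrACA; exact: cidealD.
Qed.

Lemma residueM u v c d : residue u c -> residue v d -> residue (u * v) (c * d).
Proof.
move=> [cu mu] [cv mv]; split; first exact: centerM.
rewrite (_ : _ - _ = (u - c%:A) * v + c *: (v - d%:A)).
  by apply: (cidealD m_ideal); [exact: cidealMr | exact: cidealZ].
by rewrite mulrBl mulr_algl scalerBr scalerA addrA subrK.
Qed.

Lemma residue_det n (M : 'M[A]_n) (N : 'M[K]_n) :
  (forall i j, residue (M i j) (N i j)) -> residue (\det M) (\det N).
Proof.
move=> MN; rewrite /determinant.
apply: (big_ind2 residue) => [||s _].
- by rewrite -(scale0r 1); exact: residue_scalar.
- by move=> u c v d; exact: residueD.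
- apply: residueM.
    rewrite (_ : (-1) ^+ (perm.odd_perm s) = ((-1) ^+ (perm.odd_perm s) : K)%:A); first exact: residue_scalar.
    by case: (perm.odd_perm s); rewrite ?expr0 ?expr1 ?scaleN1r ?scale1r.
  apply: (big_ind2 residue) => [||i _].
  + by rewrite -(scale1r 1); exact: residue_scalar.
  + by move=> u c v d; exact: residueM.
  + exact: MN.
Qed.

Lemma residue_uniq z c d : ~ m 1 -> residue z c -> residue z d -> c = d.
Proof.
move=> m1 [_ mc] [_ md]; have [//|cd] := eqVneq c d; case: m1.
have /(cidealZ m_ideal (d - c)^-1) := cidealB m_ideal mc md.
rewrite opprB addrCA addrAC subrr add0r -scalerBl scalerA mulVf ?scale1r //.
by rewrite subr_eq0 eq_sym.
Qed.
End Residues.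

(** * Representations of the Clifford algebra *)

Section SubalgebraType.
Variables (K : fieldType) (A : algType K) (B : set A) (subB : subalgebra B).

Definition subalg_pred : {pred A} := fun u => `[< B u >].

(** The proof is an argument so that the algebra instances on this type can be found from the type
    alone. *)
Definition subalg_of (_ : subalgebra B) := {u : A | subalg_pred u}.

Lemma subalg_predP : subalg_closed subalg_pred.
Proof.
have inS u : (u \in subalg_pred) = `[< B u >] by [].
case: subB => B1 BZ BM; split => [|c u v|u v]; rewrite !inS.
- exact/asboolP.
- by move=> /asboolP Bu /asboolP Bv; apply/asboolP/BZ.
- by move=> /asboolP Bu /asboolP Bv; apply/asboolP/BM.
Qed.

HB.instance Definition _ := SubType.on (subalg_of subB).
HB.instance Definition _ := Choice.on (subalg_of subB).
HB.instance Definition _ := SubChoice.on (subalg_of subB).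
HB.instance Definition _ := GRing.SubChoice_isSubAlgebra.Build K A subalg_pred
  (subalg_of subB) (GRing.subalg_closed_semi subalg_predP).

Definition subalg_val (u : subalg_of subB) : A := val u.

Lemma subalg_valZ : linear subalg_val.
Proof. by move=> c u v; rewrite /subalg_val [LHS]raddfD [X in X + _ = _]GRing.valZ. Qed.
Lemma subalg_valM : GRing.monoid_morphism subalg_val.
Proof. by split; [exact: rmorph1|exact: rmorphM]. Qed.

HB.instance Definition _ := GRing.isLinear.Build K (subalg_of subB) A _ subalg_val subalg_valZ.
HB.instance Definition _ := GRing.isMonoidMorphism.Build (subalg_of subB) A subalg_val subalg_valM.

End SubalgebraType.

Lemma lrmorph_anticommutator (K : fieldType) (A B : algType K)
    (f : {lrmorphism A -> B}) (u v w : A) (c : K) : injective f ->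
  f u * f v + f v * f u = c *: f w ^+ 2 -> u * v + v * u = c *: w ^+ 2.
Proof.
move=> inj_f e; apply: inj_f.
by rewrite linearZ /= rmorphXn /= -e rmorphD /= !rmorphM.
Qed.

Section Generation.
Variables (R : realType) (a b : R[i]) (A : algType R[i]) (x : 'Z_5 -> A).
Hypothesis pres : presented_by (@clifford_relations R a b) x.

(** The universal property sends A into the subalgebra B. Followed by the inclusion, this map fixes
    the generators, so it is the identity of A. *)
Lemma presented_ind (B : set A) :
  subalgebra B -> (forall i, B (x i)) -> forall u, B u.
Proof.
move=> subB Bx u; have [relx univ] := pres.
have Sx i : subalg_pred B (x i) by apply/asboolP.
pose y i : subalg_of subB := Sub (x i) (Sx i).
pose f : {lrmorphism subalg_of subB -> A} := @subalg_val _ _ _ subB.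
have inj_f : injective f by exact: val_inj.
have rely : clifford_relations a b y.
  by move=> k; have [e1 e2] := relx k; split; apply: (lrmorph_anticommutator inj_f).
have [[g gx] _] := univ _ _ rely.
have [_ uniq] := univ _ _ relx.
have -> : u = (f \o g) u by apply: (uniq idfun (f \o g)) => i; rewrite /= gx.
by have /asboolP := valP (g u).
Qed.
End Generation.

Section QmxEntries.
Variables (B : comPzRingType) (a b : B) (y : 'Z_5 -> B) (k : 'Z_5).

Lemma Qmx_diag : Qmx a b y k k = 2 * y k.
Proof. by case/or4P: (Z5_cases k) => [/eqP->|/eqP->|/eqP->|/orP[]/eqP->]; rewrite mxE. Qed.

Lemma Qmx_entry14 : Qmx a b y (1 + k) (4 + k) = a * y k.
Proof.
rewrite -[in RHS](add0r k).
have /matrixP/(_ 1 4) := Qmx_shift a b y k; rewrite [RHS]mxE => <-.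
by rewrite mxE.
Qed.

Lemma Qmx_entry23 : Qmx a b y (2 + k) (3 + k) = b * y k.
Proof.
rewrite -[in RHS](add0r k).
have /matrixP/(_ 2 3) := Qmx_shift a b y k; rewrite [RHS]mxE => <-.
by rewrite mxE.
Qed.

Lemma Qmx_sym i j : Qmx a b y i j = Qmx a b y j i.
Proof. by rewrite -[in LHS](trmx_Qmx a b y) mxE. Qed.

End QmxEntries.

(** Two distinct indices occur together in one relation only, that of their midpoint k = 3 (i + j)
    mod 5. *)
Lemma Z5_pair (i j : 'Z_5) : i = j \/
  exists k : 'Z_5, [\/ i = 1 + k /\ j = 4 + k, j = 1 + k /\ i = 4 + k,
    i = 2 + k /\ j = 3 + k | j = 2 + k /\ i = 3 + k].
Proof.
have five (z : 'Z_5) : 5 + z = z by rewrite (_ : 5 = 0) ?add0r //; exact: val_inj.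
have -> : j = (j - i) + i by rewrite subrK.
case/or4P: (Z5_cases (j - i)) => [/eqP->|/eqP->|/eqP->|/orP[]/eqP->].
- by left; rewrite add0r.
- right; exists (i + 3); apply: Or43.
  by split; [rewrite -[LHS]five; ring | rewrite -[LHS]five; ring].
- right; exists (i + 1); apply: Or42.
  by split; [ring | rewrite -[LHS]five; ring].
- right; exists (i + 4); apply: Or41.
  by split; rewrite -[LHS]five; ring.
- right; exists (i + 2); apply: Or44.
  by split; [ring | rewrite -[LHS]five; ring].
Qed.

Section Representations.
Variables (R : realType) (a b : R[i]) (A : algType R[i]) (x : 'Z_5 -> A).
Hypothesis pres : presented_by (@clifford_relations R a b) x.
Notation K := R[i].

Lemma clifford_relations_of_module d (p : 'Z_5 -> K) (X : 'Z_5 -> 'M[K]_d.+1) :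
  clifford_module (Qmx a b p) X ->
  clifford_relations a b X /\ forall i, X i ^+ 2 = (p i)%:M.
Proof.
move=> modX; have two_neq0 : (2 : K) != 0 by rewrite pnatr_eq0.
have sq i : X i ^+ 2 = (p i)%:M.
  apply: (scalerI two_neq0); rewrite scaler_nat mulr2n expr2 scale_scalar_mx.
  by rewrite -(Qmx_diag a b); exact: modX.
split=> // k; rewrite !sq !scale_scalar_mx -(Qmx_entry14 a b p) -(Qmx_entry23 a b p).
by split; exact: modX.
Qed.

Lemma module_of_rep d (rho : {lrmorphism A -> 'M[K]_d.+1}) (p : 'Z_5 -> K) :
  (forall i, rho (x i ^+ 2) = (p i)%:M) -> clifford_module (Qmx a b p) (fun i => rho (x i)).
Proof.
move=> sq; have [relx _] := pres.
have r14 k : rho (x (1 + k)) *m rho (x (4 + k)) + rho (x (4 + k)) *m rho (x (1 + k)) =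
    (a * p k)%:M.
  have e := congr1 rho (relx k).1.
  by rewrite rmorphD !rmorphM linearZ /= sq scale_scalar_mx in e.
have r23 k : rho (x (2 + k)) *m rho (x (3 + k)) + rho (x (3 + k)) *m rho (x (2 + k)) =
    (b * p k)%:M.
  have e := congr1 rho (relx k).2.
  by rewrite rmorphD !rmorphM linearZ /= sq scale_scalar_mx in e.
move=> i j; have [->|[k [] [-> ->]]] := Z5_pair i j.
- have e : rho (x j) *m rho (x j) = (p j)%:M by rewrite -sq expr2 [RHS]rmorphM.
  by rewrite e Qmx_diag mulr_natl mulr2n raddfD.
- by rewrite r14 Qmx_entry14.
- by rewrite addrC r14 Qmx_sym Qmx_entry14.
- by rewrite r23 Qmx_entry23.
- by rewrite addrC r23 Qmx_sym Qmx_entry23.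
Qed.

Lemma rep_of_module d (p : 'Z_5 -> K) (X : 'Z_5 -> 'M[K]_d.+1) :
    clifford_module (Qmx a b p) X ->
  exists rho : {lrmorphism A -> 'M[K]_d.+1},
    (forall i, rho (x i) = X i) /\ forall i, rho (x i ^+ 2) = (p i)%:M.
Proof.
move=> /clifford_relations_of_module[relX sqX]; have [_ univ] := pres.
have [[rho rhoE] _] := univ _ _ relX.
by exists rho; split => // i; rewrite rmorphXn /= rhoE sqX.
Qed.

Lemma stable_generators d (rho : {lrmorphism A -> 'M[K]_d.+1}) (V : {vspace 'cV[K]_d.+1}) :
    (forall i v, v \in V -> rho (x i) *m v \in V) ->
  forall u v, v \in V -> rho u *m v \in V.
Proof.
move=> stabV u; apply: (presented_ind pres (B := [set u | forall v, v \in V -> rho u *m v \in V])).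
  split=> [v|c u' w Bu Bw v Vv|u' w Bu Bw v Vv].
  - by rewrite rmorph1 mul1mx.
  - by rewrite linearP mulmxDl -scalemxAl memvD ?memvZ ?Bu ?Bw.
  - by rewrite rmorphM -mulmxA Bu // Bw.
by move=> i v /stabV.
Qed.

Lemma simple_repP d (rho : {lrmorphism A -> 'M[K]_d.+1}) :
  simple_rep rho <-> irreducible (fun i => rho (x i)).
Proof.
split=> [simple V stabV|irr V stabV].
  by apply: simple => u v; apply: stable_generators.
by apply: irr => i v; exact: stabV.
Qed.

Lemma isomorphic_generators d (rho rho' : {lrmorphism A -> 'M[K]_d.+1}) (P : 'M[K]_d.+1) :
  (forall i, P *m rho (x i) = rho' (x i) *m P) -> forall u, P *m rho u = rho' u *m P.
Proof.
move=> PX u; apply: (presented_ind pres (B := [set u | P *m rho u = rho' u *m P])) => //.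
split=> [|c v w /= Bv Bw|v w /= Bv Bw].
- by rewrite /= !rmorph1 mulmx1 mul1mx.
- by rewrite !(linearP rho, linearP rho') mulmxDr mulmxDl -scalemxAr -scalemxAl Bv Bw.
- by rewrite !rmorphM mulmxA Bv -mulmxA Bw mulmxA.
Qed.

(** Schur's lemma: for an eigenvalue c of [rho z], the kernel of [rho z - c%:M] is nonzero and
    stable. *)
Lemma simple_rep_center d (rho : {lrmorphism A -> 'M[K]_d.+1}) z :
  simple_rep rho -> Defs.center z -> exists c, rho z = c%:M.
Proof.
move=> simple cz.
have [c rc] : exists c, root (char_poly (rho z)) c.
  by apply/closed_rootP; rewrite size_char_poly.
exists c; apply/eqP; rewrite -subr_eq0; apply/eqP.
set M := rho z - c%:M.
have detM : \det M = 0.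
  move: rc; rewrite -eigenvalue_root_char => /eigenvalueP[v vz v_neq0].
  apply/eqP/det0P; exists v => //.
  by rewrite mulmxBr vz mul_mx_scalar subrr.
pose V := lker (linfun (mulmx M) : 'Hom('cV[K]_d.+1, 'cV[K]_d.+1)).
have memV w : (w \in V) = (M *m w == 0) by rewrite memv_ker lfunE.
have stabV u w : w \in V -> rho u *m w \in V.
  rewrite !memV => /eqP Mw.
  have -> : M *m (rho u *m w) = rho u *m (M *m w).
    rewrite !mulmxA; congr (_ *m _); rewrite /M mulmxBl mulmxBr.
    have -> : rho z *m rho u = rho u *m rho z.
      by rewrite -[LHS](rmorphM rho) -[RHS](rmorphM rho) cz.
    by rewrite mul_scalar_mx mul_mx_scalar.
  by rewrite Mw mulmx0.
have [V0|Vfull] := simple V stabV.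
  have /det0P[v v_neq0 vM] : \det M^T == 0 by rewrite det_tr detM.
  have : v^T \in V by rewrite memV -[M]trmxK -trmx_mul vM trmx0.
  by rewrite V0 memv0 trmx_eq0 (negPf v_neq0).
apply/matrixP => i j.
have : delta_mx j 0 \in V by rewrite Vfull memvf.
by rewrite memV -colE => /eqP/matrixP/(_ i 0); rewrite !mxE.
Qed.

End Representations.

Section PointsOfCenter.
Variables (R : realType) (a b : R[i]) (A : algType R[i]) (x : 'Z_5 -> A) (c5 : A).
Notation K := R[i].
Hypothesis pres : presented_by (@clifford_relations R a b) x.
Hypothesis c5_spec : is_central_c5 x a b c5.
Hypothesis rank_neq3 : forall p, (\rank (Qmx a b p) <= 3)%N -> (\rank (Qmx a b p) <= 2)%N.

Let G := center_generators x c5.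

Lemma center_generated z : Defs.center z <-> generated_subalgebra G z.
Proof. by have [_ _ e] := c5_spec; rewrite e. Qed.

Lemma center_square i : Defs.center (x i ^+ 2).
Proof. by apply/center_generated => B _; apply; left; exists i. Qed.

Lemma center_c5 : Defs.center c5.
Proof. by apply/center_generated => B _; apply; right. Qed.

Lemma residue_Qmx (m : set A) (p : 'Z_5 -> K) i j : center_ideal m ->
    (forall k, residue m (x k ^+ 2) (p k)) ->
  residue m (Qmx a%:A b%:A (fun k => x k ^+ 2) i j) (Qmx a b p i j).
Proof.
move=> mI rp; have r2 : residue m (2 : A) 2.
  by have := residue_scalar mI (2 : K); rewrite scaler_nat.
have rb c := residue_scalar mI c.
by case/or4P: (Z5_cases i) => [/eqP->|/eqP->|/eqP->|/orP[]/eqP->];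
   case/or4P: (Z5_cases j) => [/eqP->|/eqP->|/eqP->|/orP[]/eqP->];
   rewrite !mxE; apply: (residueM mI).
Qed.

Lemma residue_c5 (m : set A) (p : 'Z_5 -> K) g : center_ideal m -> ~ m 1 ->
    (forall k, residue m (x k ^+ 2) (p k)) -> residue m c5 g ->
  g ^+ 2 = \det (Qmx a b p).
Proof.
move=> mI m1 rp rg; have [_ c52 _] := c5_spec.
apply: (residue_uniq mI m1 (z := c5 ^+ 2)); first by rewrite !expr2; exact: residueM.
by rewrite c52; apply: residue_det => // i j; exact: residue_Qmx.
Qed.

Section Kernel.
Variables (d : nat) (rho : {lrmorphism A -> 'M[K]_d.+1}).

Definition central_kernel : set A := [set u | rho u = 0] `&` @Defs.center _ A.

Lemma central_kernel_ideal : center_ideal central_kernel.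
Proof.
split=> [u []//||u v [/= ru cu] [/= rv cv]|z u cz [/= ru cu]].
- by split; [exact: rmorph0 | rewrite -(scale0r 1); exact: center_scalar].
- by split; [rewrite /= rmorphD /= ru rv addr0 | exact: centerD].
- by split; [rewrite /= rmorphM /= ru mulr0 | exact: centerM].
Qed.

Lemma central_kernel_proper : ~ central_kernel 1.
Proof. by case=> /=; rewrite rmorph1 => /eqP; rewrite oner_eq0. Qed.

Lemma residue_kernel z c : Defs.center z -> rho z = c%:M -> residue central_kernel z c.
Proof.
move=> cz rz; split=> //; split; last exact/centerB/center_scalar.
by rewrite /= rmorphB /= rz linearZ /= rmorph1 scalemx1 subrr.
Qed.

(** The central elements with the same value at m and at the kernel of [rho] form a subalgebra;
    containing the generators, it is the whole center. *)
Lemma lies_above_residues (m : set A) (p : 'Z_5 -> K) g : center_ideal m -> ~ m 1 ->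
    (forall k, residue m (x k ^+ 2) (p k)) -> residue m c5 g ->
    (forall k, rho (x k ^+ 2) = (p k)%:M) -> rho c5 = g%:M ->
  lies_above rho m.
Proof.
move=> mI m1 rp rg rhop rhog; have kI := central_kernel_ideal.
pose B : set A := [set z | exists c, residue m z c /\ residue central_kernel z c].
have subB : subalgebra B.
  split=> [|c u v [e [mu ku]] [f [mv kv]]|u v [e [mu ku]] [f [mv kv]]].
  - by exists 1; rewrite -(scale1r 1); split; exact: residue_scalar.
  - exists (c * e + f); rewrite -mulr_algl.
    by split; apply: residueD => //; apply: residueM => //; exact: residue_scalar.
  - by exists (e * f); split; exact: residueM.
have GB : G `<=` B.
  move=> _ [[i _ <-]|->].
    by exists (p i); split => //; apply: residue_kernel (rhop i); exact: center_square.
  by exists g; split => //; apply: residue_kernel rhog; exact: center_c5.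
have res0 (I : set A) z : center_ideal I -> I z -> residue I z 0.
  by move=> II Iz; split; [exact: cideal_center Iz | rewrite scale0r subr0].
have resK (I : set A) z : residue I z 0 -> I z by case=> _; rewrite scale0r subr0.
apply/seteqP; split=> z.
  move=> kz; have [c [mc kc]] := (center_generated z).1 kz.2 B subB GB.
  by apply: resK; rewrite -(residue_uniq kI central_kernel_proper kc (res0 _ _ kI kz)).
move=> mz; have [c [mc kc]] := (center_generated z).1 (cideal_center mI mz) B subB GB.
by apply: resK; rewrite -(residue_uniq mI m1 mc (res0 _ _ mI mz)).
Qed.

End Kernel.

Lemma maximal_residue (m : set A) z : maximal_center_ideal m -> Defs.center z ->
  exists c, residue m z c.
Proof.
move=> mmax cz.
pose g (i : option 'Z_5) := if i is Some k then x k ^+ 2 else c5.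
have Gg : G `<=` range g by move=> _ [[i _ <-]|->]; [exists (Some i) | exists None].
have [e eP] := generated_subalgebra_span Gg.
have [|c mc] := maximal_ideal_residue (@uncountable_complex R) mmax (e := e) _ cz.
  by move=> u /center_generated; exact: eP.
by exists c.
Qed.

Lemma rep_opp_c5 d (rho rho' : {lrmorphism A -> 'M[K]_d.+1}) :
  (forall i, rho' (x i) = - rho (x i)) -> rho' c5 = - rho c5.
Proof.
move=> rhoN; have [[f ->] _ _] := c5_spec.
have key (w : seq 'Z_5) :
    rho' (\prod_(i <- w) x i) = (-1) ^+ size w *: rho (\prod_(i <- w) x i).
  elim: w => [|i w IHw] /=; first by rewrite !big_nil !rmorph1 scale1r.
  rewrite !big_cons !rmorphM /= IHw rhoN exprS mulN1r scaleNr.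
  by rewrite mulNr scalerAr.
apply/eqP; rewrite -addr_eq0 !raddf_sum /= -big_split; apply/eqP/big1 => w _ /=.
rewrite !linearZ /= key size_tuple -scalerDr (_ : (-1) ^+ 5 = -1 :> K); last by ring.
by rewrite scaleN1r addNr scaler0.
Qed.

Let symQ p : (Qmx a b p)^T = Qmx a b p := trmx_Qmx a b p.

(* In a simple representation over p, c5 acts by a square root of det Q(p); the sign is
   adjusted by x_i -> - x_i, since c5 has odd degree. *)
Lemma simple_rep4_above (m : set A) : maximal_center_ideal m -> ~ on_cone x a b m ->
  exists2 rho : {lrmorphism A -> 'M[K]_4}, simple_rep rho & lies_above rho m.
Proof.
move=> mmax ncone; have [mI m1 _] := mmax.
have [p rp] := choice (fun k => maximal_residue mmax (center_square k)).
have [g rg] := maximal_residue mmax center_c5.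
have rk3 : (3 < \rank (Qmx a b p))%N.
  rewrite ltnNge; apply/negP => /rank_neq3 rk2; apply: ncone; exists p => // k.
  by have [] := rp k.
have [|X modX irrX] := exists_irreducible_module4 (symQ p).
  by rewrite rk3 rank_leq_row.
have [rho [rhoX rhop]] := rep_of_module pres modX.
have simple : simple_rep rho.
  apply/(simple_repP pres) => V stabV; apply: irrX => i v Vv.
  by rewrite -rhoX; exact: stabV.
have [g' rhog] := simple_rep_center simple center_c5.
have rk' := residue_kernel (center_square _) (rhop _).
have g'2 := residue_c5 (central_kernel_ideal rho) (@central_kernel_proper _ rho) rk'
   (residue_kernel center_c5 rhog).
have g2 := residue_c5 mI m1 rp rg.
have /eqP : g ^+ 2 = g' ^+ 2 by rewrite g2 g'2.
rewrite eqf_sqr => /orP[] /eqP gg'.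
  by exists rho => //; apply: lies_above_residues rp rg rhop _ => //; rewrite gg'.
have modX' : clifford_module (Qmx a b p) (fun i => - X i).
  by move=> i j; rewrite !mulNmx !mulmxN !opprK; exact: modX.
have [rho' [rhoX' rhop']] := rep_of_module pres modX'.
exists rho'.
  apply/(simple_repP pres) => V stabV; apply: irrX => i v Vv.
  by rewrite -[X i]opprK -rhoX' mulNmx memvN; exact: stabV.
apply: lies_above_residues rp rg rhop' _ => //.
rewrite (rep_opp_c5 (rho := rho)) ?rhog ?gg' ?raddfN // => i.
by rewrite rhoX' rhoX.
Qed.

Lemma rep_square_above d (rho : {lrmorphism A -> 'M[K]_d.+1}) m (p : 'Z_5 -> K) :
  lies_above rho m -> has_image x m p -> forall i, rho (x i ^+ 2) = (p i)%:M.
Proof.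
move=> above img i; have := img i; rewrite -above => -[/= /eqP + _].
by rewrite rmorphB /= linearZ /= rmorph1 scalemx1 subr_eq0 => /eqP.
Qed.

Lemma cone_simple_rep_dim d (rho : {lrmorphism A -> 'M[K]_d.+1}) m :
  simple_rep rho -> lies_above rho m -> on_cone x a b m -> (d < 2)%N.
Proof.
move=> /(simple_repP pres) irr above [p rk2 img].
apply: (irreducible_module_dim (symQ p) rk2 _ irr).
exact/(module_of_rep pres)/(rep_square_above above img).
Qed.

Lemma trivial_rep : exists rho : {lrmorphism A -> 'M[K]_1}, forall i, rho (x i) = 0.
Proof.
have mod0 : clifford_module (Qmx a b (fun=> 0)) (fun _ : 'Z_5 => 0 : 'M[K]_1).
  by move=> i j; rewrite mul0mx addr0 Qmx0 mxE raddf0.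
by have [rho []] := rep_of_module pres mod0; exists rho.
Qed.

End PointsOfCenter.

(** * Simple representations above the vertex and above the rest of the cone *)

Section SimpleRepresentations.
Variables (R : realType) (a b : R[i]) (A : algType R[i]) (x : 'Z_5 -> A) (c5 : A).
Notation K := R[i].
Hypothesis pres : presented_by (@clifford_relations R a b) x.
Hypothesis c5_spec : is_central_c5 x a b c5.
Hypothesis rank_neq3 : forall p, (\rank (Qmx a b p) <= 3)%N -> (\rank (Qmx a b p) <= 2)%N.
Hypothesis rank_neq1 : forall p : 'Z_5 -> K, (\rank (Qmx a b p) <= 1)%N -> forall i, p i = 0.

Let G := center_generators x c5.
Let vertex := vertex_ideal x c5.

Lemma generators_center : G `<=` @Defs.center _ A.
Proof.
by move=> _ [[i _ <-]|->]; [exact: (center_square c5_spec) | exact: (center_c5 c5_spec)].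
Qed.

Lemma vertex_center_ideal : center_ideal vertex.
Proof.
have cI : center_ideal (@Defs.center _ A).
  split=> // [|u v|z u]; [|exact: centerD|exact: centerM].
  by rewrite -(scale0r 1); exact: center_scalar.
split=> [u vu|I II _|u v vu vv I II GI|z u cz vu I II GI].
- by apply: vu => //; exact: generators_center.
- exact: cideal0.
- by apply: cidealD => //; [exact: vu | exact: vv].
- by apply: cidealM => //; exact: vu.
Qed.

Lemma generators_vertex : G `<=` vertex.
Proof. by move=> u Gu I _; apply. Qed.

Lemma vertex_residue_square k : residue vertex (x k ^+ 2) 0.
Proof.
split; first exact: (center_square c5_spec).
by rewrite scale0r subr0; apply: generators_vertex; left; exists k.
Qed.

Lemma vertex_residue_c5 : residue vertex c5 0.
Proof.
split; first exact: (center_c5 c5_spec).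
by rewrite scale0r subr0; apply: generators_vertex; right.
Qed.

(** The trivial representation is unchanged by x_i -> - x_i, while the odd element [c5] changes
    sign. *)
Lemma trivial_rep_c5 (rho : {lrmorphism A -> 'M[K]_1}) :
  (forall i, rho (x i) = 0) -> rho c5 = 0.
Proof.
move=> rho0; have e : rho c5 = - rho c5.
  by apply: (rep_opp_c5 c5_spec) => i; rewrite rho0 oppr0.
apply: (scalerI (_ : (2 : K) != 0)); first by rewrite pnatr_eq0.
by rewrite scaler0 scaler_nat mulr2n [X in X + _]e addNr.
Qed.

Lemma vertex_proper : ~ vertex 1.
Proof.
have [rho rho0] := trivial_rep pres.
move=> v1; apply: (@central_kernel_proper _ _ _ rho); apply: v1; first exact: central_kernel_ideal.
move=> u Gu; split; last exact: generators_center.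
by case: Gu => [[i _ <-]|->]; [rewrite /= rmorphXn /= rho0 expr0n | exact: trivial_rep_c5].
Qed.

(** The generators of the center have value 0 here, so every central element is a scalar modulo this
    ideal. *)
Lemma vertex_maximal : maximal_center_ideal vertex.
Proof.
have vI := vertex_center_ideal; split=> // [|I II I1 vsub]; first exact: vertex_proper.
apply/seteqP; split=> // z Iz.
pose B : set A := [set z | exists c, residue vertex z c].
have subB : subalgebra B.
  split=> [|c u v [e ve] [f vf]|u v [e ve] [f vf]].
  - by exists 1; rewrite -(scale1r 1); exact: residue_scalar.
  - exists (c * e + f); rewrite -mulr_algl.
    by apply: residueD => //; apply: residueM => //; exact: residue_scalar.
  - by exists (e * f); exact: residueM.
have GB : G `<=` B.
  by move=> _ [[i _ <-]|->]; exists 0; [exact: vertex_residue_square | exact: vertex_residue_c5].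
have [c [cz vzc]] := (center_generated c5_spec z).1 (cideal_center II Iz) B subB GB.
have Ic : I (c%:A) by rewrite -[_%:A](subKr z); apply: (cidealB II) => //; exact: vsub.
have [c0|c_neq0] := eqVneq c 0; first by move: vzc; rewrite c0 scale0r subr0.
by case: I1; have := cidealZ II c^-1 Ic; rewrite scalerA mulVf // scale1r.
Qed.

Lemma vertex_on_cone : on_cone x a b vertex.
Proof.
exists (fun=> 0); last by move=> i; have [] := vertex_residue_square i.
by rewrite /affine_cone /= Qmx0 mxrank0.
Qed.

Lemma trivial_rep_above_vertex : exists rho : {lrmorphism A -> 'M[K]_1},
  [/\ forall i, rho (x i) = 0, simple_rep rho & lies_above rho vertex].
Proof.
have [rho rho0] := trivial_rep pres; exists rho; split=> //.
  by apply/(simple_repP pres); exact: irreducible1.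
apply: (lies_above_residues c5_spec vertex_center_ideal vertex_proper
  vertex_residue_square vertex_residue_c5) => [k|].
- by rewrite rmorphXn /= rho0 expr2 mul0r raddf0.
- by rewrite trivial_rep_c5 // raddf0.
Qed.

Lemma no_simple_rep_above_vertex d (rho : {lrmorphism A -> 'M[K]_d.+1}) :
  simple_rep rho -> lies_above rho vertex -> d = 0%N.
Proof.
move=> /(simple_repP pres) irr above.
have img : has_image x vertex (fun=> 0) by move=> i; have [] := vertex_residue_square i.
have mod := module_of_rep pres (rep_square_above above img).
apply: (irreducible_eq0_dim _ irr) => i.
rewrite Qmx0 in mod.
(* Over the vertex the form is 0, factored through a matrix with no rows: every basis vector is in
   the radical and acts by 0. *)
have := radical_acts_trivially (trmx0 _ _ _) (L := 0 : 'M[K]_(0, 5)) _ mod irr (v := delta_mx i 0).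
rewrite mul0mx mulmx0 scaler0 => /(_ erefl erefl) <-.
rewrite (bigD1 i) //= mxE !eqxx scale1r big1 ?addr0 // => j /negPf ji.
by rewrite mxE ji scale0r.
Qed.

Lemma simple_rep2_above (m : set A) : maximal_center_ideal m -> on_cone x a b m ->
    m <> vertex ->
  exists rho : {lrmorphism A -> 'M[K]_2}, [/\ simple_rep rho, lies_above rho m
    & forall rho' : {lrmorphism A -> 'M[K]_2},
        simple_rep rho' -> lies_above rho' m -> isomorphic_reps rho rho'].
Proof.
move=> mmax [p rk2 img] mv; have [mI m1 _] := mmax.
have rp k : residue m (x k ^+ 2) (p k) by split; [exact: (center_square c5_spec) | exact: img].
have [g rg] := maximal_residue c5_spec mmax (center_c5 c5_spec).
(* The determinant vanishes on the cone, so [c5] takes the value 0 both at m and in the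
   representation, and no sign has to be chosen. *)
have detQ : \det (Qmx a b p) = 0.
  apply/eqP; rewrite -[_ == 0]negbK -unitfE -unitmxE; apply/negP => /mxrank_unit rk5.
  by move: rk2; rewrite /affine_cone /= rk5.
have sq0 (h : K) : h ^+ 2 = 0 -> h = 0 by move/eqP; rewrite expf_eq0 => /eqP.
have g0 : g = 0 by apply: sq0; rewrite (residue_c5 c5_spec mI m1 rp rg).
(* Rank at most 1 would force p = 0; then m contains all generators of the vertex ideal, which is
   maximal. *)
have rkQ : \rank (Qmx a b p) = 2%N.
  apply/eqP; rewrite eqn_leq (rk2 : (_ <= 2)%N) ltnNge; apply/negP => /rank_neq1 p0.
  have Gm : G `<=` m.
    move=> _ [[i _ <-]|->]; first by have [_] := rp i; rewrite p0 scale0r subr0.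
    by have [_] := rg; rewrite g0 scale0r subr0.
  case: mv; have [_ _ /(_ m mI m1)] := vertex_maximal.
  by apply=> u; apply.
have symQ := trmx_Qmx a b p.
have [X modX irrX] := exists_irreducible_module2 symQ rkQ.
have [rho [rhoX rhop]] := rep_of_module pres modX.
have simple : simple_rep rho.
  apply/(simple_repP pres) => V stabV; apply: irrX => i v Vv.
  by rewrite -rhoX; exact: stabV.
have [g' rhog] := simple_rep_center simple (center_c5 c5_spec).
have g'0 : g' = 0.
  apply: sq0; rewrite -detQ.
  apply: (residue_c5 c5_spec (central_kernel_ideal rho) (@central_kernel_proper _ _ _ rho)).
    move=> k; exact: residue_kernel (center_square c5_spec _) (rhop _).
  exact: residue_kernel (center_c5 c5_spec) rhog.
exists rho; split=> //.
  by apply: (lies_above_residues c5_spec mI m1 rp rg rhop); rewrite rhog g'0 g0.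
move=> rho' /(simple_repP pres) irr' above'.
have mod' := module_of_rep pres (rep_square_above above' img).
have [P uP PX] := irreducible_module2_unique symQ rkQ modX irrX mod' irr'.
exists P => //; apply: (isomorphic_generators pres) => i.
by rewrite rhoX; exact: PX.
Qed.

Lemma simple_reps_over_center :
  [/\ forall m : set A, maximal_center_ideal m ->
        (exists2 rho : {lrmorphism A -> 'M[K]_4},
           simple_rep rho & lies_above rho m) <-> ~ on_cone x a b m,
      forall m : set A, maximal_center_ideal m -> on_cone x a b m ->
        m <> vertex_ideal x c5 ->
        exists rho : {lrmorphism A -> 'M[K]_2},
          [/\ simple_rep rho, lies_above rho m
            & forall rho' : {lrmorphism A -> 'M[K]_2},
                simple_rep rho' -> lies_above rho' m -> isomorphic_reps rho rho']
    & [/\ maximal_center_ideal (vertex_ideal x c5),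
          on_cone x a b (vertex_ideal x c5),
          exists rho : {lrmorphism A -> 'M[K]_1},
            [/\ forall i, rho (x i) = 0, simple_rep rho
              & lies_above rho (vertex_ideal x c5)]
        & ~ exists2 rho : {lrmorphism A -> 'M[K]_2},
              simple_rep rho & lies_above rho (vertex_ideal x c5)]].
Proof.
split=> [m mmax|m|].
- split; last exact: (simple_rep4_above pres c5_spec rank_neq3 mmax).
  by move=> [rho simple above] /(cone_simple_rep_dim pres simple above).
- exact: simple_rep2_above.
split; [exact: vertex_maximal | exact: vertex_on_cone | exact: trivial_rep_above_vertex |].
by move=> [rho simple /(no_simple_rep_above_vertex simple)].
Qed.
End SimpleRepresentations.

(** * Theta functions *)

Section Ce.
Variable R : realType.
Notation C := R[i].

Lemma cexpD (x y : C) : cexp (x + y) = cexp x * cexp y.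
Proof.
case: x y => [a b] [c d]; rewrite /cexp /= expRD cosD sinD; simpc.
by congr (_ +i* _); ring.
Qed.

Lemma ceE (x y : R) : ce (x +i* y) = (expR (- (2 * pi * y)))%:C *
  (cos (2 * pi * x) +i* sin (2 * pi * x)).
Proof. by rewrite /ce /cexp; simpc. Qed.

Lemma ceD (x y : C) : ce (x + y) = ce x * ce y.
Proof. by rewrite /ce mulrDr cexpD. Qed.

Lemma ce0 : ce (0 : C) = 1.
Proof. by rewrite (ceE 0 0) !mulr0 oppr0 expR0 cos0 sin0; simpc. Qed.

Lemma norm_ce (z : C) : `|ce z| = (expR (- (2 * pi * complex.Im z)))%:C.
Proof.
case: z => x y; rewrite ceE normrM !normc_def /= expr0n /= addr0 sqrtr_sqr ger0_norm ?expR_ge0 //.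
by rewrite cos2Dsin2 sqrtr1 mulr1.
Qed.

Lemma ce_neq0 (z : C) : ce z != 0.
Proof. by rewrite -normr_eq0 norm_ce (inj_eq (@complexI _)) gt_eqF ?expR_gt0. Qed.

Lemma ceN (z : C) : ce (- z) = (ce z)^-1.
Proof.
by apply: (mulfI (ce_neq0 z)); rewrite -ceD subrr ce0 mulfV ?ce_neq0.
Qed.

Lemma ceMn (n : nat) (z : C) : ce (n%:R * z) = ce z ^+ n.
Proof.
elim: n => [|n IHn]; first by rewrite mul0r ce0.
by rewrite -natr1 mulrDl mul1r ceD IHn exprSr.
Qed.

Lemma ce1 : ce (1 : C) = 1.
Proof. rewrite (ceE 1 0) mulr0 oppr0 expR0 mulr1 mulr_natl cos2pi sin2pi; by simpc. Qed.

Lemma ce_half : ce (1 / 2 : C) = -1.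
Proof.
have -> : 1 / 2 = (1 / 2)%:C :> C by rewrite rmorphM rmorph1 fmorphV rmorph_nat.
have e : 2 * pi * (1 / 2) = pi :> R by field.
by rewrite (ceE (1 / 2) 0) mulr0 oppr0 expR0 e cospi sinpi; simpc.
Qed.

Lemma ce_int (k : int) : ce (k%:~R : C) = 1.
Proof.
case: k => n; rewrite ?NegzE ?mulrNz ?ceN -[_%:~R]mulr1 -?pmulrn ceMn ce1 expr1n ?invr1 //.
Qed.

(** The norm forces z to be real. For its fractional part f, cos (2 pi f) = 1 gives sin (pi f) = 0,
    while the sine is positive on the open interval from 0 to pi. *)
Lemma ce_eq1 (z : C) : ce z = 1 -> exists k : int, z = k%:~R.
Proof.
move=> z1; have := norm_ce z; rewrite z1 normr1 => -[] /esym/eqP.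
rewrite -{2}expR0 (inj_eq (@expR_inj R)) oppr_eq0 !mulf_eq0 pnatr_eq0 /=.
rewrite (gt_eqF (pi_gt0 R)) /= => /eqP Imz.
case: z z1 Imz => x y /= z1 y0; rewrite y0 in z1 *.
exists (Num.floor x).
pose f := x - (Num.floor x)%:~R.
have ef : ce (f +i* 0) = 1.
  have : ce ((x +i* 0) - (Num.floor x)%:~R) = 1 by rewrite ceD ceN ce_int z1 mul1r invr1.
  by rewrite -(rmorph_int (real_complex R)) /=; simpc.
move: ef; rewrite ceE mulr0 oppr0 expR0; simpc => -[c1 _].
have f0 : 0 <= f by rewrite subr_ge0 ge_floor.
have f1 : f < 1 by have := lt_succ_floor x; rewrite intrD ltrBlDl.
have sin0 : sin (pi * f) = 0.
  have := c1; rewrite (_ : 2 * pi * f = (pi * f) *+ 2); last by rewrite -mulrA mulr_natl.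
  rewrite cos_mulr2n => c2.
  have := cos2Dsin2 (pi * f) => cs; apply/eqP; rewrite -sqrf_eq0.
  by apply/eqP; move: c2; rewrite mulr2n; lra.
have [f0'|f_neq0] := eqVneq f 0.
  have -> : x = (Num.floor x)%:~R by apply/eqP; rewrite -subr_eq0 -/f f0'.
  by rewrite -(rmorph_int (real_complex R)) intrKfloor.
have fpos : 0 < f by rewrite lt_neqAle eq_sym f_neq0.
have : 0 < sin (pi * f).
  by rewrite sin_gt0_pi // mulr_gt0 ?pi_gt0 //= gtr_pMr ?pi_gt0.
by rewrite sin0 ltxx.
Qed.
End Ce.

Section Existence.
Variable R : realType.
Notation C := R[i].

Lemma has_sum_nonneg (I : eqType) (r : I -> R) (B : R) : (forall i, 0 <= r i) ->
    (forall F, uniq F -> \sum_(i <- F) r i <= B) ->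
  exists s : R, has_sum (fun i => (r i)%:C) s%:C.
Proof.
move=> r0 rB; pose E : set R := [set y | exists2 F, uniq F & y = \sum_(i <- F) r i].
have E0 : E !=set0 by exists 0, [::]; rewrite // big_nil.
have EB : has_ubound E by exists B => _ [F uF ->]; exact: rB.
exists (sup E) => e e0.
have [eR e0'] : e = (complex.Re e)%:C /\ 0 < complex.Re e.
  by move: e0; case: e => x y; rewrite ltcE /= => /andP[/eqP -> ].
have [_ [F0 uF0 ->] lt0] := sup_adherent e0' (conj E0 EB).
exists F0 => F uF sF; rewrite eR -rmorph_sum -rmorphB normc_def /= expr0n /= addr0 sqrtr_sqr ltcR.
have le1 : \sum_(i <- F) r i <= sup E by apply: ub_le_sup => //; exists F.
have le0 : \sum_(i <- F0) r i <= \sum_(i <- F) r i.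
  rewrite [leRHS](bigID (mem F0)) /= -[leLHS]addr0 lerD ?sumr_ge0 // -(big_filter F).
  rewrite le_eqVlt; apply/orP; left; apply/eqP/perm_big.
  apply: uniq_perm; rewrite ?filter_uniq // => i; rewrite mem_filter.
  by case: (boolP (i \in F0)) => //= /sF ->.
by rewrite distrC ger0_norm ?subr_ge0 // ltrBlDr -ltrBlDl (lt_le_trans lt0).
Qed.

(** With n the norm of a term and p its real or imaginary part, p = (p + n) - n is a difference of
    nonnegative summable families. *)
Lemma has_sum_exists (I : eqType) (f : I -> C) (B : C) :
  norm_bounded f B -> exists s, has_sum f s.
Proof.
move=> fB; pose n i := complex.Re `|f i|.
have nE i : (n i)%:C = `|f i| by rewrite /n RRe_real // normr_real.
have n0 i : 0 <= n i by rewrite -ler0c nE normr_ge0.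
have nB F : uniq F -> \sum_(i <- F) n i <= complex.Re B.
  move=> uF; have := fB F uF; under eq_bigr do rewrite -nE.
  by rewrite -rmorph_sum lecE => /andP[].
have [sn hn] := has_sum_nonneg n0 nB.
have part (p : I -> R) : (forall i, `|p i| <= n i) -> exists s, has_sum (fun i => (p i)%:C) s.
  move=> pn; have q0 i : 0 <= p i + n i.
    by rewrite -lerBlDr sub0r; have /ler_normlP[] := pn i; rewrite lerNl.
  have qB F : uniq F -> \sum_(i <- F) (p i + n i) <= complex.Re B + complex.Re B.
    move=> uF; apply: le_trans (_ : \sum_(i <- F) (n i + n i) <= _).
      by apply: ler_sum => i _; rewrite lerD2r (le_trans (ler_norm _)).
    by rewrite big_split lerD // nB.
  have [s hs] := has_sum_nonneg q0 qB.
  exists (s%:C + (-1) * sn%:C); apply: has_sum_eq (has_sumD hs (has_sumZ (-1) hn)) => i.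
  by rewrite rmorphD /= mulN1r addrK.
have [|sr hr] := part (fun i => complex.Re (f i)).
  by move=> i; rewrite -lecR nE normc_ge_Re.
have [|si hi] := part (fun i => complex.Im (f i)).
  move=> i; rewrite -lecR nE normc_def lecR -sqrtr_sqr ler_sqrt.
    by rewrite lerDr sqr_ge0.
  by rewrite addr_ge0 ?sqr_ge0.
exists (sr + 'i%C * si); apply: has_sum_eq (has_sumD hr (has_sumZ 'i%C hi)) => i.
by rewrite -complexE.
Qed.

End Existence.

Section Gaussian.

Lemma sum_geometric_le (K : numFieldType) (r : K) (F : seq nat) : 0 <= r -> r < 1 ->
  uniq F -> \sum_(k <- F) r ^+ k <= (1 - r)^-1.
Proof.
move=> r0 r1 uF; pose M := (\max_(k <- F) k.+1)%N.
have FM : {subset F <= iota 0 M}.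
  by move=> k kF; rewrite mem_iota add0n /M (big_rem k) //= leq_maxl.
have le : \sum_(k <- F) r ^+ k <= \sum_(k <- iota 0 M) r ^+ k.
  rewrite [leRHS](bigID (mem F)) /= -[leLHS]addr0 lerD //; last first.
    by apply: sumr_ge0 => k _; rewrite exprn_ge0.
  rewrite -(big_filter (iota 0 M)) le_eqVlt; apply/orP; left; apply/eqP/perm_big.
  apply: uniq_perm; rewrite ?filter_uniq ?iota_uniq // => k; rewrite mem_filter.
  by case: (boolP (k \in F)) => //= /FM ->.
apply: le_trans le _; rewrite -{1}(subn0 M) -/(index_iota 0 M) big_mkord.
have d0 : 0 < 1 - r by rewrite subr_gt0.
rewrite -[(1 - r)^-1]mul1r ler_pdivlMr // mulrC -opprB mulNr -subrX1 opprB.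
by rewrite gerBl exprn_ge0.
Qed.

Lemma int_geometric_bounded (K : numFieldType) (r : K) : 0 <= r -> r < 1 ->
  norm_bounded (fun n : int => r ^+ `|n|%N) ((1 - r)^-1 + (1 - r)^-1).
Proof.
move=> r0 r1 F uF; under eq_bigr do rewrite normrX ger0_norm //.
rewrite (bigID (fun n : int => 0 <= n)) /=.
apply: lerD.
  rewrite -(big_filter F) -(big_map absz xpredT (fun k => r ^+ k)).
  apply: sum_geometric_le => //; rewrite map_inj_in_uniq ?filter_uniq //.
  move=> m n; rewrite !mem_filter => /andP[m0 _] /andP[n0 _] e.
  by rewrite -(gez0_abs m0) -(gez0_abs n0) e.
rewrite -(big_filter F) -(big_map absz xpredT (fun k => r ^+ k)).
apply: sum_geometric_le => //; rewrite map_inj_in_uniq ?filter_uniq //.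
move=> m n; rewrite !mem_filter -!ltNge => /andP[m0 _] /andP[n0 _] e.
by apply: oppr_inj; rewrite -(ltz0_abs m0) -(ltz0_abs n0) e.
Qed.

Variable R : realType.
Notation C := R[i].

(** All theta series are brought to this form, in which rearranging a product of two of them amounts
    to an identity between quadratic forms. *)
Definition gauss (z s : C) (n : int) : C := ce (n%:~R * z + (n ^+ 2)%:~R * s).

Lemma gauss_bounded (z s : C) : 0 < complex.Im s ->
  exists2 B : C, 0 <= B & norm_bounded (gauss z s) B.
Proof.
move=> s0; pose y := complex.Im z; pose sg := complex.Im s.
(* The maximum over real m of m (|y| + 1) - m^2 sg, by completing the square; it makes the terms at
   most a constant times e^(- 2 pi |n|). *)
pose k := (`|y| + 1) ^+ 2 / (4 * sg).
pose r : C := (expR (- (2 * pi)))%:C.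
have r0 : 0 <= r by rewrite ler0c expR_ge0.
have r1 : r < 1 by rewrite -[1]/(1%:C) ltcR expR_lt1 oppr_lt0 mulr_gt0 ?pi_gt0.
pose D : C := (expR (2 * pi * k))%:C.
have D0 : 0 <= D by rewrite ler0c expR_ge0.
exists (D * ((1 - r)^-1 + (1 - r)^-1)).
  by rewrite mulr_ge0 // addr_ge0 // invr_ge0 subr_ge0 ltW.
apply: norm_boundedW (int_geometric_bounded r0 r1) => // n.
have ImE : complex.Im (n%:~R * z + (n ^+ 2)%:~R * s) = n%:~R * y + (n ^+ 2)%:~R * sg.
  rewrite /y /sg; case: (z) (s) => a b [c d] /=.
  by rewrite -!(rmorph_int (real_complex R)); simpc.
rewrite norm_ce ImE normrX (ger0_norm r0) /D /r -rmorphXn -rmorphM lecR -expRM_natl -expRD ler_expR.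
have pi0 := pi_gt0 R.
pose m : R := `|n|%N%:R.
have mE : m = `|n%:~R| :> R by rewrite /m -intr_norm natr_absz.
have m2 : (n ^+ 2)%:~R = m ^+ 2 :> R by rewrite mE real_normK ?num_real // rmorphXn.
have ny : - (m * `|y|) <= n%:~R * y.
  by rewrite mE -normrM lerNl (le_trans (ler_norm _)) // normrN.
have key : m <= k + (n%:~R * y + (n ^+ 2)%:~R * sg).
  have s4 : 0 < 4 * sg by rewrite mulr_gt0.
  rewrite -subr_ge0 -(pmulr_rge0 _ s4).
  have -> : 4 * sg * (k + (n%:~R * y + (n ^+ 2)%:~R * sg) - m) =
      (`|y| + 1 - 2 * sg * m) ^+ 2 + 4 * sg * (n%:~R * y + m * `|y|).
    by rewrite m2 /k; field; rewrite gt_eqF.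
  rewrite addr_ge0 ?sqr_ge0 // mulr_ge0 ?(ltW s4) //.
  by rewrite -lerBlDr sub0r.
rewrite -/m -subr_ge0.
have -> : 2 * pi * k + m * - (2 * pi) - - (2 * pi * (n%:~R * y + (n ^+ 2)%:~R * sg)) =
  2 * pi * (k + (n%:~R * y + (n ^+ 2)%:~R * sg) - m) by ring.
by rewrite mulr_ge0 ?mulr_ge0 ?(ltW pi0) // subr_ge0.
Qed.

End Gaussian.

Section ThetaSum.
Variable R : realType.
Notation C := R[i].

Lemma theta_termE (eta z : C) (k : int) :
  theta_term eta z k = gauss (z + 1 / 2 - eta / 2) (eta / 2) k.
Proof.
rewrite /theta_term /gauss.
have -> : (-1) ^+ `|k|%N = ce (k%:~R * (1 / 2) : C).
  case: k => n; rewrite ?NegzE ?mulrNz ?abszN.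
    by rewrite -pmulrn ceMn ce_half.
  by rewrite mulNr ceN -pmulrn ceMn ce_half invr_sign.
rewrite -ceD; congr ce; rewrite expr2 !intrM intrB.
by field.
Qed.

Lemma has_sum_int_tends (f : int -> C) s : has_sum f s ->
  tends (fun N => \sum_(0 <= k < N) (f k%:Z + f (- k.+1%:Z))) s.
Proof.
move=> hs e e0; have [F0 h0] := hs e e0; exists (\max_(i <- F0) `|i|.+1)%N => N FN.
rewrite big_split /= -(big_map Posz xpredT f) -(big_map (fun k => - k.+1%:Z) xpredT f).
rewrite -big_cat; apply: h0.
  rewrite cat_uniq !map_inj_uniq ?iota_uniq ?andbT /=.
  - by apply/hasPn => _ /mapP[k _ ->]; apply/mapP => -[k' _].
  - by move=> k k' /oppr_inj [].
  - by move=> k k' [].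
move=> i iF; have : (`|i| < N)%N.
  by apply: leq_trans FN; rewrite (big_rem i) //= leq_maxl.
rewrite mem_cat; case: i {iF} => n /= nN; apply/orP; [left | right].
  by rewrite map_f // mem_index_iota.
by apply/mapP; exists n; [rewrite mem_index_iota /= ltnW | rewrite NegzE].
Qed.

Lemma tends_lim (u : nat -> C) l : tends u l -> limn (u : nat -> R[i]^o) = l.
Proof.
move=> ul; apply: cvg_lim; first exact: norm_hausdorff.
apply/cvgrPdist_lt => e e0; have [N NP] := ul e e0.
by exists N => // n /= Nn; rewrite distrC; exact: NP.
Qed.

Lemma theta_has_sum (eta z : C) : 0 < complex.Im eta ->
  has_sum (gauss (z + 1 / 2 - eta / 2) (eta / 2)) (theta eta z).
Proof.
move=> eta0; have e2 : 0 < complex.Im (eta / 2).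
  have -> : eta / 2 = eta * (2^-1)%:C by rewrite fmorphV rmorph_nat.
  case: eta eta0 => a b /= b0; simpc.
  by rewrite mulr_gt0 // invr_gt0.
have [B _ gB] := gauss_bounded (z + 1 / 2 - eta / 2) e2.
have [s hs] := has_sum_exists gB; suff -> : theta eta z = s by [].
apply: tends_lim; apply: eq_tends (has_sum_int_tends hs) => N.
by rewrite /series /=; apply: eq_bigr => k _; rewrite !theta_termE.
Qed.

(* The theta series with exponents n z + n^2 s, without signs. *)
Definition jsum (z s : C) : C := theta (2 * s) (z - 1 / 2 + s).

Lemma jsum_has_sum (z s : C) : 0 < complex.Im s -> has_sum (gauss z s) (jsum z s).
Proof.
move=> s0; have s2 : 0 < complex.Im (2 * s).
  have -> : 2 * s = s + s by ring.
  by case: s s0 => a b /= b0; rewrite addr_gt0.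
have := @theta_has_sum (2 * s) (z - 1 / 2 + s) s2; rewrite -/(jsum z s).
have -> : 2 * s / 2 = s by field.
by have -> : z - 1 / 2 + s + 1 / 2 - s = z by ring.
Qed.
End ThetaSum.

(** * The Jacobi triple product and the zeros of theta *)

Section TripleProduct.
Variable R : realType.
Notation C := R[i].

Lemma has_sum_geometric (c q : C) : `|q| < 1 ->
  exists s, has_sum (fun n : nat => `|c * q ^+ n|) s.
Proof.
move=> q1; apply: (@has_sum_exists _ _ _ (`|c| * (1 - `|q|)^-1)) => F uF.
under eq_bigr do rewrite normr_id normrM normrX.
by rewrite -mulr_sumr ler_wpM2l // sum_geometric_le.
Qed.

Variable q : C.
Hypothesis q1 : `|q| < 1.

Lemma prod_geometric_lower_bound (c : C) : (forall n, 1 - c * q ^+ n != 0) ->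
  exists2 d, 0 < d & forall N, d <= `|\prod_(n < N) (1 - c * q ^+ n)|.
Proof.
by move=> ne; have [s hs] := has_sum_geometric c q1; exact: prod_lower_bound hs ne.
Qed.

Lemma prod_geometric_upper_bound (c : C) :
  exists D, forall N, `|\prod_(n < N) (1 - c * q ^+ n)| <= D.
Proof.
have [s hs] := has_sum_geometric c q1.
have [s' hs'] : exists s', has_sum (fun n => `| `|c * q ^+ n| / (1 + `|c * q ^+ n|) |) s'.
  apply: (@has_sum_exists _ _ _ (`|c| * (1 - `|q|)^-1)) => F uF.
  apply: le_trans (_ : \sum_(n <- F) `|c * q ^+ n| <= _).
    apply: ler_sum => n _; have d0 : 0 < 1 + `|c * q ^+ n| by rewrite ltr_wpDr.
    rewrite normr_id normrM normfV normr_id (gtr0_norm d0) ler_pdivrMr //.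
    by rewrite ler_peMr // lerDl.
  under eq_bigr do rewrite normrM normrX.
  by rewrite -mulr_sumr ler_wpM2l // sum_geometric_le.
exact: prod_upper_bound hs hs'.
Qed.

Lemma qpochE n : qpoch q n = \prod_(k < n) (1 - q * q ^+ k).
Proof. by apply: eq_bigr => k _; rewrite exprS. Qed.

Lemma expq_neq1 n : 1 - q * q ^+ n != 0.
Proof.
rewrite subr_eq0 -exprS; apply/eqP => /(congr1 Num.norm) /eqP.
by rewrite normr1 normrX eq_sym lt_eqF // exprn_ilt1.
Qed.

Lemma qpoch_limit : exists G, [/\ G != 0, tends (qpoch q) G,
  exists2 c, 0 < c & forall n, c <= `|qpoch q n| &
  exists D, forall n, `|qpoch q n| <= D].
Proof.
have [c c0 cP] := prod_geometric_lower_bound expq_neq1.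
have [D DP] := prod_geometric_upper_bound q.
have qc n : c <= `|qpoch q n| by rewrite qpochE.
have qD n : `|qpoch q n| <= D by rewrite qpochE.
(* Telescoping: these are the differences of consecutive q-factorials, summable because the
   q-factorials are bounded. *)
have [s hs] : exists s, has_sum (fun n => - (qpoch q n * (q * q ^+ n))) s.
  apply: (@has_sum_exists _ _ _ (D * (`|q| * (1 - `|q|)^-1))) => F uF.
  apply: le_trans (_ : \sum_(n <- F) D * (`|q| * `|q| ^+ n) <= _).
    apply: ler_sum => n _; rewrite normrN !normrM normrX.
    by apply: ler_wpM2r; [rewrite mulr_ge0 // exprn_ge0 | exact: qD].
  rewrite -!mulr_sumr ler_wpM2l //; first by apply: le_trans (qD 0%N).
  by rewrite ler_wpM2l // sum_geometric_le.
have lim : tends (qpoch q) (1 + s).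
  apply: eq_tends (tendsD (tends_cst 1) (has_sum_tends hs)) => N.
  elim: N => [|N IHN]; first by rewrite big_ord0 addr0 /qpoch big_ord0.
  by rewrite big_ord_recr /= addrA IHN qpochS exprS; ring.
by exists (1 + s); split=> //; [have [] := tendsV c0 qc lim | exists c | exists D].
Qed.

End TripleProduct.

Section JacobiTripleProduct.
Variable R : realType.
Notation C := R[i].
Variables (eta : C).
Hypothesis eta0 : 0 < complex.Im eta.
Let q := ce eta.

Lemma norm_ce_lt1 : `|q| < 1.
Proof.
rewrite norm_ce -[X in _ < X]/(1%:C) ltcR expR_lt1 oppr_lt0 !mulr_gt0 ?pi_gt0 //.
Qed.

(** The truncated triple product without the factors 1 - q^k, whose product does not depend on z and
    is left to a constant. *)
Definition theta_prod (z : C) (N : nat) : C :=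
  \prod_(k < N) ((1 - ce z * q ^+ k) * (1 - q / ce z * q ^+ k)).

Lemma bin2_complex (n : nat) : 'C(n, 2)%:R = n%:R * (n%:R - 1) / 2 :> C.
Proof.
elim: n => [|n IHn]; first by rewrite bin_small // !mul0r.
by rewrite binS bin1 natrD IHn -natr1; field.
Qed.

Lemma prod_expq (N : nat) : \prod_(k < N) q ^+ k = q ^+ 'C(N, 2).
Proof.
elim: N => [|N IHN]; first by rewrite big_ord0 bin_small.
by rewrite big_ord_recr /= IHN binS bin1 exprD.
Qed.

Let A (z : C) (N : nat) := q ^+ 'C(N, 2) * q ^+ (N * N) * (- ce z) ^+ N.

(** The factors with k >= N give the 1 - e^(2 pi i z) q^(k - N); those with k < N, taken in reverse
    order, give the others. [A] collects the monomials taken out. *)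
Lemma theta_prodE z N :
  \prod_(k < N + N) (q ^+ N + q ^+ k * (- ce z)) = A z N * theta_prod z N.
Proof.
rewrite big_split_ord /=.
have -> : \prod_(i < N) (q ^+ N + q ^+ (N + i) * - ce z) =
    q ^+ (N * N) * \prod_(k < N) (1 - ce z * q ^+ k).
  have -> : q ^+ (N * N) = \prod_(i < N) q ^+ N by rewrite prodr_const card_ord exprM.
  by rewrite -big_split /=; apply: eq_bigr => i _; rewrite exprD; ring.
have -> : \prod_(i < N) (q ^+ N + q ^+ i * - ce z) =
    q ^+ 'C(N, 2) * (- ce z) ^+ N * \prod_(k < N) (1 - q / ce z * q ^+ k).
  transitivity (\prod_(i < N) (q ^+ i * (- ce z) * (1 - q / ce z * q ^+ rev_ord i))).
    apply: eq_bigr => i _ /=.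
    have -> : q ^+ N = q ^+ i * (q * q ^+ (N - i.+1)).
      by rewrite -exprS -exprD; congr (_ ^+ _); have := ltn_ord i; lia.
    by field; exact: ce_neq0.
  rewrite !big_split /= prod_expq prodr_const card_ord; congr (_ * _ * _).
  by rewrite [RHS](reindex_inj rev_ord_inj).
by rewrite /A /theta_prod big_split /=; ring.
Qed.

Lemma theta_termA z N i : (i <= N + N)%N ->
  q ^+ 'C(i, 2) * (- ce z) ^+ i * (q ^+ N) ^+ (N + N - i) =
  A z N * gauss (z + 1 / 2 - eta / 2) (eta / 2) (i%:Z - N%:Z).
Proof.
move=> iN; have w : - ce z = ce (z + 1 / 2) by rewrite ceD ce_half mulrN1.
rewrite /A w /gauss /q -!exprM -!ceMn -!ceD; congr ce.
rewrite !natrM natrB // natrD !bin2_complex expr2 !intrM !intrB -!pmulrn.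
by field.
Qed.

Lemma theta_prod_sum z N : theta_prod z N = \sum_(i < (N + N).+1)
  gbin q (N + N) i * gauss (z + 1 / 2 - eta / 2) (eta / 2) (i%:Z - N%:Z).
Proof.
have A0 : A z N != 0.
  by rewrite /A !mulf_neq0 // expf_neq0 ?oppr_eq0 // ce_neq0.
apply: (mulfI A0); rewrite -theta_prodE gauss_binomial mulr_sumr.
apply: eq_bigr => i _.
by rewrite mulrCA -theta_termA ?mulrA // -ltnS.
Qed.

(* The q-binomial theorem writes theta_prod z N as a finite sum over [-N, N], to which
   Tannery's theorem applies. *)
Lemma jacobi_triple_product : exists2 G, G != 0 &
  forall z, tends (theta_prod z) (G * theta eta z).
Proof.
have [G [G0 Glim [c c0 cP] [D DP]]] := qpoch_limit norm_ce_lt1.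
have D0 : 0 <= D by apply: le_trans (DP 0%N).
exists G^-1; first by rewrite invr_eq0.
move=> z; pose g := gauss (z + 1 / 2 - eta / 2) (eta / 2).
have qp0 n : qpoch q n != 0 by rewrite -normr_gt0 (lt_le_trans c0).
(* The Gaussian binomial of 2 N over N + j as a quotient; it is symmetric in j, hence the absolute
   value. For fixed j it tends to G / (G G). *)
pose F N (j : int) : C := if (`|j| <= N)%N
  then qpoch q (N + N) / (qpoch q (N + `|j|) * qpoch q (N - `|j|)) * g j else 0.
have th := theta_has_sum z eta0; rewrite -/g in th.
have e2 : 0 < complex.Im (eta / 2).
  have -> : eta / 2 = eta * (2^-1)%:C by rewrite fmorphV rmorph_nat.
  case: (eta) eta0 => a b /= b0; simpc.
  by rewrite mulr_gt0 // invr_gt0.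
have [B B0 gB] := gauss_bounded (z + 1 / 2 - eta / 2) e2.
have [B' hB'] : exists B', has_sum (fun j => `|G^-1 * g j|) B'.
  apply: (@has_sum_exists _ _ _ (`|G^-1| * B)) => S uS.
  under eq_bigr do rewrite normr_id normrM.
  by rewrite -mulr_sumr ler_wpM2l // gB.
pose E := D / (c * c) * `|G|.
have c0' : 0 <= c := ltW c0.
have E0 : 0 <= E by rewrite mulr_ge0 // divr_ge0 // mulr_ge0.
apply: (tannery (F := F) E0 _ _ hB' (has_sumZ G^-1 th)) => [N j|j|N].
- rewrite /F; case: ifP => _; last by rewrite normr0 mulr_ge0.
  rewrite /E /= -(mulrA _ `|G|) -(normrM G) (mulrA G) mulfV // mul1r normrM ler_wpM2r //.
  rewrite normrM normfV normrM ler_pM ?invr_ge0 ?mulr_ge0 //.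
  by rewrite lef_pV2 ?posrE ?mulr_gt0 ?normr_gt0 ?qp0 // ler_pM ?cP // ltW.
- have limV := (tendsV c0 cP Glim).2.
  apply: (@tends_near _ (fun N => qpoch q (N + N) * ((qpoch q (N + `|j|))^-1 *
     (qpoch q (N - `|j|))^-1) * g j)).
    by exists `|j|%N => N jN; rewrite /F jN invfM.
  have -> : G^-1 * g j = g j * (G * (G^-1 * G^-1)) by field.
  apply: eq_tends (tendsZ (g j) (tendsM (tends_sub (h := fun N => (N + N)%N) _ Glim)
    (tendsM (tends_sub (h := fun N => (N + `|j|)%N) _ limV)
            (tends_sub (h := fun N => (N - `|j|)%N) _ limV)))) => [N|M|M|M].
  + by rewrite mulrC.
  + by exists M => n; lia.
  + by exists M => n; lia.
  + by exists (M + `|j|)%N => n; lia.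
pose s := [seq i%:Z - N%:Z | i <- iota 0 (N + N).+1].
have us : uniq s by rewrite map_inj_uniq ?iota_uniq // => i i' /addIr [].
have Fs j : j \notin s -> F N j = 0.
  rewrite /F; case: ifP => // jN /negP[]; apply/mapP.
  exists (absz (j + N%:Z)); first by rewrite mem_iota; lia.
  by rewrite gez0_abs; [rewrite addrK | lia].
have -> : theta_prod z N = \sum_(j <- s) F N j.
  rewrite theta_prod_sum big_map -[iota 0 _]/(index_iota 0 (N + N).+1) big_mkord.
  apply: eq_bigr => i _; have := ltn_ord i; rewrite ltnS => iN.
  rewrite -/(g _) /F ifT; last by lia.
  congr (_ * _); have := gbin_poch q iN => gp.
  apply: (mulIf (mulf_neq0 (qp0 (N + `|i%:Z - N%:Z|)%N) (qp0 (N - `|i%:Z - N%:Z|)%N))).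
  rewrite divfK ?mulf_neq0 // -gp; congr (_ * _).
  have [Ni|Ni] := leqP N i.
    by congr (qpoch q _ * qpoch q _); lia.
  by rewrite mulrC; congr (qpoch q _ * qpoch q _); lia.
exact: has_sum_finite.
Qed.

(** Off the lattice no factor of the triple product vanishes, so the partial products stay away from
    0. *)
Lemma theta_neq0 z : ~ in_lattice eta z -> theta eta z != 0.
Proof.
move=> nz; have [G G0 lim] := jacobi_triple_product.
have q1 := norm_ce_lt1.
have n1 n : 1 - ce z * q ^+ n != 0.
  rewrite subr_eq0 eq_sym; apply/eqP; rewrite -ceMn -ceD => /ce_eq1[k e].
  apply: nz; exists k, (- n%:Z); rewrite -e mulrNz -pmulrn; ring.
have n2 n : 1 - q / ce z * q ^+ n != 0.
  rewrite subr_eq0 eq_sym; apply/eqP; rewrite -ceN -ceMn -!ceD => /ce_eq1[k e].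
  apply: nz; exists (- k), (n.+1%:Z); rewrite mulrNz -e -pmulrn -natr1; ring.
have [c1 c10 c1P] := prod_geometric_lower_bound q1 n1.
have [c2 c20 c2P] := prod_geometric_lower_bound q1 n2.
have lb N : c1 * c2 <= `|theta_prod z N|.
  by rewrite /theta_prod big_split /= normrM ler_pM ?(ltW c10) ?(ltW c20) ?c1P ?c2P.
have [] := tendsV (mulr_gt0 c10 c20) lb (lim z).
by rewrite mulf_eq0 negb_or => /andP[].
Qed.

End JacobiTripleProduct.

(** * The product of theta over the translates by m / 5 *)

Section Quintuple.
Variable R : realType.
Notation C := R[i].

Lemma prod_root5 (w x : C) : w ^+ 5 = 1 -> w != 1 ->
  \prod_(m < 5) (1 - w ^+ m * x) = 1 - x ^+ 5.
Proof.
move=> w5 w1; have w4 : w ^+ 4 = - 1 - w - w ^+ 2 - w ^+ 3.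
  apply: (mulfI (_ : w - 1 != 0)); first by rewrite subr_eq0.
  by ring: w5.
by rewrite !big_ord_recr big_ord0 /=; ring: w4.
Qed.

Lemma ce_fifth : ce (1 / 5 : C) ^+ 5 = 1 /\ ce (1 / 5 : C) != 1.
Proof.
split; first by rewrite -ceMn mul1r mulfV ?pnatr_eq0 // ce1.
apply/eqP => /ce_eq1[k] /(congr1 ( *%R 5%:R)).
rewrite mul1r mulfV ?pnatr_eq0 // -[5%:R]/(5%:~R) -[1]/(1%:~R) -intrM.
by move/eqP; rewrite eqr_int => /eqP; lia.
Qed.

Variable eta : C.
Hypothesis eta0 : 0 < complex.Im eta.

Lemma im_5eta : 0 < complex.Im (5 * eta).
Proof.
have -> : 5 * eta = eta + eta + eta + eta + eta by ring.
by case: eta eta0 => a b /= b0; rewrite !addr_gt0.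
Qed.

(** This holds factor by factor, as the product of the 1 - w^m x over the fifth roots of unity w^m
    is 1 - x^5. *)
Lemma theta_prod5 z N :
  \prod_(m < 5) theta_prod eta (z + m%:R / 5) N = theta_prod (5 * eta) (5 * z) N.
Proof.
rewrite /theta_prod exchange_big; apply: eq_bigr => k _ /=.
have w_exp m : ce (m%:R / 5 : C) = ce (1 / 5) ^+ m by rewrite -ceMn mul1r.
have [w5 w1] := ce_fifth; rewrite big_split /=; congr (_ * _).
  rewrite (ceMn 5 z) (ceMn 5 eta) exprAC -exprMn -(prod_root5 _ w5 w1).
  by apply: eq_bigr => m _; rewrite ceD w_exp; ring.
have wi5 : (ce (1 / 5 : C))^-1 ^+ 5 = 1 by rewrite exprVn w5 invr1.
have wi1 : (ce (1 / 5 : C))^-1 != 1 by rewrite invr_eq1.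
rewrite (ceMn 5 z) (ceMn 5 eta) (exprAC _ 5) -exprVn -!exprMn -(prod_root5 _ wi5 wi1).
by apply: eq_bigr => m _; rewrite ceD w_exp exprVn; field; rewrite -w_exp !ce_neq0.
Qed.

Lemma theta_mul5 : exists2 K, K != 0 &
  forall z, \prod_(m < 5) theta eta (z + m%:R / 5) = K * theta (5 * eta) (5 * z).
Proof.
have [G G0 Glim] := jacobi_triple_product eta0.
have [G5 G50 G5lim] := jacobi_triple_product im_5eta.
exists (G5 / G ^+ 5) => [|z]; first by rewrite mulf_neq0 // invr_eq0 expf_neq0.
have tendsprod n : tends (fun N => \prod_(m < n) theta_prod eta (z + m%:R / 5) N)
    (\prod_(m < n) (G * theta eta (z + m%:R / 5))).
  elim: n => [|n IHn].
    by rewrite big_ord0; apply: eq_tends (tends_cst 1) => N; rewrite big_ord0.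
  rewrite big_ord_recr; apply: eq_tends (tendsM IHn (Glim _)) => N.
  by rewrite big_ord_recr.
have := tends_uniq (tendsprod 5) (eq_tends (fun N => esym (theta_prod5 z N)) (G5lim (5 * z))).
rewrite big_split /= prodr_const card_ord => e.
by apply: (mulfI (expf_neq0 5 G0)); rewrite e; field; rewrite G0.
Qed.

End Quintuple.

(** * Theta series over a residue class mod 5 *)

Section ThetaSections.
Variable R : realType.
Notation C := R[i].

Lemma norm_bounded_inj (I J : eqType) (f : I -> C) (h : J -> I) B : injective h ->
  norm_bounded f B -> norm_bounded (fun j => f (h j)) B.
Proof.
by move=> hI fB F uF; rewrite -(big_map h xpredT (fun i => `|f i|)) fB // map_inj_uniq.
Qed.

Lemma has_sum_prod (I J : eqType) (f : I -> C) (g : J -> C) s t B D :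
    norm_bounded f B -> norm_bounded g D -> has_sum f s -> has_sum g t ->
  has_sum (fun p => f p.1 * g p.2) (s * t).
Proof.
move=> fB gD hf hg; have [S hS] := has_sum_exists (norm_boundedM fB gD).
by rewrite -(has_sumM fB gD hf hg hS).
Qed.

Variable eta : C.
Hypothesis eta0 : 0 < complex.Im eta.

Lemma im_scale m n : 0 < complex.Im (m.+1%:R / n.+1%:R * eta).
Proof.
have -> : m.+1%:R / n.+1%:R = (m.+1%:R / n.+1%:R)%:C :> C.
  by rewrite rmorphM fmorphV !rmorph_nat.
by case: (eta) eta0 => a b /= b0; simpc; rewrite mulr_gt0 // divr_gt0 ?ltr0Sn.
Qed.

Let sg := 1 / 10 * eta.

Lemma im_sg : 0 < complex.Im sg. Proof. exact: (im_scale 0 9). Qed.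

(* The sum over the integers n = s mod 5 of e^(2 pi i (n z + n^2 eta / 10)). *)
Definition theta_section (s : int) (z : C) : C :=
  gauss z sg s * jsum (5 * z + 10 * s%:~R * sg) (25 * sg).

Local Notation f := theta_section.

Lemma theta_section_has_sum s z : has_sum (fun k : int => gauss z sg (5 * k + s)) (f s z).
Proof.
have im25 : 0 < complex.Im (25 * sg).
  have -> : 25 * sg = 25 / 10 * eta by rewrite /sg; field.
  exact: (im_scale 24 9).
apply: has_sum_eq (has_sumZ (gauss z sg s) (jsum_has_sum (5 * z + 10 * s%:~R * sg) im25)).
by move=> k /=; rewrite /gauss -ceD; congr ce; rewrite !expr2 !(intrD, intrM); ring.
Qed.

Lemma theta_section_bounded s z : exists B, norm_bounded (fun k : int => gauss z sg (5 * k + s)) B.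
Proof.
have [B _ BP] := gauss_bounded z im_sg; exists B.
by apply: norm_bounded_inj BP => k l /addIr e; lia.
Qed.

Lemma theta_section_shift s t z : f (s + 5 * t) z = f s z.
Proof.
have k1 : cancel (fun k : int => k + t) (fun k => k - t) by move=> k; rewrite addrK.
have k2 : cancel (fun k : int => k - t) (fun k => k + t) by move=> k; rewrite subrK.
apply: has_sum_uniq (has_sum_bij k1 k2 (theta_section_has_sum s z)).
apply: has_sum_eq (theta_section_has_sum _ z) => k /=.
by congr gauss; ring.
Qed.

Lemma theta_section_opp s z : f (- s) z = f s (- z).
Proof.
have kK : cancel (fun k : int => - k) (fun k => - k) by move=> k; rewrite opprK.
apply: has_sum_uniq (has_sum_bij kK kK (theta_section_has_sum s (- z))).
apply: has_sum_eq (theta_section_has_sum _ z) => k /=.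
by rewrite /gauss; congr ce; rewrite !expr2 !(intrD, intrM, intrN, mulrNz); ring.
Qed.

(** Translation by q eta moves the summation index by q; translation by p multiplies each term by
    e^(2 pi i N) for an integer N. *)
Lemma theta_section_quasi s (p q : int) z :
  f s (z - (p%:~R + q%:~R * eta)) = gauss z (- sg) (5 * q) * f s z.
Proof.
rewrite -[in RHS](theta_section_shift s (- q) z).
apply: has_sum_uniq (has_sumZ _ (theta_section_has_sum _ z)).
apply: has_sum_eq (theta_section_has_sum s _) => k /=.
rewrite /gauss -ceD.
transitivity (ce ((- ((5 * k + s) * p))%:~R +
   ((5 * k + s)%:~R * (z - q%:~R * eta) + ((5 * k + s) ^+ 2)%:~R * sg)) : C).
  by congr ce; rewrite mulrNz intrM; ring.
rewrite [LHS]ceD ce_int mul1r; congr ce.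
have -> : eta = 10 * sg by rewrite /sg; field.
by rewrite !expr2 !(intrD, intrM, mulrNz); ring.
Qed.

End ThetaSections.

Section ThetaIdentities.
Variable R : realType.
Notation C := R[i].
Variable eta : C.
Hypothesis eta0 : 0 < complex.Im eta.
Let sg := 1 / 10 * eta.
Local Notation f := (theta_section eta).

Lemma has_sum_gauss_inj (h : int -> int) (z s : C) : 0 < complex.Im s -> injective h ->
  exists S B, has_sum (fun k => gauss z s (h k)) S /\ norm_bounded (fun k => gauss z s (h k)) B.
Proof.
move=> s0 hI; have [B _ /(norm_bounded_inj hI) BP] := gauss_bounded z s0.
by have [S hS] := has_sum_exists BP; exists S, B.
Qed.

(* Sum over x = s + d, y = s - d mod 5 along the lines x + y = const: both x + y and
   x - y then run through one of two classes mod 10, selected by the parity of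
   (x - y - 2 d) / 5. *)
Lemma theta_section_mul z : exists B D : bool -> int -> C, forall s d : int,
  f (s + d) z * f (s - d) z = B false s * D false d + B true s * D true d.
Proof.
have half0 : 0 < complex.Im (1 / 2 * sg).
  have -> : 1 / 2 * sg = 1 / 20 * eta by rewrite /sg; field.
  exact: (im_scale eta0 0 19).
(* For n = 5 k + s + d and m = 5 l + s - d with k = p + q + e and l = p - q, these are n + m = h e s
   p and n - m = h e d q. Half the sum of their squares is n^2 + m^2, hence the parameter sg / 2. *)
pose h (e : bool) (s p : int) : int := 5 * (2 * p + e%:Z) + 2 * s.
have hI e s : injective (h e s) by move=> p p'; rewrite /h => E; lia.
have /choice[S /choice[BS SP]] : forall x : C * bool * int, exists S B,
    has_sum (fun k => gauss x.1.1 (1 / 2 * sg) (h x.1.2 x.2 k)) S /\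
    norm_bounded (fun k => gauss x.1.1 (1 / 2 * sg) (h x.1.2 x.2 k)) B.
  by move=> x; exact: has_sum_gauss_inj.
exists (fun e s => S (z, e, s)), (fun e d => S (0, e, d)) => s d.
pose F (x : int * int * bool) : C :=
  gauss z (1 / 2 * sg) (h x.2 s x.1.1) * gauss 0 (1 / 2 * sg) (h x.2 d x.1.2).
have hF : has_sum F (\sum_(e : bool) S (z, e, s) * S (0, e, d)).
  apply: has_sum_slices => e.
  have [S1 B1] := SP (z, e, s); have [S2 B2] := SP (0, e, d).
  exact: has_sum_prod B1 B2 S1 S2.
pose odd_int (n : int) : bool := (n %% 2)%Z != 0.
pose hh (x : int * int) : int * int * bool :=
  (((x.1 + x.2) %/ 2)%Z, ((x.1 - x.2) %/ 2)%Z, odd_int (x.1 - x.2)).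
pose kk (x : int * int * bool) : int * int :=
  (x.1.1 + x.1.2 + x.2%:Z, x.1.1 - x.1.2).
have hhK : cancel hh kk.
  move=> [k l]; rewrite /hh /kk /odd_int /=; case: eqP => E /=; congr (_, _); lia.
have kkK : cancel kk hh.
  move=> [[p q] e]; rewrite /hh /kk /odd_int /=; case: e => /=;
  (congr (_, _, _); [lia | lia |]); case: eqP; lia.
have := has_sum_bij hhK kkK hF.
have [Bf Bf1] := theta_section_bounded eta0 (s + d) z.
have [Bf' Bf2] := theta_section_bounded eta0 (s - d) z.
have hf := has_sum_prod Bf1 Bf2 (theta_section_has_sum eta0 (s + d) z)
  (theta_section_has_sum eta0 (s - d) z).
rewrite big_bool /= addrC => hFh; apply: has_sum_uniq hf _.
have FE x : F x = gauss z sg (5 * (kk x).1 + (s + d)) * gauss z sg (5 * (kk x).2 + (s - d)).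
  case: x => [[p q] e]; rewrite /F /kk /h /gauss -!ceD /=; congr ce.
  by rewrite !expr2 !(intrD, intrM, intrN, mulrNz); field.
by apply: has_sum_eq hFh => x /=; rewrite FE hhK.
Qed.

(* By theta_section_mul the matrix has rank at most 2. *)
Lemma theta_section_det z :
  \det (\matrix_(s < 3, d < 3) (f (s%:Z + d%:Z) z * f (s%:Z - d%:Z) z)) = 0.
Proof.
have [B [D BD]] := theta_section_mul z.
transitivity (\det (\matrix_(s < 3, d < 3)
    (B false s%:Z * D false d%:Z + B true s%:Z * D true d%:Z))).
  by congr (\det _); apply/matrixP => s d; rewrite !mxE BD.
move: (B false) (B true) (D false) (D true) => B0 B1 D0 D1.
rewrite (det_mx33 (fun s d : nat => B0 s * D0 d + B1 s * D1 d)).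
by ring.
Qed.

(* The pairs x = 2 alpha, y = alpha mod 5 are x = 2 m - n, y = m + 2 n, and
   x + y = 3 m + n, x^2 + y^2 = 5 (m^2 + n^2). *)
Lemma sum_theta_section z :
  \sum_(al < 5) f (2 * al%:Z) z * f al%:Z z = jsum (3 * z) (eta / 2) * jsum z (eta / 2).
Proof.
have half0 : 0 < complex.Im (eta / 2).
  by have := im_scale eta0 0 1; rewrite mul1r mulrC.
have [B1 _ B1P] := gauss_bounded (3 * z) half0.
have [B2 _ B2P] := gauss_bounded z half0.
have hJ := has_sum_prod B1P B2P (jsum_has_sum (3 * z) half0) (jsum_has_sum z half0).
pose F (x : int * int * 'I_5) : C :=
  gauss z sg (5 * x.1.1 + 2 * x.2%:Z) * gauss z sg (5 * x.1.2 + x.2%:Z).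
have hF : has_sum F (\sum_(al < 5) f (2 * al%:Z) z * f al%:Z z).
  apply: has_sum_slices => al.
  have [S1 B1'] := theta_section_bounded eta0 (2 * al%:Z) z.
  have [S2 B2'] := theta_section_bounded eta0 al%:Z z.
  exact: has_sum_prod B1' B2' (theta_section_has_sum eta0 _ z) (theta_section_has_sum eta0 _ z).
(* Solving for the new indices, m = (2 x + y) / 5 and n = (2 y - x) / 5; the class is recovered as m
   + 2 n mod 5. *)
pose h (x : int * int * 'I_5) : int * int :=
  (2 * x.1.1 + x.1.2 + x.2%:Z, 2 * x.1.2 - x.1.1).
have kP (x : int * int) : (absz ((x.1 + 2 * x.2) %% 5)%Z < 5)%N by lia.
pose k (x : int * int) : int * int * 'I_5 :=
  (((2 * x.1 - x.2 - 2 * ((x.1 + 2 * x.2) %% 5)%Z) %/ 5)%Z,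
   ((x.1 + 2 * x.2 - ((x.1 + 2 * x.2) %% 5)%Z) %/ 5)%Z, Ordinal (kP x)).
have hK : cancel h k.
  move=> [[i j] [al al5]]; rewrite /h /k /=; congr (_, _, _); [lia | lia |].
  by apply: val_inj => /=; lia.
have kK : cancel k h by move=> [m n]; rewrite /h /k /=; congr (_, _); lia.
apply: has_sum_uniq hF (has_sum_eq _ (has_sum_bij hK kK hJ)) => -[[i j] al].
rewrite /F /h /gauss /= -!ceD; congr ce; rewrite /sg !expr2.
by rewrite !(intrD, intrM, intrN, mulrNz); field.
Qed.

End ThetaIdentities.

(** * Theta constants at a point of order two *)

Section ThetaConstants.
Variable R : realType.
Notation C := R[i].
Variables eta tau : C.
Hypothesis eta0 : 0 < complex.Im eta.
Local Notation f := (theta_section eta).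

Lemma theta_periodic (e z : C) (p : int) : 0 < complex.Im e ->
  theta e (z + p%:~R) = theta e z.
Proof.
move=> e0; apply: has_sum_uniq (theta_has_sum _ e0).
apply: has_sum_eq (theta_has_sum _ e0) => k; rewrite /gauss.
have -> : z + p%:~R + 1 / 2 - e / 2 = z + 1 / 2 - e / 2 + p%:~R by ring.
by rewrite mulrDr -intrM addrAC ceD ce_int mulr1.
Qed.

(** The product defining [theta_] collapses to one theta series for 5 eta. The shift by 1/2 + eta/2
    absorbs the signs and the linear part of k (k - 1) / 2, leaving a fifth root of unity. *)
Lemma theta_section_theta_ : exists2 K, K != 0 & forall (al : nat) z,
  theta_ 5 eta al z = K * ce ((3 * al)%:R * (1 / 5)) * f al (z - 1 / 2 - eta / 2).
Proof.
have [K K0 KP] := theta_mul5 eta0; exists K => // al z.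
rewrite /theta_ (eq_bigr (fun m : 'I_5 => theta eta (z + al%:R / 5 * eta + m%:R / 5))).
  rewrite KP /theta_section /gauss /jsum.
  have -> : 2 * (25 * (1 / 10 * eta)) = 5 * eta by field.
  have -> : 5 * (z - 1 / 2 - eta / 2) + 10 * (al%:Z)%:~R * (1 / 10 * eta) - 1 / 2 +
    25 * (1 / 10 * eta) = 5 * (z + al%:R / 5 * eta) + (- 3)%:~R by rewrite -pmulrn; field.
  rewrite theta_periodic ?im_5eta //.
  set T := theta _ _.
  have -> : K * ce ((3 * al)%:R * (1 / 5)) * (ce (al%:Z%:~R * (z - 1 / 2 - eta / 2) +
      (al%:Z ^+ 2)%:~R * (1 / 10 * eta)) * T) =
    ce ((3 * al)%:R * (1 / 5) + (al%:Z%:~R * (z - 1 / 2 - eta / 2) +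
      (al%:Z ^+ 2)%:~R * (1 / 10 * eta))) * (K * T) by rewrite [in RHS]ceD; ring.
  by congr (_ * _); congr ce; rewrite natrM expr2 intrM -!pmulrn; field.
by move=> m _; congr theta; ring.
Qed.

Lemma theta_5eta_neq0 (al : nat) z : ~ in_lattice (5 * eta) (5 * z + al%:R * eta) ->
  theta_ 5 eta al z != 0.
Proof.
move=> nz; have [K K0 KP] := theta_mul5 eta0.
rewrite /theta_ mulf_neq0 ?ce_neq0 //.
rewrite (eq_bigr (fun m : 'I_5 => theta eta (z + al%:R / 5 * eta + m%:R / 5))).
  rewrite KP mulf_neq0 // theta_neq0 ?im_5eta //.
  suff -> : 5 * (z + al%:R / 5 * eta) = 5 * z + al%:R * eta by [].
  by field.
by move=> m _; congr theta; ring.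
Qed.

Lemma theta_0_neq0 (al : nat) : (0 < al < 5)%N -> theta_ 5 eta al 0 != 0.
Proof.
move=> al5; apply: theta_5eta_neq0 => -[p [q]].
rewrite mulr0 add0r mulrCA => /(congr1 (@complex.Im R)).
have -> : complex.Im (al%:R * eta) = al%:R * complex.Im eta.
  by rewrite -(rmorph_nat (real_complex R)); case: eta => x y /=; simpc.
have -> : complex.Im (p%:~R + 5 * (q%:~R * eta)) = 5 * q%:~R * complex.Im eta.
  rewrite -!(rmorph_int (real_complex R)) -(rmorph_nat (real_complex R) 5).
  by case: eta => x y /=; simpc; rewrite mulrA.
move=> /(mulIf (lt0r_neq0 eta0)) /eqP.
rewrite -[5]/(5%:~R) -intrM pmulrn eqr_int; lia.
Qed.

Hypothesis tau2 : order_two_point eta tau.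

(* With z = tau - 1/2 - eta/2, the point 2 z lies in the lattice, so f (- s) z and f s z are
   proportional, hence equal as f 0 z != 0. *)
Lemma theta_constants : exists u v K K' : C,
  [/\ u != 0, v != 0, 1 + 4 * (u * v) != 0,
      2 * u ^+ 3 * v ^+ 3 + u * v = u ^+ 2 * v ^+ 2 + u ^+ 5 + v ^+ 5 &
  [/\ K != 0, K' != 0,
      forall al : 'I_5, theta_ 5 eta al tau =
        K * (ce (3 / 5) ^+ al * nth 0 [:: 1; u; v; v; u] al) &
      forall al : 'I_5, theta_ 5 eta al (- tau) =
        K' * (ce (3 / 5) ^+ al * nth 0 [:: 1; u; v; v; u] al)]].
Proof.
have [tauN [p [q tauE]]] := tau2.
have [K K0 KP] := theta_section_theta_.
pose z := tau - 1 / 2 - eta / 2.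
have nz (al : nat) : f al z != 0.
  have : theta_ 5 eta al tau != 0.
    apply: theta_5eta_neq0 => -[p' [q' e]]; apply: tauN.
    exists (p' - 2 * p), (5 * q' - al%:Z - 2 * q).
    (* As 2 tau is in the lattice, 5 tau cannot be there without tau being there. *)
    have -> : tau = (5 * tau + al%:R * eta) - al%:R * eta - 2 * (2 * tau) by ring.
    by rewrite e tauE !(intrD, intrM, intrN, mulrNz) -!pmulrn; ring.
  by rewrite KP mulf_eq0 negb_or => /andP[].
have [mu muE] : exists mu, forall s, f (- s) z = mu * f s z.
  exists (gauss z (- (1 / 10 * eta)) (5 * (q - 1))) => s.
  rewrite theta_section_opp // -(@theta_section_quasi _ _ eta0 s (p - 1)); congr f.
  have pE : p%:~R = 2 * tau - q%:~R * eta :> C by rewrite tauE addrK.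
  by rewrite !intrB pE /z; field.
have mu1 : mu = 1.
  by apply: (mulIf (nz 0%N)); rewrite -muE mul1r oppr0.
have even s : f (- s) z = f s z by rewrite muE mu1 mul1r.
have f3 : f 3 z = f 2 z by rewrite -even -(theta_section_shift eta0 _ 1).
have f4 : f 4 z = f 1 z by rewrite -even -(theta_section_shift eta0 _ 1).
have f0 : f 0 z != 0 := nz 0%N.
pose u := f 1 z / f 0 z; pose v := f 2 z / f 0 z.
have hE (al : 'I_5) : f al z = f 0 z * nth 0 [:: 1; u; v; v; u] al.
  have fE h : f 0 z * (h / f 0 z) = h by rewrite mulrCA mulfV ?mulr1.
  case: al => -[|[|[|[|[|//]]]]] /= _; first by rewrite mulr1.
  - by rewrite fE.
  - by rewrite fE.
  - by rewrite f3 fE.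
  - by rewrite f4 fE.
have c3 (al : nat) : ce ((3 * al)%:R * (1 / 5)) = ce (3 / 5) ^+ al.
  by rewrite -ceMn natrM; congr ce; ring.
exists u, v, (K * f 0 z), (K * (gauss z (- (1 / 10 * eta)) (5 * q) * f 0 z)).
have u0 : u != 0 by apply: mulf_neq0 (nz 1%N) _; rewrite invr_eq0.
have v0 : v != 0 by apply: mulf_neq0 (nz 2%N) _; rewrite invr_eq0.
split=> //.
- have f6 : f 6 z = f 1 z := theta_section_shift eta0 1 1 z.
  have f8 : f 8 z = f 2 z by rewrite -f3; exact: (theta_section_shift eta0 3 1 z).
  (* By evenness and periodicity mod 5, the five products are f_0^2 and four times f_1 f_2. *)
  have := sum_theta_section eta0 z; rewrite !big_ord_recr big_ord0 /= add0r.
  rewrite f6 f8 f3 f4 => e.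
  have jn (y : C) : ~ in_lattice eta (y - 1 / 2 + eta / 2) -> jsum y (eta / 2) != 0.
    by rewrite /jsum mulrCA mulfV ?pnatr_eq0 // mulr1; exact: theta_neq0.
  have : jsum (3 * z) (eta / 2) * jsum z (eta / 2) != 0.
    (* The two arguments of theta are 3 tau - 2 - eta and tau - 1, both congruent to tau modulo the
       lattice. *)
    apply: mulf_neq0; apply: jn => -[k [l e']]; apply: tauN.
      exists (k + 2 - p), (l + 1 - q).
      have -> : tau = 3 * z - 1 / 2 + eta / 2 + 2 + eta - 2 * tau by rewrite /z; field.
      by rewrite e' tauE !(intrD, intrN, mulrNz) -!pmulrn; ring.
    exists (k + 1), l.
    have -> : tau = z - 1 / 2 + eta / 2 + 1 by rewrite /z; field.
    by rewrite e' intrD -pmulrn; ring.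
  apply: contra_neq => uv; rewrite -e -[RHS](mulr0 (f 0 z ^+ 2)) -uv /u /v.
  by move: (f 0 z) (f 1 z) (f 2 z) f0 => h0 h1 h2 h00; field.
- have := theta_section_det eta0 z.
  rewrite (det_mx33 (fun s d : nat => f (s%:Z + d%:Z) z * f (s%:Z - d%:Z) z)) /=.
  rewrite !(addr0, add0r, subr0, sub0r, oppr0).
  rewrite !even.
  rewrite -[1%:Z + 1]/2%:Z -[1%:Z - 1]/0%:Z -[2%:Z + 2]/4%:Z -[2%:Z - 2]/0%:Z.
  rewrite -[1%:Z + 2]/3%:Z -[2%:Z + 1]/3%:Z -[2%:Z - 1]/1%:Z.
  rewrite f3 f4 /u /v.
  move: (f 0 z) (f 1 z) (f 2 z) f0 => h0 h1 h2 h00 e.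
  (* The determinant is homogeneous of degree 6 in the three section values, so dividing by f_0^6
     gives the equation between u and v. *)
  apply: (mulfI (expf_neq0 6 h00)); apply: subr0_eq; rewrite -e.
  by field.
split=> [||al|al]; [by rewrite mulf_neq0 | by apply/mulf_neq0/mulf_neq0/f0/ce_neq0 | |].
  by rewrite KP c3 -/z hE; ring.
rewrite KP c3.
have -> : - tau - 1 / 2 - eta / 2 = z - (p%:~R + q%:~R * eta) by rewrite -tauE /z; ring.
by rewrite theta_section_quasi // hE; ring.
Qed.

End ThetaConstants.

(** * The Clifford parameters *)

Section CliffordParameters.

Lemma exists_module4 (K : numClosedFieldType) n (S : 'M[K]_n) : S^T = S ->
  (\rank S <= 5)%N -> exists X : 'I_n -> 'M[K]_4, clifford_module S X.
Proof.
move=> symS rkS; have two_neq0 : (2 : K) != 0 by rewrite pnatr_eq0.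
have [L LE] : exists L : 'M[K]_(5, n), 2^-1 *: S = L^T *m L.
  apply: sym_mx_factor; first by rewrite linearZ /= symS.
  exact: leq_trans (mxrankS (scalemx_sub _ (submx_refl S))) rkS.
have SE : S = 2 *: (L^T *m L) by rewrite -LE scalerA mulfV // scale1r.
have [Y cliffY _] := clifford_system4 K (isT : (3 < 5 <= 5)%N).
by exists (module_of_system L Y); exact: module_of_systemP.
Qed.

Lemma big_Z5 (V : nmodType) (F : 'Z_5 -> V) :
  \sum_(r : 'Z_5) F r = F 0 + F 1 + F 2 + F 3 + F 4.
Proof.
rewrite !big_ord_recr big_ord0 /= add0r.
by congr (F _ + F _ + F _ + F _ + F _); exact: val_inj.
Qed.

Variable K : fieldType.
Variables u v : K.
Hypotheses (u0 : u != 0) (v0 : v != 0).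

(* The values theta_r(tau), up to the factor K w^r with w^5 = 1. *)
Definition theta_ratio (r : 'Z_5) : K := nth 0 [:: 1; u; v; v; u] r.

Definition reduced_relation (B : algType K) (y : 'Z_5 -> B) (i j : 'Z_5) : B :=
  \sum_(r : 'Z_5) (theta_ratio (j - i - r) * theta_ratio r)^-1 *: (y (j - r) * y (i + r)).

Variables (B : algType K) (y : 'Z_5 -> B) (a b : K).
Hypothesis e14 : y 1 * y 4 + y 4 * y 1 = a *: y 0 ^+ 2.
Hypothesis e23 : y 2 * y 3 + y 3 * y 2 = b *: y 0 ^+ 2.

Let y' (n : nat) : B := y (inZp n).

Let yE i : y i = y' (val i). Proof. by rewrite /y' valZpK. Qed.

(** All products in this relation have index sum 0 mod 5, so they combine into anticommutators equal
    to multiples of x_0^2. If x_0^2 is nonzero, the coefficient is a linear equation for a and b. *)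
Lemma reduced_relation41 :
  reduced_relation y 4 1 = ((v + a * u ^+ 2 + b * u) / (u ^+ 2 * v)) *: y 0 ^+ 2.
Proof.
transitivity (v^-1 *: (y 1 * y 4 + y 4 * y 1) + (u * u)^-1 *: (y 0 * y 0) +
  (u * v)^-1 *: (y 2 * y 3 + y 3 * y 2)).
  transitivity ((v * 1)^-1 *: (y' 1 * y' 4) + (u * u)^-1 *: (y' 0 * y' 0) +
    (1 * v)^-1 *: (y' 4 * y' 1) + (u * v)^-1 *: (y' 3 * y' 2) + (v * u)^-1 *: (y' 2 * y' 3)).
    by rewrite /reduced_relation big_Z5 !yE.
  rewrite mulr1 mul1r (mulrC v) !yE !scalerDr /=.
  by rewrite [LHS](AC 5 (1*3*2*(5*4))).
rewrite e14 e23 -expr2 !scalerA -!scalerDl; congr (_ *: _).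
by field; rewrite u0 v0.
Qed.

Lemma reduced_relation32 :
  reduced_relation y 3 2 = ((u + b * v ^+ 2 + a * v) / (u * v ^+ 2)) *: y 0 ^+ 2.
Proof.
transitivity (u^-1 *: (y 2 * y 3 + y 3 * y 2) + (u * v)^-1 *: (y 1 * y 4 + y 4 * y 1) +
  (v * v)^-1 *: (y 0 * y 0)).
  transitivity ((u * 1)^-1 *: (y' 2 * y' 3) + (v * u)^-1 *: (y' 1 * y' 4) +
    (v * v)^-1 *: (y' 0 * y' 0) + (u * v)^-1 *: (y' 4 * y' 1) + (1 * u)^-1 *: (y' 3 * y' 2)).
    by rewrite /reduced_relation big_Z5 !yE.
  rewrite mulr1 mul1r (mulrC v) !yE !scalerDr /=.
  by rewrite [LHS](AC 5 (1*5*(2*4)*3)).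
rewrite e14 e23 -expr2 !scalerA -!scalerDl; congr (_ *: _).
by field; rewrite u0 v0.
Qed.

End CliffordParameters.

(* When u v = 1, the symmetric form S, which violates the Clifford relation
   {x_1, x_4} = a x_0^2, still satisfies the Sklyanin relations. *)
Section ExcludedCase.
Variables (K : numClosedFieldType) (u v : K).
Hypothesis uv1 : u * v = 1.

(** With x_0^2 = 0 and {x_1, x_4} = 1, one of the two linear conditions asks {x_2, x_3} = - u and
    the other {x_2, x_3} = - 1 / v; these agree exactly when u v = 1. *)
Let t (i : 'Z_5) : K := nth 0 [:: 0; 1; - u; - u; 1] i.
Let S : 'M[K]_5 := \matrix_(i, j) (if (i : 'Z_5) + j == 0 then t i else 0).

Let t_opp i : t (- i) = t i.
Proof. by case/or4P: (Z5_cases i) => [/eqP->|/eqP->|/eqP->|/orP[]/eqP->]. Qed.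

Let S_sym : S^T = S.
Proof.
apply/matrixP => i j; rewrite !mxE addrC; case: eqP => // ij.
by rewrite -(t_opp j) -[i : 'Z_5](addrK (j : 'Z_5)) ij add0r.
Qed.

Lemma exists_reduced_module : exists y : 'Z_5 -> 'M[K]_4,
  [/\ forall i j, i != j -> reduced_relation u v y i j = 0, y 0 ^+ 2 = 0 &
      y 1 * y 4 + y 4 * y 1 = 1].
Proof.
have [y yS] := exists_module4 S_sym (rank_leq_row S).
have two_neq0 : (2 : K) != 0 by rewrite pnatr_eq0.
exists y; split=> [i j ij||].
- apply: (scalerI two_neq0); rewrite scaler0 scaler_nat mulr2n.
  (* The substitution r -> j - i - r fixes the coefficients and swaps the two factors, so twice the
     relation involves anticommutators only, which S prescribes. *)
  pose c r := (theta_ratio u v (j - i - r) * theta_ratio u v r)^-1.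
  have cC r : c (j - i - r) = c r by rewrite /c subKr mulrC.
  rewrite {1}/reduced_relation (reindex_inj (can_inj (subKr (j - i)))) /=.
  rewrite /reduced_relation -big_split /=.
  transitivity (\sum_(r : 'Z_5) c r *: (S (j - r) (i + r))%:M : 'M[K]_4).
    apply: eq_bigr => r _; rewrite -yS -/(c r) -/(c (j - i - r)) cC -scalerDr addrC.
    by congr (_ *: (_ *m _ + _ *m _)); congr y; ring.
  under eq_bigr do rewrite scale_scalar_mx.
  rewrite -(raddf_sum (@scalar_mx K 4)) /=.
  suff -> : \sum_(r : 'Z_5) c r * S (j - r) (i + r) = 0 by rewrite raddf0.
  under eq_bigr do rewrite mxE addrACA addNr addr0.
  have [ji|_] := eqVneq (j + i) 0; last by rewrite big1 // => r _; rewrite mulr0.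
  have jE : j = - i by rewrite -[j](addrK i) ji add0r.
  have v0 : v != 0 by apply: contra_eq_neq uv1 => ->; rewrite mulr0 eq_sym oner_eq0.
  have uE : u = v^-1 by apply: (mulIf v0); rewrite uv1 mulVf.
  rewrite big_Z5 /c jE; move: ij; rewrite jE.
  case/or4P: (Z5_cases i) => [/eqP->|/eqP->|/eqP->|/orP[]/eqP->] // _.
  - transitivity ((v * 1)^-1 * 1 + (v * u)^-1 * - u + (u * v)^-1 * - u + (1 * v)^-1 * 1
      + (u * u)^-1 * 0); [by [] | by rewrite uE; field].
  - transitivity ((u * 1)^-1 * - u + (1 * u)^-1 * - u + (u * v)^-1 * 1 + (v * v)^-1 * 0
      + (v * u)^-1 * 1); [by [] | by rewrite uE; field].
  - transitivity ((u * 1)^-1 * - u + (v * u)^-1 * 1 + (v * v)^-1 * 0 + (u * v)^-1 * 1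
      + (1 * u)^-1 * - u); [by [] | by rewrite uE; field].
  - transitivity ((v * 1)^-1 * 1 + (u * u)^-1 * 0 + (1 * v)^-1 * 1 + (u * v)^-1 * - u
      + (v * u)^-1 * - u); [by [] | by rewrite uE; field].
- apply: (scalerI two_neq0); rewrite scaler0 scaler_nat mulr2n expr2.
  by have := yS 0 0; rewrite mxE /= => ->; rewrite raddf0.
by have := yS 1 4; rewrite mxE /= => ->.
Qed.

End ExcludedCase.

(** * Comparison of the two presentations *)

Section SklyaninClifford.

Lemma quintic_clifford_parameters (K : fieldType) (u v a b : K) :
    (2 : K) != 0 -> u != 0 -> v != 0 -> u * v != 1 -> 1 + 4 * (u * v) != 0 ->
    2 * u ^+ 3 * v ^+ 3 + u * v = u ^+ 2 * v ^+ 2 + u ^+ 5 + v ^+ 5 ->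
    v + a * u ^+ 2 + b * u = 0 -> u + b * v ^+ 2 + a * v = 0 ->
  exists U V : K, [/\ a = 2 * U, b = 2 * V, U != 0, V != 0 & U * V != 1 /\
    U ^+ 5 = 2 * U ^+ 3 * V ^+ 3 - U ^+ 2 * V ^+ 2 + U * V - V ^+ 5].
Proof.
move=> n2 u0 v0 uv1 uv4 g e1 e2.
pose D := 2 * (u * v * (u * v - 1)).
have D0 : D != 0 by rewrite !mulf_neq0 // subr_eq0.
have aE : a = 2 * ((u ^+ 2 - v ^+ 3) / D).
  apply: (mulIf D0); rewrite [RHS](_ : _ = 2 * (u ^+ 2 - v ^+ 3)); last by field.
  apply/eqP; rewrite -subr_eq0; apply/eqP.
  transitivity (2 * (v ^+ 2 * (v + a * u ^+ 2 + b * u) - u * (u + b * v ^+ 2 + a * v))).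
    by rewrite /D; ring.
  by rewrite e1 e2; ring.
have bE : b = 2 * ((v ^+ 2 - u ^+ 3) / D).
  apply: (mulIf D0); rewrite [RHS](_ : _ = 2 * (v ^+ 2 - u ^+ 3)); last by field.
  apply/eqP; rewrite -subr_eq0; apply/eqP.
  transitivity (2 * (u ^+ 2 * (u + b * v ^+ 2 + a * v) - v * (v + a * u ^+ 2 + b * u))).
    by rewrite /D; ring.
  by rewrite e1 e2; ring.
have g' : u ^+ 5 = 2 * u ^+ 3 * v ^+ 3 + u * v - u ^+ 2 * v ^+ 2 - v ^+ 5.
  by rewrite g; ring.
exists ((u ^+ 2 - v ^+ 3) / D), ((v ^+ 2 - u ^+ 3) / D).
move: ((u ^+ 2 - v ^+ 3) / D) ((v ^+ 2 - u ^+ 3) / D)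
  (divfK D0 (u ^+ 2 - v ^+ 3)) (divfK D0 (v ^+ 2 - u ^+ 3)) aE bE => U V UD VD aE bE.
have UVE : 4 * (u * v) * (U * V) = -1.
  apply: (mulIf (mulf_neq0 D0 D0)).
  transitivity (4 * (u * v) * ((U * D) * (V * D))); first by ring.
  by rewrite UD VD /D; ring: g'.
have UV0 : U * V != 0.
  by apply: contra_eq_neq UVE => ->; rewrite mulr0 eq_sym oppr_eq0 oner_eq0.
have [U0 V0] : U != 0 /\ V != 0 by move: UV0; rewrite mulf_eq0 negb_or => /andP.
split=> //; split.
  by apply: contra_neq uv4 => UV1; move: UVE; rewrite UV1 mulr1 => ->; rewrite subrr.
(* The sixth power clears the denominators of U^3 V^3, the term of highest degree; what remains
   follows from the quintic for u and v. *)
apply: (mulIf (expf_neq0 6 D0)).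
transitivity ((U * D) ^+ 5 * D); first by ring.
transitivity (2 * (U * D) ^+ 3 * (V * D) ^+ 3 - (U * D) ^+ 2 * (V * D) ^+ 2 * D ^+ 2 +
  (U * D) * (V * D) * D ^+ 4 - (V * D) ^+ 5 * D); last by ring.
by rewrite UD VD /D; ring: g'.
Qed.

Variable R : realType.
Notation C := R[i].
Variables eta tau : C.
Hypothesis eta0 : 0 < complex.Im eta.
Hypothesis tau2 : order_two_point eta tau.

(** The roots of unity in the denominators multiply to w^(j - i), whatever r is. So a common factor
    splits off each relation, nonzero because theta_(j - i) does not vanish at 0 for distinct i and
    j. *)
Lemma sklyanin_relationsP : exists u v : C,
  [/\ u != 0, v != 0, 1 + 4 * (u * v) != 0,
      2 * u ^+ 3 * v ^+ 3 + u * v = u ^+ 2 * v ^+ 2 + u ^+ 5 + v ^+ 5 &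
      forall (B : algType C) (y : 'Z_5 -> B), @sklyanin_relations R 5 eta tau B y <->
        forall i j, i != j -> reduced_relation u v y i j = 0].
Proof.
have [u [v [K [K' [u0 v0 uv4 g [K0 K'0 KE K'E]]]]]] := theta_constants eta0 tau2.
exists u, v; split=> // B y.
have w5 : ce (3 / 5 : C) ^+ 5 = 1.
  by rewrite -ceMn (_ : _ * _ = 3%:Z%:~R) ?ce_int // -pmulrn; field.
have w0 : ce (3 / 5 : C) != 0 by exact: ce_neq0.
move: (ce (3 / 5)) w5 w0 KE K'E => w w5 w0 KE K'E.
pose c (d : 'Z_5) := theta_ 5 eta (val d) 0 / (K' * K * w ^+ (val d)).
have c0 d : d != 0 -> c d != 0.
  move=> d0; apply: mulf_neq0; last by rewrite invr_eq0 !mulf_neq0 ?expf_neq0.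
  by apply: theta_0_neq0 => //; rewrite lt0n; apply/andP; split; last exact: ltn_ord d.
have vD (d e : 'Z_5) : val (d + e) = ((val d + val e) %% 5)%N by [].
have E (i j : 'Z_5) : i != j -> \sum_(r : 'Z_5) (theta_ 5 eta (val (j - i)) 0
       / (theta_ 5 eta (val (j - i - r)) (- tau) * theta_ 5 eta (val r) tau))
      *: (y (j - r) * y (i + r)) = c (j - i) *: reduced_relation u v y i j.
  move=> ij; rewrite /reduced_relation scaler_sumr; apply: eq_bigr => r _.
  rewrite scalerA; congr (_ *: _); rewrite (KE r) (K'E (j - i - r)).
  rewrite /c /theta_ratio.
  have -> : w ^+ val (j - i) = w ^+ val (j - i - r) * w ^+ val r.
    rewrite -exprD -(expr_mod (val (j - i - r) + val r) w5).
    by rewrite -vD subrK.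
  by rewrite !invfM; ring.
split=> rel i j ij; first last.
  by rewrite E // rel // scaler0.
have := rel i j ij; rewrite E // => /eqP; rewrite scaler_eq0 (negPf (c0 _ _)) ?subr_eq0 1?eq_sym //.
by move/eqP.
Qed.

Variables (A : algType C) (x : 'Z_5 -> A) (a b : C).
Hypothesis A_sklyanin : @is_sklyanin_algebra R 5 eta tau A x.
Hypothesis A_clifford : presented_by (@clifford_relations R a b) x.

(** Over the point (1, ..., 1) there is a Clifford module, whatever a and b are, and x_0^2 acts on
    it by 1. *)
Lemma sqr_x0_neq0 : x 0 ^+ 2 != 0.
Proof.
have [X modX] := exists_module4 (trmx_Qmx a b (fun=> 1)) (rank_leq_row _).
have [rho [_ /(_ 0) sq]] := rep_of_module A_clifford modX.
apply/eqP => x00; move/eqP: sq; rewrite x00 raddf0 eq_sym.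
by rewrite -[1%:M]/(1 : 'M[C]_4) oner_eq0.
Qed.

Lemma clifford_parameters : exists U V : C,
  [/\ a = 2 * U, b = 2 * V, U != 0, V != 0 & U * V != 1 /\
    U ^+ 5 = 2 * U ^+ 3 * V ^+ 3 - U ^+ 2 * V ^+ 2 + U * V - V ^+ 5].
Proof.
have [u [v [u0 v0 uv4 g relP]]] := sklyanin_relationsP.
have [relx univ] := A_sklyanin.
have [e14 e23] := A_clifford.1 0.
rewrite !addr0 in e14 e23.
have red := (relP A x).1 relx.
apply: (@quintic_clifford_parameters _ u v) => //.
(* The excluded module is a representation of A through its Sklyanin presentation, and there {x_1,
   x_4} = a x_0^2 would read 1 = 0. *)
- apply/eqP => uv1; have [y [yred y00 y14]] := exists_reduced_module uv1.
  have [[rho rhoE] _] := univ _ _ ((relP _ y).2 yred).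
  have := congr1 rho e14; rewrite rmorphD !rmorphM linearZ /= rmorphXn /= !rhoE.
  by rewrite y14 y00 scaler0 => /eqP; rewrite oner_eq0.
- have := red 4 1 isT; rewrite (reduced_relation41 u0 v0 e14 e23) => /eqP.
  rewrite scaler_eq0 (negPf sqr_x0_neq0) orbF mulf_eq0 invr_eq0 mulf_eq0 expf_eq0.
  by rewrite (negPf u0) (negPf v0) !orbF => /eqP.
- have := red 3 2 isT; rewrite (reduced_relation32 u0 v0 e14 e23) => /eqP.
  rewrite scaler_eq0 (negPf sqr_x0_neq0) orbF mulf_eq0 invr_eq0 mulf_eq0 expf_eq0.
  by rewrite (negPf u0) (negPf v0) !orbF => /eqP.
Qed.

End SklyaninClifford.

Theorem theorem8p3 (R : realType) (eta tau : R[i])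
    (eta_pos : 0 < complex.Im eta)
    (tau_order2 : order_two_point eta tau)
    (A : algType R[i]) (x : 'Z_5 -> A)
    (A_sklyanin : @is_sklyanin_algebra R 5 eta tau A x)
    (a b : R[i]) (A_clifford : presented_by (@clifford_relations R a b) x)
    (c5 : A) (c5_spec : is_central_c5 x a b c5) :
  [/\ forall m : set A, maximal_center_ideal m ->
        (exists2 rho : {lrmorphism A -> 'M[R[i]]_4},
           simple_rep rho & lies_above rho m) <-> ~ on_cone x a b m,
      forall m : set A, maximal_center_ideal m -> on_cone x a b m ->
        m <> vertex_ideal x c5 ->
        exists rho : {lrmorphism A -> 'M[R[i]]_2},
          [/\ simple_rep rho, lies_above rho m
            & forall rho' : {lrmorphism A -> 'M[R[i]]_2},
                simple_rep rho' -> lies_above rho' m -> isomorphic_reps rho rho']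
    & [/\ maximal_center_ideal (vertex_ideal x c5),
          on_cone x a b (vertex_ideal x c5),
          exists rho : {lrmorphism A -> 'M[R[i]]_1},
            [/\ forall i, rho (x i) = 0, simple_rep rho
              & lies_above rho (vertex_ideal x c5)]
        & ~ exists2 rho : {lrmorphism A -> 'M[R[i]]_2},
              simple_rep rho & lies_above rho (vertex_ideal x c5)]].
Proof.
have [U [V [aE bE U0 V0 [UV1 gUV]]]] :=
  clifford_parameters eta_pos tau_order2 A_sklyanin A_clifford.
have two_neq0 : (2 : R[i]) != 0 by rewrite pnatr_eq0.
apply: (simple_reps_over_center A_clifford c5_spec) => p rk.
  by move: rk; rewrite aE bE; exact: Qmx_rank_neq3.
move=> k; apply/eqP/negPn/negP => pk; move: rk; rewrite leqNgt => /negP[].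
(* Rank 1 was excluded for a nonzero coordinate of index 0; the cyclic shift moves the nonzero
   coordinate of p there. *)
pose p' i := p (i + k).
have : (1 < \rank (Qmx a b p'))%N.
  by rewrite aE bE; apply: Qmx_rank_neq1 => //; rewrite /p' add0r.
by rewrite /p' Qmx_shift; move/leq_trans; apply; exact: mxrank_mxsub.
Qed.
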